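(* Fix $k\ge1$. For $n\ge k$ let $\mathbf{S_{n,n}}=(S_{1,n},\dots,S_{n,n})^*$ be uniformly distributed on $\mathcal{M}_n(\mathbb{C})$ and $\mathbf{S_{k,n}}=(S_{1,n},\dots,S_{k,n})^*$ (a $kp\times p$ block column). Then $$\sqrt{8np}\,(A^{-1}\otimes I_p)(\mathbf{S_{k,n}}-\mathbf{S^0_k})\xrightarrow[n\to\infty]{\mathcal{D}}\mathbf{G}=(G_1,\dots,G_k)^*,$$ with $G_1,\dots,G_k$ i.i.d. GUE, $\mathbf{S^0_k}=(s^0_1I_p,\dots,s^0_kI_p)^*$, $s^0_j=2^{-2j}\binom{2j}{j}$, and $A$ the $k\times k$ lower triangular matrix with $a_{i,j}=2^{-2i+2}\binom{2i}{i-j}$ for $j\le i$, $a_{i,j}=0$ for $j>i$.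
   Context: $\mathcal{S}_p(\mathbb{C})$: complex hermitian $p\times p$ matrices with Lebesgue measure $dX=\prod_idx_{ii}\prod_{i<j}d\operatorname{Re}x_{ij}\,d\operatorname{Im}x_{ij}$. A complex matrix measure on $[0,1]$ is a $p\times p$ matrix of complex Borel measures with $\mu(B)$ hermitian nonnegative definite for every Borel $B$ and $\mu([0,1])=I_p$; $S_j=\int_0^1x^jd\mu$. $\mathcal{M}_n(\mathbb{C})\subset(\mathcal{S}_p(\mathbb{C}))^n$ is the set of moment vectors $(S_1,\dots,S_n)^*$, and the uniform distribution on it has density proportional to its indicator with respect to Lebesgue measure. $s^0_j=\int_0^1\frac{x^jdx}{\pi\sqrt{x(1-x)}}$ are the arcsine moments. $\otimes$ is the Kronecker product. GUE: density $(2\pi)^{-p/2}\pi^{-p(p-1)/2}e^{-\frac12\operatorname{tr}X^2}$ with respect to $dX$. *)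

(* Defs.v *)
From HB Require Import structures.
From mathcomp Require Import all_boot all_order all_algebra.
From mathcomp Require Import all_classical all_reals all_analysis.
From mathcomp Require Import complex.

Set Implicit Arguments.
Unset Strict Implicit.
Unset Printing Implicit Defensive.

Import Order.TTheory GRing.Theory Num.Theory.
Import numFieldNormedType.Exports.
Local Open Scope classical_set_scope.
Local Open Scope ring_scope.

Section Defs.
Variable R : realType.
Local Notation C := R[i].

Definition adjmx (m n : nat) (X : 'M[C]_(m, n)) : 'M[C]_(n, m) :=
  map_mx (@conjc R) X^T.

Definition herm_psd (p : nat) (X : 'M[C]_p) : Prop :=
  adjmx X = X /\ forall v : 'cV[C]_p, 0 <= (adjmx v *m X *m v) 0 0.

(* The hermitian matrix with real coordinates y:
   diagonal entry x_aa = y a a; for a < b, Re x_ab = y a b, Im x_ab = y b a.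
   Lebesgue measure dX on S_p(C) is Lebesgue measure in these p^2 real
   coordinates. *)
Definition herm_of (p : nat) (y : 'I_p -> 'I_p -> R) : 'M[C]_p :=
  \matrix_(a, b)
    if a == b then ((y a a) +i* 0)%C
    else if (a < b)%N then ((y a b) +i* (y b a))%C
    else ((y b a) -i* (y a b))%C.

Definition herm_coords (p : nat) (X : 'M[C]_p) : 'I_p * 'I_p -> R :=
  fun ab => let: (a, b) := ab in
    if a == b then complex.Re (X a a)
    else if (a < b)%N then complex.Re (X a b)
    else complex.Im (X b a).

Definition upd (I : eqType) (x : I -> R) (i : I) (t : R) : I -> R :=
  fun j => if j == i then t else x j.

(* iterated one-dimensional Lebesgue integrals (= integral w.r.t. the
   product Lebesgue measure on R^I, by Fubini) *)
Fixpoint iter_leb_int (I : eqType) (s : seq I) (f : (I -> R) -> \bar R)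
    (x : I -> R) : \bar R :=
  if s is i :: s' then
    (\int[@lebesgue_measure R]_t iter_leb_int s' f (upd x i t))%E
  else f x.

Definition leb_int (I : finType) (f : (I -> R) -> \bar R) : \bar R :=
  iter_leb_int (enum I) f (fun _ => 0).

Definition I01 : set R := [set x | 0 <= x <= 1].

Definition real_sigma_additive (rho : set R -> R) : Prop :=
  forall F : nat -> set R, (forall i, measurable (F i)) ->
    trivIset setT F ->
    (fun n => \sum_(i < n) rho (F i)) @ \oo --> rho (\bigcup_i F i).

Definition complex_measure01 (nu : set R -> C) : Prop :=
  [/\ real_sigma_additive (fun B => complex.Re (nu B)),
      real_sigma_additive (fun B => complex.Im (nu B)) &
      forall B, measurable B -> nu B = nu (B `&` I01)].

Definition matrix_measure01 (p : nat) (mu : set R -> 'M[C]_p) : Prop :=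
  [/\ forall a b, complex_measure01 (fun B => mu B a b),
      forall B, measurable B -> herm_psd (mu B) &
      mu I01 = 1%:M].

(* Jordan decomposition of a finite signed measure rho:
   rho^+(B) = sup {rho(D) : D Borel, D subset of B}, rho^- = (-rho)^+ *)
Definition pos_variation (rho : set R -> R) : set R -> \bar R :=
  fun B => ereal_sup [set (rho D)%:E | D in [set D | measurable D /\ D `<=` B]].

Definition signed_int01 (rho : set R -> R) (f : R -> R) : R :=
  fine (\int[pos_variation rho]_(x in I01) (f x)%:E)%E
  - fine (\int[pos_variation (fun B => (- rho B)%R)]_(x in I01) (f x)%:E)%E.

Definition complex_int01 (nu : set R -> C) (f : R -> R) : C :=
  ((signed_int01 (fun B => complex.Re (nu B)) f)
     +i* (signed_int01 (fun B => complex.Im (nu B)) f))%C.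

Definition moment (p : nat) (mu : set R -> 'M[C]_p) (j : nat) : 'M[C]_p :=
  \matrix_(a, b) complex_int01 (fun B => mu B a b) (fun x => x ^+ j).

(* M_n(C), in coordinates: x(j, .) are the coordinates of S_{j+1} *)
Definition moment_space (p n : nat) : set ('I_n * ('I_p * 'I_p) -> R) :=
  [set x | exists mu : set R -> 'M[C]_p, matrix_measure01 mu /\
     forall j : 'I_n, herm_of (fun a b => x (j, (a, b))) = moment mu j.+1].

Definition s0 (j : nat) : R := (2%:R ^- (2 * j)) * ('C(2 * j, j))%:R.

(* A (0-based indices): a_{i,j} = 2^{-2i+2} binom(2i, i-j) (1-based, j <= i) *)
Definition Amat (k : nat) : 'M[R]_k :=
  \matrix_(i, j) if (j <= i)%N
                 then (2%:R ^- (2 * i)) * ('C((2 * i).+2, i - j))%:R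
                 else 0.

(* sqrt(8np) (A^{-1} (x) I_p) (S_k - S^0_k), blockwise *)
Definition scaled_stat (p k n : nat) (S : 'I_k -> 'M[C]_p) : 'I_k -> 'M[C]_p :=
  fun i => (Num.sqrt (8 * n * p)%:R)%:C%C *:
    \sum_(j < k) ((invmx (Amat k)) i j)%:C%C *: (S j - ((s0 j.+1)%:C%C)%:M).

Definition vec_coords (p k : nat) (Y : 'I_k -> 'M[C]_p) :
    'I_k * ('I_p * 'I_p) -> R :=
  fun jab => herm_coords (Y jab.1) jab.2.

(* E[h(sqrt(8np)(A^{-1} (x) I_p)(S_{k,n} - S^0_k))] for S_{n,n} uniform on
   M_n(C), with n = k + m *)
Definition expect_stat (p k m : nat) (h : ('I_k * ('I_p * 'I_p) -> R) -> R) : R :=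
  let n := (k + m)%N in
  let S (x : 'I_n * ('I_p * 'I_p) -> R) (j : 'I_k) : 'M[C]_p :=
    herm_of (fun a b => x (widen_ord (leq_addr m k) j, (a, b))) in
  fine (leb_int (fun x => (\1_(@moment_space p n) x * h (vec_coords (@scaled_stat p k n (S x))))%:E))
  / fine (leb_int (fun x => (\1_(@moment_space p n) x)%:E)).

Definition gue_density (p : nat) (X : 'M[C]_p) : R :=
  expR (- complex.Re (\tr (X *m X)) / 2)
  / (Num.sqrt (2 * pi) ^+ p * pi ^+ 'C(p, 2)).

Definition expect_GUE (p k : nat) (h : ('I_k * ('I_p * 'I_p) -> R) -> R) : R :=
  fine (leb_int (fun y : 'I_k * ('I_p * 'I_p) -> R =>
    ((\prod_(j < k) gue_density (herm_of (fun a b => y (j, (a, b))))) * h y)%:E)).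

Definition bounded_continuous (I : finType) (h : (I -> R) -> R) : Prop :=
  (exists M : R, forall x, `|h x| <= M) /\
  (forall x (e : R), 0 < e -> exists2 d : R, 0 < d &
     forall y, (forall i, `|x i - y i| < d) -> `|h x - h y| < e).

End Defs.

(* Main.v *)
(** Write S_i = s0_i I + (1/2) sum_j A_ij C_j with hermitian C_1, ..., C_n, and
    C_0 = I.  As ((1 + Re d)/2)^i = s0_i + (1/2) sum_j A_ij Re d^j for |d| = 1,
    the vector (S_i) lies in the moment space iff the block Toeplitz matrix
    T_(n+1) = (C_|i-j|) is nonnegative definite.  By Schur complements, the fibre
    of C_(j+1) over (C_1, ..., C_j) is a translate of {X : -D < X < D}, where
    det D = det T_(j+1) / det T_j, and the integral of (det(D + X) det(D - X))^N
    over this set is a constant times det D^(2N+p).  Integrating out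
    C_n, ..., C_(k+1) therefore leaves on (C_1, ..., C_k) the density
    (det T_(k+1) / det T_k)^(p(n-k)) up to a constant.  With
    C_j = W_j / sqrt(2np) this tends to exp(-(1/2) sum_j tr W_j^2) and is
    dominated by a Gaussian, so dominated convergence applies. *)

Require Import Defs.
From HB Require Import structures.
From mathcomp Require Import all_boot all_order all_algebra fingroup perm.
From mathcomp Require Import all_classical all_reals all_analysis.
From mathcomp Require Import measurable_realfun complex.
From mathcomp Require Import ring lra zify.
Set Implicit Arguments.
Unset Strict Implicit.
Unset Printing Implicit Defensive.
Import Order.TTheory GRing.Theory Num.Theory.
Import numFieldNormedType.Exports.
Local Open Scope classical_set_scope.
Local Open Scope ring_scope.

(** * Iterated Lebesgue integrals *)

(** Lebesgue measure on matrices is an iterated one-dimensional integral, so each linear change of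
    variables is assembled from two kinds: scaling of single coordinates, and shears shifting some
    coordinates by functions of the others. The passage from the C_j to the S_i is triangular and
    factors in this way; so does X -> B X B^* for the matrices B that bring D to diagonal form and
    then to the identity. The constants that arise do not depend on the test function h and cancel
    in the quotient defining the expectation. Limits are taken separately for the nonnegative
    functions h + B, with |h| <= B, and 1. For the moment space, one inclusion builds a measure with
    finitely many atoms out of a unitary matrix. The other replaces the given measure by its masses
    on small cells, because the integral against a signed measure, defined by suprema, is most
    easily reached as a limit of sums. Schur complements need invertible matrices while the moment
    space is closed: contracting (C_j) by t < 1 carries the closed set into its interior, so the
    boundary is negligible. The factor sqrt(8np) is 2 sqrt(2np); the 2 undoes the 1/2 in front of
    the sum over A_ij C_j. *)

Section LebesgueAffine.
Variable R : realType.
Local Notation mu := (@lebesgue_measure R).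
Local Open Scope ereal_scope.

(** The image of Lebesgue measure under the affine map, multiplied by [c], agrees with Lebesgue
    measure on half-open intervals, hence on all Borel sets. *)
Lemma ge0_integral_affine (c d : R) (f : R -> \bar R) : (0 < c)%R ->
  measurable_fun setT f -> (forall x, 0 <= f x) ->
  \int[mu]_x f (c * x + d)%R = (c^-1)%:E * \int[mu]_x f x.
Proof.
move=> c0 mf f0.
pose phi := (fun x : R => (c * x + d)%R : measurableTypeR R).
have mphi : measurable_fun setT (phi : measurableTypeR R -> measurableTypeR R).
  apply: measurable_funD => //; exact: measurable_funM.
pose nu0 := mscale (NngNum (ltW c0)) (pushforward mu phi).
pose nu := nu0 mphi.
have E : forall A, measurable A -> mu A = nu A.
  apply: lebesgue_measure_unique => _ [[a b] _ <-].
  have P : phi @^-1` `]a, b]%classic = `]((a - d) / c)%R, ((b - d) / c)%R]%classic.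
    apply/seteqP; split=> x /=; rewrite !in_itv/= ltr_pdivrMr// ler_pdivlMr// /phi;
    by rewrite ltrBlDr lerBrDr (mulrC c).
  change (mu `]a, b]%classic = c%:E * mu (phi @^-1` `]a, b]%classic)); rewrite P.
  rewrite !lebesgue_measure_itv /= !lte_fin ltr_pM2r ?invr_gt0// ltrD2r.
  case: ifP => ab; last by rewrite mule0.
  rewrite -!EFinB -!EFinM; congr EFin.
  by rewrite -mulrBl mulrCA divff ?gt_eqF// mulr1 opprB addrA subrK.
have -> : \int[mu]_x f x = \int[nu]_x f x.
  by apply: eq_measure_integral => A mA _; exact: E.
rewrite ge0_integral_mscale//= ge0_integral_pushforward//= preimage_setT.
by rewrite muleA -EFinM mulVf ?gt_eqF// mul1e.
Qed.
End LebesgueAffine.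

Section Iter.
Variable R : realType.
Variable I : eqType.
Local Notation mu := (@lebesgue_measure R).
Local Open Scope ereal_scope.

(** Generators of the product sigma-algebra. The index type may be infinite: later it is
    [nat * idx], so that Toeplitz matrices of all sizes are functions on one and the same space. *)
Definition coordinate_cylinders : set (set (I -> R)) :=
  [set A | exists i (B : set R), measurable B /\ A = (fun x => x i) @^-1` B].
Definition RI := g_sigma_algebraType coordinate_cylinders.

Lemma measurable_coord (i : I) :
  measurable_fun setT (fun x : RI => (x i : measurableTypeR R)).
Proof.
move=> _ B mB; rewrite setTI; apply: sub_sigma_algebra; by exists i, B.
Qed.

Lemma measurable_into_RI d (T : measurableType d) (g : T -> RI) :
  (forall i, measurable_fun setT (fun t => g t i)) -> measurable_fun setT g.
Proof.
move=> mg; refine (@measurability _ _ T RI setT g coordinate_cylinders _ _) => //.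
by move=> _ [_ [i [B [mB ->]]] <-]; have := mg i measurableT B mB.
Qed.

Lemma measurable_upd d (T : measurableType d) (g : T -> RI) (i : I) (h : T -> R) :
  measurable_fun setT g -> measurable_fun setT h ->
  measurable_fun setT (fun t => upd (g t) i (h t) : RI).
Proof.
move=> mg mh; apply: measurable_into_RI => j; rewrite /upd.
case: (j == i) => //.
exact: (measurableT_comp (measurable_coord j) mg).
Qed.

Local Notation Mf f := (measurable_fun [set: RI] (f : RI -> \bar R)).
Implicit Types (f g : (I -> R) -> \bar R) (s : seq I) (x : I -> R).

Lemma iter_leb_int_cat s1 s2 f x :
  iter_leb_int (s1 ++ s2) f x = iter_leb_int s1 (iter_leb_int s2 f) x.
Proof.
elim: s1 x => //= i s1 IH x.
by apply: eq_integral => t _; rewrite IH.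
Qed.

Lemma iter_leb_int_ge0 s f x : (forall x, 0 <= f x) -> 0 <= iter_leb_int s f x.
Proof. by move=> f0; elim: s x => //= i s IH x; apply: integral_ge0. Qed.

Lemma measurable_iter_leb_int s f :
  Mf f -> (forall x, 0 <= f x) -> Mf (iter_leb_int s f).
Proof.
move=> mf f0; elim: s => //= i s IH.
pose F := fun z : RI * measurableTypeR R => iter_leb_int s f (upd z.1 i z.2).
have mF : measurable_fun setT F.
  apply: (measurableT_comp (g := fun z : RI * measurableTypeR R => upd z.1 i z.2 : RI) IH).
  exact: measurable_upd.
apply: (@measurable_fun_fubini_tonelli_F _ _ RI (measurableTypeR R) R mu F mF) => z.
exact: iter_leb_int_ge0.
Qed.

Lemma measurable_iter_section s f x i : Mf f -> (forall x, 0 <= f x) ->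
  measurable_fun [set: R] (fun t => iter_leb_int s f (upd x i t)).
Proof.
move=> mf f0.
apply: (measurableT_comp (g := fun t : R => upd x i t : RI)
  (measurable_iter_leb_int s mf f0)).
apply: (measurable_upd (g := fun=> x : RI)) => //; exact: measurable_cst.
Qed.

Lemma eq_iter_leb_int s f g x :
  (forall y, (forall j, j \notin s -> y j = x j) -> f y = g y) ->
  iter_leb_int s f x = iter_leb_int s g x.
Proof.
elim: s x => [|i s IH] x fg /=; first exact: fg.
apply: eq_integral => t _; apply: IH => y yx; apply: fg => j.
rewrite inE negb_or => /andP[ji js]; rewrite yx// /upd.
by rewrite (negbTE ji).
Qed.

Lemma iter_leb_int_outer s f x y : (forall j, j \notin s -> x j = y j) ->
  iter_leb_int s f x = iter_leb_int s f y.
Proof.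
elim: s x y => [|i s IH] x y xy /=; first by congr f; apply/funext => j; exact: xy.
apply: eq_integral => t _; apply: IH => j js; rewrite /upd.
by case: eqP => // /eqP ji; apply: xy; rewrite inE negb_or ji.
Qed.

Lemma le_iter_leb_int s f g x : Mf f -> Mf g -> (forall x, 0 <= f x) ->
  (forall x, f x <= g x) -> iter_leb_int s f x <= iter_leb_int s g x.
Proof.
move=> mf mg f0 fg.
have g0 z : 0 <= g z by exact: le_trans (f0 z) (fg z).
elim: s x => //= i s IH x; apply: ge0_le_integral => //.
- by move=> t _; exact: iter_leb_int_ge0.
- exact: measurable_iter_section.
- exact: measurable_iter_section.
Qed.

Lemma iter_leb_intD s f g x : Mf f -> Mf g -> (forall x, 0 <= f x) ->
  (forall x, 0 <= g x) ->
  iter_leb_int s (fun y => f y + g y) x = iter_leb_int s f x + iter_leb_int s g x.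
Proof.
move=> mf mg f0 g0.
elim: s x => //= i s IH x; under eq_integral do rewrite IH.
rewrite ge0_integralD//.
- by move=> t _; exact: iter_leb_int_ge0.
- exact: measurable_iter_section.
- by move=> t _; exact: iter_leb_int_ge0.
- exact: measurable_iter_section.
Qed.

Lemma iter_leb_intZ s f k x : Mf f -> (forall x, 0 <= f x) -> 0 <= k ->
  iter_leb_int s (fun y => k * f y) x = k * iter_leb_int s f x.
Proof.
move=> mf f0 k0.
elim: s x => //= i s IH x; under eq_integral do rewrite IH.
rewrite ge0_integralZl//.
- exact: measurable_iter_section.
- by move=> t _; exact: iter_leb_int_ge0.
Qed.

Lemma updC x i j t u : i != j -> upd (upd x i t) j u = upd (upd x j u) i t.
Proof.
move=> ij; apply/funext => l; rewrite /upd.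
by have [->|//] := eqVneq l j; rewrite eq_sym (negbTE ij).
Qed.

Lemma iter_leb_int_swap i j s f x : Mf f -> (forall x, 0 <= f x) ->
  iter_leb_int [:: i, j & s] f x = iter_leb_int [:: j, i & s] f x.
Proof.
move=> mf f0; have [->//|ij] := eqVneq i j.
pose F := fun z : measurableTypeR R * measurableTypeR R =>
  iter_leb_int s f (upd (upd x i z.1) j z.2).
have mF : measurable_fun setT F.
  apply: (measurableT_comp (g := fun z : measurableTypeR R * measurableTypeR R =>
    upd (upd x i z.1) j z.2 : RI) (measurable_iter_leb_int s mf f0)).
  by apply: measurable_upd => //; exact: (measurable_upd (g := fun=> x : RI)).
have F0 z : 0 <= F z by exact: iter_leb_int_ge0.
rewrite /= (@fubini_tonelli _ _ _ _ _ mu mu F mF F0).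
by apply: eq_integral => t _; apply: eq_integral => u _; rewrite /F/= updC.
Qed.

Lemma iter_leb_int_perm s1 s2 f x : Mf f -> (forall x, 0 <= f x) ->
  perm_eq s1 s2 -> iter_leb_int s1 f x = iter_leb_int s2 f x.
Proof.
move=> mf f0.
have front i r1 r2 y : iter_leb_int (r1 ++ i :: r2) f y = iter_leb_int (i :: r1 ++ r2) f y.
  elim: r1 y => // j r1 IH y.
  rewrite [RHS]iter_leb_int_swap//=.
  by apply: eq_integral => t _; rewrite IH.
elim: s1 s2 x => [|i s1 IH] s2 x p12.
  by have := perm_size p12; case: s2 {p12}.
have : i \in s2 by rewrite -(perm_mem p12) mem_head.
move=> /splitPr is2; case: is2 p12 => r1 r2 p12.
rewrite front /=; apply: eq_integral => t _; apply: IH.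
by rewrite -(perm_cons i) (perm_trans p12)// perm_catC /= perm_cons perm_catC.
Qed.

Definition affine_on s (c d : I -> R) x : I -> R :=
  fun j => if j \in s then (c j * x j + d j)%R else x j.

Lemma measurable_affine_on s c d :
  measurable_fun [set: RI] (affine_on s c d : RI -> RI).
Proof.
apply: measurable_into_RI => j.
have -> : (fun t => affine_on s c d t j) =
    if j \in s then (fun t : RI => c j * t j + d j)%R else (fun t => t j).
  by apply/funext => t; rewrite /affine_on; case: ifP.
case: ifP => _; last exact: measurable_coord.
apply: measurable_funD => //; apply: measurable_funM => //; exact: measurable_coord.
Qed.

Lemma iter_leb_int_upd s f i (e : R -> R) y : i \notin s ->
  iter_leb_int s (fun z => f (upd z i (e (z i)))) y =
  iter_leb_int s f (upd y i (e (y i))).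
Proof.
elim: s y => //= j s IH y; rewrite inE negb_or => /andP[ij is_].
apply: eq_integral => u _.
rewrite IH// updC 1?eq_sym//; congr iter_leb_int.
by rewrite [upd y j u i]/upd (negbTE ij).
Qed.

Lemma iter_leb_int_affine s c d f x : uniq s -> (forall j, 0 < c j)%R -> Mf f ->
  (forall x, 0 <= f x) ->
  iter_leb_int s (fun y => f (affine_on s c d y)) x =
  (\prod_(j <- s) (c j)^-1)%:E * iter_leb_int s f x.
Proof.
move=> + c0 mf f0; elim: s x => [|i s IH] x.
  by rewrite big_nil mul1e /affine_on/= => _; congr f; apply/funext.
move=> /= /andP[is_ us].
have E t : iter_leb_int s (fun y => f (affine_on (i :: s) c d y)) (upd x i t) =
  iter_leb_int s (fun y => f (affine_on s c d y)) (upd x i (c i * t + d i)%R).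
  pose e u := (c i * u + d i)%R.
  have -> : upd x i (c i * t + d i)%R = upd (upd x i t) i (e (upd x i t i)).
    by apply/funext => j; rewrite /upd eqxx; case: eqP.
  rewrite -(iter_leb_int_upd (fun y => f (affine_on s c d y)) e)//.
  congr (iter_leb_int s _ _); apply/funext => y; congr f; apply/funext => j.
  rewrite /affine_on /upd inE; have [->|ji]//= := eqVneq j i.
  by rewrite (negbTE is_).
under eq_integral do rewrite E IH//.
rewrite ge0_integralZl//; last 3 first.
- have := measurable_iter_section s x i mf f0 => h.
  apply: (measurableT_comp (g := fun t : R => (c i * t + d i)%R : R) h).
  by apply: measurable_funD => //; exact: measurable_funM.
- by move=> t _; exact: iter_leb_int_ge0.
- by rewrite lee_fin big_seq prodr_ge0// => j _; rewrite invr_ge0 ltW.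
rewrite (@ge0_integral_affine R (c i) (d i) (fun t => iter_leb_int s f (upd x i t)))//.
- by rewrite muleA -EFinM big_cons mulrC.
- exact: measurable_iter_section.
- by move=> t; exact: iter_leb_int_ge0.
Qed.

(** Once the coordinates outside [s2] are fixed, [g y] is a constant vector, and the inner integral
    over [s2] is translation invariant. Non-diagonal linear changes of variables are later composed
    of such shears. *)
Lemma iter_leb_int_shift s1 s2 (g : (I -> R) -> I -> R) f x : uniq s2 ->
  Mf f -> (forall x, 0 <= f x) ->
  (forall y j, j \notin s2 -> g y j = 0%R) ->
  (forall y z, (forall j, j \notin s2 -> y j = z j) -> g y = g z) ->
  iter_leb_int (s1 ++ s2) (fun y => f (fun j => (y j + g y j)%R)) x =
  iter_leb_int (s1 ++ s2) f x.
Proof.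
move=> u2 mf f0 g0 gdep; rewrite !iter_leb_int_cat; congr iter_leb_int.
apply/funext => {}x.
transitivity (iter_leb_int s2 (fun y => f (affine_on s2 (fun=> 1%R) (g x) y)) x).
  apply: eq_iter_leb_int => y yx; congr f; apply/funext => j.
  rewrite /affine_on (gdep y x)// mul1r; case: ifPn => // js.
  by rewrite g0// addr0.
rewrite iter_leb_int_affine// big1 ?mul1e// => j _; exact: invr1.
Qed.

(** Dominated convergence is applied to one variable at a time, so the majorant must have a finite
    integral over every tail of [s] and at every point; a finite total integral would give this only
    almost everywhere. *)
Lemma iter_leb_int_cvg s (f_ : nat -> (I -> R) -> \bar R) f G x :
  (forall n, Mf (f_ n)) -> (forall n x, 0 <= f_ n x) ->
  (forall n x, f_ n x <= G x) -> Mf G ->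
  (forall r x, suffix r s -> iter_leb_int r G x < +oo) ->
  (forall x, f_ ^~ x @ \oo --> f x) ->
  (fun n => iter_leb_int s (f_ n) x) @ \oo --> iter_leb_int s f x.
Proof.
move=> mf f0 fG mG + ff.
have G0 z : 0 <= G z by exact: le_trans (f0 0%N z) (fG 0%N z).
elim: s x => [|i s IH] x fin /=; first exact: ff.
have fins r y : suffix r s -> iter_leb_int r G y < +oo.
  by move=> rs; apply: fin; apply: suffix_trans rs (suffix_suffix [:: i] s).
apply: (@dominated_cvg _ _ R mu setT measurableT _ _ (fun t => iter_leb_int s G (upd x i t))).
- by move=> n; exact: measurable_iter_section.
- by move=> t _; exact: IH.
- by move=> t _; rewrite ge0_fin_numE ?fins// ?suffix_refl//; exact: iter_leb_int_ge0.
- apply/integrableP; split; first exact: measurable_iter_section.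
  under eq_integral do rewrite gee0_abs ?iter_leb_int_ge0//.
  by have := fin (i :: s) x (suffix_refl _).
- move=> n t _; rewrite gee0_abs ?iter_leb_int_ge0//.
  exact: le_iter_leb_int.
Qed.

(** Reduces a signed integrand to nonnegative ones by h = (h + B) - B. The difference passes through
    each integration because both terms have finite integrals over the tails. *)
Lemma iter_leb_int_signed s (W h : (I -> R) -> R) (B : R) x :
  measurable_fun [set: RI] (W : RI -> R) -> measurable_fun [set: RI] (h : RI -> R) ->
  (forall x, 0 <= W x)%R -> (forall x, `|h x| <= B)%R ->
  (forall r x, suffix r s -> iter_leb_int r (fun y => (W y)%:E) x < +oo) ->
  iter_leb_int s (fun y => (W y * h y)%:E) x =
  iter_leb_int s (fun y => (W y * (h y + B))%:E) x
  - B%:E * iter_leb_int s (fun y => (W y)%:E) x.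
Proof.
move=> mW mh W0 hB.
have B0 : (0 <= B)%R by exact: le_trans (hB (fun=> 0%R)).
have hB0 y : (0 <= h y + B)%R by have := hB y; rewrite ler_norml -lerBlDr sub0r => /andP[].
have hB2 y : (h y + B <= B *+ 2)%R.
  by rewrite mulr2n lerD2r; have := hB y; rewrite ler_norml => /andP[].
have mWE : Mf (fun y => (W y)%:E) by exact/measurable_EFinP.
have mF : Mf (fun y => (W y * (h y + B))%:E).
  by apply/measurable_EFinP; apply: measurable_funM => //; exact: measurable_funD.
have F0 y : 0 <= (W y * (h y + B))%:E by rewrite lee_fin mulr_ge0.
have WE0 y : 0 <= (W y)%:E by rewrite lee_fin.
elim: s x => [|i s IH] x fin /=; first by congr (_%:E); rewrite mulrDr (mulrC B) addrK.
have fins r y : suffix r s -> iter_leb_int r (fun y => (W y)%:E) y < +oo.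
  by move=> rs; apply: fin; apply: suffix_trans rs (suffix_suffix [:: i] s).
under eq_integral do rewrite IH//.
have bnd y : iter_leb_int s (fun y => (W y * (h y + B))%:E) y <=
    (B *+ 2)%:E * iter_leb_int s (fun y => (W y)%:E) y.
  rewrite -iter_leb_intZ// ?lee_fin ?mulrn_wge0//; apply: le_iter_leb_int => //.
    by apply: measurable_funeM.
  by move=> z; rewrite -EFinM lee_fin mulrC ler_wpM2r.
have intW : mu.-integrable setT (fun t => iter_leb_int s (fun y => (W y)%:E) (upd x i t)).
  apply/integrableP; split; first exact: measurable_iter_section.
  under eq_integral do rewrite gee0_abs ?iter_leb_int_ge0//.
  by have := fin (i :: s) x (suffix_refl _).
rewrite integralB//; last 2 first.
- apply: (le_integrable measurableT _ _ (integrableZl measurableT (B *+ 2) intW)) => //.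
    exact: measurable_iter_section.
  move=> t _; rewrite gee0_abs ?iter_leb_int_ge0// gee0_abs ?bnd//.
  by rewrite mule_ge0// ?lee_fin ?mulrn_wge0// iter_leb_int_ge0.
- exact: integrableZl.
by congr (_ - _); rewrite integralZl.
Qed.

Lemma iter_leb_int_prod s (K : (I -> R) -> R) (u : I -> R -> R) (v : I -> R) x :
  uniq s -> (forall j, measurable_fun setT (u j)) -> (forall j t, 0 <= u j t)%R ->
  (forall j, \int[mu]_t (u j t)%:E = (v j)%:E) -> (0 <= K x)%R ->
  (forall y, (forall j, j \notin s -> y j = x j) -> K y = K x) ->
  iter_leb_int s (fun y => (K y * \prod_(j <- s) u j (y j))%:E) x =
  (K x * \prod_(j <- s) v j)%:E.
Proof.
move=> us mu_ u0 uv K0 Kx.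
transitivity (iter_leb_int s (fun y => (K x * \prod_(j <- s) u j (y j))%:E) x).
  by apply: eq_iter_leb_int => y /Kx ->.
move: (K x) K0 us {Kx} => k k0.
elim: s x k k0 => [|i s IH] x k k0 /=; first by rewrite !big_nil.
move=> /andP[is_ us].
transitivity (\int[mu]_t (k * u i t * \prod_(j <- s) v j)%:E).
  apply: eq_integral => t _; rewrite -(IH (upd x i t))//; last by rewrite mulr_ge0.
  apply: eq_iter_leb_int => y yx.
  by rewrite big_cons mulrA yx// /upd eqxx.
have v0 j : (0 <= v j)%R by rewrite -lee_fin -uv integral_ge0// => t _; rewrite lee_fin.
transitivity (\int[mu]_t ((k * \prod_(j <- s) v j)%:E * (u i t)%:E)).
  by apply: eq_integral => t _; rewrite -EFinM mulrAC.
rewrite ge0_integralZl//.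
- by rewrite uv -EFinM big_cons -mulrA (mulrC (v i)) .
- by have /measurable_EFinP := mu_ i.
- by move=> t _; rewrite lee_fin.
- by rewrite lee_fin mulr_ge0// prodr_ge0.
Qed.
End Iter.

(** Renaming of variables, used to compare integrals over a finite index type with integrals over
    some coordinates of an infinite sequence. *)
Lemma iter_leb_int_map (R : realType) (I J : eqType) (phi : J -> I) (s : seq J)
    (f : (I -> R) -> \bar R) (ext : (J -> R) -> I -> R) (z : J -> R) :
  (forall z j t, ext (upd z j t) = upd (ext z) (phi j) t) ->
  iter_leb_int (map phi s) f (ext z) = iter_leb_int s (fun z => f (ext z)) z.
Proof.
move=> E; elim: s z => //= j s IH z.
by apply: eq_integral => t _; rewrite -IH E.
Qed.

(** * Positive definite matrices *)

Section HermitianMatrices.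
Variable R : realType.
Local Notation C := R[i].
Local Notation "x %:C" := (real_complex R x) : ring_scope.

Lemma adjmxE m n (X : 'M[C]_(m, n)) i j : adjmx X i j = conjc (X j i).
Proof. by rewrite !mxE. Qed.

Lemma adjmxK m n (X : 'M[C]_(m, n)) : adjmx (adjmx X) = X.
Proof. by apply/matrixP => i j; rewrite !adjmxE conjcK. Qed.

Lemma adjmxM m n p (X : 'M[C]_(m, n)) (Y : 'M[C]_(n, p)) :
  adjmx (X *m Y) = adjmx Y *m adjmx X.
Proof. by rewrite /adjmx trmx_mul map_mxM. Qed.

Lemma adjmxD m n (X Y : 'M[C]_(m, n)) : adjmx (X + Y) = adjmx X + adjmx Y.
Proof. by rewrite /adjmx linearD/= map_mxD. Qed.

Lemma adjmxN m n (X : 'M[C]_(m, n)) : adjmx (- X) = - adjmx X.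
Proof. by rewrite /adjmx linearN/= map_mxN. Qed.

Lemma adjmxB m n (X Y : 'M[C]_(m, n)) : adjmx (X - Y) = adjmx X - adjmx Y.
Proof. by rewrite adjmxD adjmxN. Qed.

Lemma adjmx0 m n : adjmx (0 : 'M[C]_(m, n)) = 0.
Proof. by rewrite /adjmx trmx0 map_mx0. Qed.

Lemma adjmx1 n : adjmx (1%:M : 'M[C]_n) = 1%:M.
Proof. by rewrite /adjmx trmx1 map_mx1. Qed.

Lemma adjmxZ m n (a : C) (X : 'M[C]_(m, n)) : adjmx (a *: X) = conjc a *: adjmx X.
Proof. by rewrite /adjmx linearZ/= map_mxZ. Qed.

Lemma adjmx_sum m n I (r : seq I) (P : pred I) (F : I -> 'M[C]_(m, n)) :
  adjmx (\sum_(i <- r | P i) F i) = \sum_(i <- r | P i) adjmx (F i).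
Proof. by apply: (big_morph _ (@adjmxD m n) (adjmx0 m n)). Qed.

Lemma adjmx_block m1 m2 n1 n2 (A : 'M[C]_(m1, n1)) B D (E : 'M[C]_(m2, n2)) :
  adjmx (block_mx A B D E) = block_mx (adjmx A) (adjmx D) (adjmx B) (adjmx E).
Proof. by rewrite /adjmx tr_block_mx map_block_mx. Qed.

Lemma adjmx_col m1 m2 n (A : 'M[C]_(m1, n)) (B : 'M[C]_(m2, n)) :
  adjmx (col_mx A B) = row_mx (adjmx A) (adjmx B).
Proof. by rewrite /adjmx tr_col_mx map_row_mx. Qed.

Lemma adjmx_row m n1 n2 (A : 'M[C]_(m, n1)) (B : 'M[C]_(m, n2)) :
  adjmx (row_mx A B) = col_mx (adjmx A) (adjmx B).
Proof. by rewrite /adjmx tr_row_mx map_col_mx. Qed.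

Lemma det_adjmx n (X : 'M[C]_n) : \det (adjmx X) = conjc (\det X).
Proof. by rewrite /adjmx det_map_mx det_tr. Qed.

Lemma adjmx_unit n (X : 'M[C]_n) : (adjmx X \in unitmx) = (X \in unitmx).
Proof. by rewrite !unitmxE !unitfE det_adjmx conjc_eq0. Qed.

Lemma adjmx_inv n (X : 'M[C]_n) : adjmx (invmx X) = invmx (adjmx X).
Proof. by rewrite /adjmx trmx_inv map_invmx. Qed.

Lemma mul_conjc_ge0 (z : C) : 0 <= conjc z * z.
Proof. by rewrite mulrC mulcJ_ge0. Qed.

Definition qf n (X : 'M[C]_n) (v : 'cV[C]_n) : C := (adjmx v *m X *m v) 0 0.

Definition pd n (X : 'M[C]_n) : Prop :=
  adjmx X = X /\ forall v : 'cV[C]_n, v != 0 -> 0 < qf X v.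

Lemma qf0 n (X : 'M[C]_n) : qf X 0 = 0.
Proof. by rewrite /qf mulmx0 mxE. Qed.

Lemma qfD n (X Y : 'M[C]_n) v : qf (X + Y) v = qf X v + qf Y v.
Proof. by rewrite /qf mulmxDr mulmxDl mxE. Qed.

Lemma qfZ n (a : C) (X : 'M[C]_n) v : qf (a *: X) v = a * qf X v.
Proof. by rewrite /qf -scalemxAr -scalemxAl mxE. Qed.

Lemma qf_congr m n (B : 'M[C]_(m, n)) X v :
  qf (B *m X *m adjmx B) v = qf X (adjmx B *m v).
Proof. by rewrite /qf adjmxM adjmxK !mulmxA. Qed.

Lemma qf_diag n (d : 'rV[C]_n) v :
  qf (diag_mx d) v = \sum_i d 0 i * (conjc (v i 0) * v i 0).
Proof.
rewrite /qf mxE; apply: eq_bigr => i _.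
by rewrite mul_mx_diag mxE adjmxE mulrAC mulrC.
Qed.

Lemma pd_psd n (X : 'M[C]_n) : pd X -> herm_psd X.
Proof.
move=> [hX pX]; split=> // v; have [->|v0] := eqVneq v 0.
  by rewrite mulmx0 mxE.
exact/ltW/pX.
Qed.

Lemma herm_congr m n (B : 'M[C]_(m, n)) X : adjmx X = X ->
  adjmx (B *m X *m adjmx B) = B *m X *m adjmx B.
Proof. by move=> h; rewrite !adjmxM adjmxK h mulmxA. Qed.

Lemma psd_congr m n (B : 'M[C]_(m, n)) X : herm_psd X ->
  herm_psd (B *m X *m adjmx B).
Proof.
move=> [hX pX]; split; first exact: herm_congr.
by move=> v; rewrite -/(qf _ _) qf_congr; exact: pX.
Qed.

Lemma pd_congr n (B : 'M[C]_n) X : B \in unitmx -> pd X ->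
  pd (B *m X *m adjmx B).
Proof.
move=> uB [hX pX]; split; first exact: herm_congr.
move=> v v0; rewrite qf_congr; apply: pX.
apply: contra_neq v0 => Bv.
by rewrite -[v](mulKmx (_ : adjmx B \in unitmx)) ?adjmx_unit// Bv mulmx0.
Qed.

Lemma pd_congrE n (B : 'M[C]_n) X : B \in unitmx ->
  pd (B *m X *m adjmx B) <-> pd X.
Proof.
move=> uB; split; last exact: pd_congr.
move=> /(@pd_congr n (invmx B)); rewrite unitmx_inv => /(_ uB).
by rewrite !mulmxA mulVmx// mul1mx adjmx_inv mulmxK// adjmx_unit.
Qed.

Lemma psdD n (X Y : 'M[C]_n) : herm_psd X -> herm_psd Y -> herm_psd (X + Y).
Proof.
move=> [hX pX] [hY pY]; split; first by rewrite adjmxD hX hY.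
by move=> v; rewrite -/(qf _ _) qfD addr_ge0// ?pX ?pY.
Qed.

Lemma psd_sum m I (r : seq I) (P : pred I) (F : I -> 'M[C]_m) :
  (forall i, P i -> herm_psd (F i)) -> herm_psd (\sum_(i <- r | P i) F i).
Proof.
move=> FP; apply: big_ind => //; last by move=> X Y; exact: psdD.
by split=> [|v]; rewrite ?adjmx0// mulmx0 mul0mx mxE.
Qed.

Lemma pdD n (X Y : 'M[C]_n) : pd X -> herm_psd Y -> pd (X + Y).
Proof.
move=> [hX pX] [hY pY]; split; first by rewrite adjmxD hX hY.
by move=> v v0; rewrite qfD ltr_wpDr ?pX// pY.
Qed.

Lemma pdZ n (a : R) (X : 'M[C]_n) : 0 < a -> pd X -> pd (a%:C *: X).
Proof.
move=> a0 [hX pX]; split; first by rewrite adjmxZ hX conjc_real.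
by move=> v v0; rewrite qfZ mulr_gt0 ?pX// ltcR.
Qed.

Lemma psdZ n (a : R) (X : 'M[C]_n) : 0 <= a -> herm_psd X -> herm_psd (a%:C *: X).
Proof.
move=> a0 [hX pX]; split; first by rewrite adjmxZ hX conjc_real.
by move=> v; rewrite -/(qf _ _) qfZ mulr_ge0// ?pX// lecR.
Qed.

Lemma qf1_gt0 n (v : 'cV[C]_n) : v != 0 -> 0 < qf 1%:M v.
Proof.
move=> v0; rewrite -diag_const_mx qf_diag lt0r sumr_ge0 ?andbT; last first.
  by move=> i _; rewrite mxE mul1r mul_conjc_ge0.
apply: contra v0 => /eqP /psumr_eq0P E; apply/eqP/colP => i; rewrite mxE.
have N (j : 'I_n) : true -> 0 <= (const_mx 1 : 'rV[C]_n) 0 j * (conjc (v j 0) * v j 0) :> C.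
  by move=> _; rewrite mxE mul1r mul_conjc_ge0.
have /eqP := E N i isT; rewrite !mxE mul1r.
by rewrite mulf_eq0 conjc_eq0 orbb => /eqP.
Qed.

Lemma pd1 n : pd (1%:M : 'M[C]_n).
Proof. by split; [exact: adjmx1|exact: qf1_gt0]. Qed.

Lemma hermitian_spectral n (X : 'M[C]_n) : adjmx X = X ->
  exists (U : 'M[C]_n) (d : 'rV[R]_n), [/\ U *m adjmx U = 1%:M,
    adjmx U *m U = 1%:M &
    X = adjmx U *m diag_mx (map_mx (real_complex R) d) *m U].
Proof.
move=> hX.
have hs : X \is hermsymmx.
  by apply/is_hermitianmxP; rewrite expr0 scale1r -[LHS]hX.
have un := spectral_unitarymx X.
have U1 : spectralmx X *m adjmx (spectralmx X) = 1%:M by apply/unitarymxP.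
exists (spectralmx X), (map_mx (@complex.Re R) (spectral_diag X)).
split=> //; first exact: mulmx1C.
have -> : map_mx (real_complex R) (map_mx (@complex.Re R) (spectral_diag X)) = spectral_diag X.
  apply/matrixP => i j; rewrite !mxE.
  have /mxOverP/(_ i j) := hermitian_spectral_diag_real hs.
  exact: RRe_real.
have /orthomx_spectralP {1}-> := hermitian_normalmx hs.
by rewrite invmx_unitary.
Qed.

Section Spectrum.
Variables (n : nat) (X U : 'M[C]_n) (d : 'rV[R]_n).
Hypotheses (UU : U *m adjmx U = 1%:M) (UU' : adjmx U *m U = 1%:M).
Hypothesis XE : X = adjmx U *m diag_mx (map_mx (real_complex R) d) *m U.

Lemma spectrum_unit : U \in unitmx.
Proof. by case: (mulmx1_unit UU). Qed.

Lemma det_spectrum : \det X = (\prod_i d 0 i)%:C.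
Proof.
rewrite XE !det_mulmx mulrAC -det_mulmx UU' det1 mul1r det_diag rmorph_prod.
by apply: eq_bigr => i _; rewrite mxE.
Qed.

Lemma trace_spectrum : \tr X = (\sum_i d 0 i)%:C.
Proof.
rewrite XE mxtrace_mulC mulmxA UU mul1mx mxtrace_diag rmorph_sum.
by apply: eq_bigr => i _; rewrite mxE.
Qed.

Lemma qf_spectrum v :
  qf X v = \sum_i (d 0 i)%:C * (conjc ((U *m v) i 0) * (U *m v) i 0).
Proof.
rewrite XE -{2}(adjmxK U) qf_congr !adjmxK qf_diag.
by apply: eq_bigr => i _; rewrite mxE.
Qed.

Lemma qf_eigenvector i : qf X (adjmx U *m delta_mx i 0) = (d 0 i)%:C.
Proof.
rewrite qf_spectrum mulmxA UU mul1mx (bigD1 i)//= !mxE !eqxx conjc1 !mulr1.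
by rewrite big1 ?addr0// => j ji; rewrite !mxE (negbTE ji) mulr0 mulr0.
Qed.

Lemma psd_spectrum : herm_psd X -> forall i, 0 <= d 0 i.
Proof. by move=> [_ pX] i; rewrite -lecR -qf_eigenvector; exact: pX. Qed.

Lemma pd_spectrum : pd X <-> forall i, 0 < d 0 i.
Proof.
split=> [[_ pX] i|d0].
  rewrite -ltcR -qf_eigenvector; apply: pX.
  apply/eqP => /(congr1 (fun v => (U *m v) i 0)).
  by rewrite mulmxA UU mul1mx mulmx0 !mxE !eqxx => /eqP; rewrite oner_eq0.
rewrite XE -{2}(adjmxK U); apply: pd_congr.
  by rewrite adjmx_unit spectrum_unit.
split.
  apply/matrixP => i j; rewrite adjmxE !mxE eq_sym.
  by have [->|] := eqVneq i j; rewrite ?mulr1n ?mulr0n ?conjc_real ?conjc0.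
move=> v v0; rewrite qf_diag lt0r sumr_ge0 ?andbT; last first.
  by move=> i _; rewrite mxE mulr_ge0 ?mul_conjc_ge0// lecR ltW.
apply: contra v0 => /eqP /psumr_eq0P E; apply/eqP/colP => i; rewrite mxE.
have {}E : (d 0 i)%:C * (conjc (v i 0) * v i 0) = 0.
  by rewrite -[RHS](E _ i)// ?mxE// => j _; rewrite mxE mulr_ge0 ?mul_conjc_ge0// lecR ltW.
move/eqP: E; rewrite !mulf_eq0 conjc_eq0 orbb.
have -> : ((d 0 i)%:C == 0) = false by rewrite (inj_eq (@complexI R)) gt_eqF.
by move=> /= /eqP.
Qed.

End Spectrum.

Lemma pd_det_gt0 n (X : 'M[C]_n) : pd X -> 0 < \det X.
Proof.
move=> pX; have [U [d [U1 U2 XE]]] := hermitian_spectral pX.1.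
rewrite (det_spectrum U2 XE) ltcR prodr_gt0// => i _.
exact: ((pd_spectrum U1 XE).1 pX i).
Qed.

Lemma pd_unit n (X : 'M[C]_n) : pd X -> X \in unitmx.
Proof. by move=> /pd_det_gt0 dX; rewrite unitmxE unitfE gt_eqF. Qed.

Lemma pd_inv n (X : 'M[C]_n) : pd X -> pd (invmx X).
Proof.
move=> pX; have uX := pd_unit pX.
rewrite -(_ : invmx X *m X *m adjmx (invmx X) = invmx X).
  by apply: pd_congr => //; rewrite unitmx_inv.
by rewrite mulVmx// mul1mx adjmx_inv pX.1.
Qed.

Lemma qf_block m n (A : 'M[C]_m) (D : 'M[C]_n) u v :
  qf (block_mx A 0 0 D) (col_mx u v) = qf A u + qf D v.
Proof.
by rewrite /qf adjmx_col mul_row_block !mulmx0 addr0 add0r mul_row_col mxE.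
Qed.

Lemma pd_diag_block m n (A : 'M[C]_m) (D : 'M[C]_n) :
  pd (block_mx A 0 0 D) <-> pd A /\ pd D.
Proof.
split=> [[+ pX]|[[hA pA] [hD pD]]].
  rewrite adjmx_block => /eq_block_mx[hA _ _ hD]; split; split=> // v v0.
    have := pX (col_mx v 0); rewrite qf_block qf0 addr0; apply.
    by rewrite col_mx_eq0 (negbTE v0).
  have := pX (col_mx 0 v); rewrite qf_block qf0 add0r; apply.
  by rewrite col_mx_eq0 (negbTE v0) andbF.
split; first by rewrite adjmx_block hA hD !adjmx0.
move=> v; rewrite -(vsubmxK v) col_mx_eq0 negb_and qf_block.
have A0 u : 0 <= qf A u by exact: (pd_psd (conj hA pA)).2.
have D0 u : 0 <= qf D u by exact: (pd_psd (conj hD pD)).2.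
case/orP => v0; first by rewrite ltr_wpDr ?pA.
by rewrite ltr_wpDl ?pD.
Qed.

Lemma schur_congr m n (A : 'M[C]_m) (B : 'M[C]_(m, n)) (D : 'M[C]_n) :
  adjmx A = A -> A \in unitmx ->
  let L := block_mx 1%:M 0 (- (adjmx B *m invmx A)) 1%:M in
  L *m block_mx A B (adjmx B) D *m adjmx L =
  block_mx A 0 0 (D - adjmx B *m invmx A *m B).
Proof.
move=> hA uA /=; rewrite adjmx_block adjmx0 !adjmx1 adjmxN adjmxM adjmxK adjmx_inv hA.
rewrite !mulmx_block !mul1mx !mul0mx !mulmx1 !mulmx0 !addr0.
rewrite !mulNmx !mulmxN -!mulmxA mulVmx// mulmx1 addNr mul0mx oppr0 add0r.
by rewrite !mulmxA mulmxV// mul1mx addNr [in LHS]addrC.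
Qed.

Lemma schur_unit m n (B : 'M[C]_(n, m)) :
  block_mx 1%:M 0 B 1%:M \in unitmx /\ \det (block_mx (1%:M : 'M[C]_m) 0 B 1%:M) = 1.
Proof.
have E : \det (block_mx (1%:M : 'M[C]_m) 0 B 1%:M) = 1.
  by rewrite det_lblock !det1 mulr1.
by rewrite unitmxE E unitr1.
Qed.

Lemma pd_schur m n (A : 'M[C]_m) (B : 'M[C]_(m, n)) (D : 'M[C]_n) :
  pd A -> pd (block_mx A B (adjmx B) D) <-> pd (D - adjmx B *m invmx A *m B).
Proof.
move=> pA; have uA := pd_unit pA; have [uL _] := schur_unit (- (adjmx B *m invmx A)).
rewrite -(pd_congrE _ uL) schur_congr ?pA.1//.
by rewrite pd_diag_block; split=> [[]|].
Qed.

Lemma det_schur m n (A : 'M[C]_m) (B : 'M[C]_(m, n)) (D : 'M[C]_n) :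
  adjmx A = A -> A \in unitmx ->
  \det (block_mx A B (adjmx B) D) = \det A * \det (D - adjmx B *m invmx A *m B).
Proof.
move=> hA uA; have [_ dL] := schur_unit (- (adjmx B *m invmx A)).
have := congr1 determinant (schur_congr B D hA uA); rewrite !det_mulmx det_adjmx dL.
by rewrite conjc1 mul1r mulr1 => ->; rewrite det_lblock.
Qed.

Lemma pd_ulsubmx m n (A : 'M[C]_m) (B : 'M[C]_(m, n)) B' (D : 'M[C]_n) :
  pd (block_mx A B B' D) -> pd A.
Proof.
move=> [+ pX]; rewrite adjmx_block => /eq_block_mx[hA _ _ _]; split=> // v v0.
have := pX (col_mx v 0); rewrite col_mx_eq0 (negbTE v0) => /(_ isT).
by rewrite /qf adjmx_col adjmx0 mul_row_block !mul0mx !addr0 mul_row_col mulmx0 addr0.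
Qed.

(** Passing to sums and differences of the two halves diagonalises this block pattern, up to a
    factor 2. With D a Schur complement, this turns positivity of a Toeplitz matrix into a matrix
    interval. *)
Lemma pd_symmetric_block p (D X : 'M[C]_p) :
  pd (block_mx D X X D) <-> pd (D + X) /\ pd (D - X).
Proof.
pose P : 'M[C]_(p + p) := block_mx 1%:M 1%:M 1%:M (- 1%:M).
have PE : P *m block_mx D X X D *m adjmx P =
    2%:R%:C *: block_mx (D + X) 0 0 (D - X).
  rewrite /P adjmx_block adjmxN !adjmx1 !mulmx_block !mul1mx !mulmx1 scale_block_mx.
  rewrite !mulNmx !mul1mx !mulmxN !mulmx1 !scaler0 rmorphMn/= !scaler_nat.
  congr block_mx.
  - by rewrite mulr2n [X + D]addrC.
  - by rewrite [X + D]addrC subrr.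
  - by rewrite -[X - D]opprB subrr.
  - by rewrite -[X - D]opprB opprK -mulr2n.
have uP : P \in unitmx.
  have PP : P *m (2%:R^-1 *: P) = 1%:M.
    rewrite -scalemxAr /P mulmx_block !mul1mx mulmx1 mulNmx mul1mx opprK.
    by rewrite subrr -raddfD/= -mulr2n -scalar_mx_block scale_scalar_mx mulVf ?pnatr_eq0.
  by case: (mulmx1_unit PP).
rewrite -(pd_congrE _ uP) PE -pd_diag_block.
split=> [|h]; last exact: pdZ.
have h2 : (2^-1 : R)%:C * 2%:R%:C = 1 by rewrite -rmorphM mulVf ?pnatr_eq0.
move=> /(@pdZ _ 2%:R^-1); rewrite scalerA h2 scale1r; apply.
by rewrite invr_gt0.
Qed.

(** Unipotent row and column operations replace the congruence [P] above, whose determinant would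
    have to be divided out. *)
Lemma det_symmetric_block p (D X : 'M[C]_p) :
  \det (block_mx D X X D) = \det (D + X) * \det (D - X).
Proof.
have := @det_ublock C p p 1%:M 1%:M 1%:M; rewrite !det1 mulr1 => d1.
have := @det_ublock C p p 1%:M (- 1%:M) 1%:M; rewrite !det1 mulr1 => d2.
have E : block_mx 1%:M 1%:M 0 1%:M *m block_mx D X X D *m block_mx 1%:M (- 1%:M) 0 1%:M =
    block_mx (D + X) 0 X (D - X).
  rewrite !mulmx_block !mul1mx !mul0mx !mulmx1 !mulmx0 !mulmxN !mulmx1 !addr0 !add0r.
  by rewrite [X + D]addrC addNr [- X + D]addrC.
by have := congr1 determinant E; rewrite !det_mulmx d1 d2 mul1r mulr1 det_lblock.
Qed.

Lemma frobenius m n (X : 'M[C]_(m, n)) :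
  \tr (X *m adjmx X) = (\sum_i \sum_j (complex.Re (X i j) ^+ 2 + complex.Im (X i j) ^+ 2))%:C.
Proof.
rewrite rmorph_sum; apply: eq_bigr => i _; rewrite mxE rmorph_sum; apply: eq_bigr => j _.
by rewrite adjmxE -sqr_normc -add_Re2_Im2.
Qed.

Lemma trace_sqr_spectrum n (X U : 'M[C]_n) (d : 'rV[R]_n) : U *m adjmx U = 1%:M ->
  X = adjmx U *m diag_mx (map_mx (real_complex R) d) *m U ->
  \tr (X *m X) = (\sum_i d 0 i ^+ 2)%:C.
Proof.
move=> UU ->; rewrite -mulmxA [U *m _]mulmxA [U *m _]mulmxA UU mul1mx.
rewrite mulmxA mxtrace_mulC !mulmxA UU mul1mx mulmx_diag mxtrace_diag rmorph_sum.
by apply: eq_bigr => i _; rewrite !mxE -rmorphM expr2.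
Qed.

(** The squared moduli of all entries add up to the sum of the squared eigenvalues, which for
    nonnegative eigenvalues is at most the square of their sum. *)
Lemma psd_entry_bound n (X : 'M[C]_n) i j : herm_psd X ->
  complex.Re (X i j) ^+ 2 + complex.Im (X i j) ^+ 2 <= complex.Re (\tr X) ^+ 2.
Proof.
move=> pX; have [U [d [U1 U2 XE]]] := hermitian_spectral pX.1.
have d0 := psd_spectrum U1 XE pX.
rewrite (trace_spectrum U1 XE) /=.
apply: (@le_trans _ _ (\sum_i d 0 i ^+ 2)).
  have := trace_sqr_spectrum U1 XE; rewrite -{2}pX.1 frobenius => /complexI <-.
  have F0 k l : 0 <= complex.Re (X k l) ^+ 2 + complex.Im (X k l) ^+ 2.
    by rewrite addr_ge0 ?sqr_ge0.
  rewrite (bigD1 i)//= (bigD1 j)//= -addrA lerDl addr_ge0//.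
    by apply: sumr_ge0.
  by apply: sumr_ge0 => k _; apply: sumr_ge0.
rewrite expr2 mulr_suml; apply: ler_sum => k _; rewrite expr2 ler_wpM2l//.
by rewrite (bigD1 k)//= lerDl sumr_ge0.
Qed.

End HermitianMatrices.

(** * Determinant and trace estimates through eigenvalues *)

Section SpectralEstimates.
Variable R : realType.
Local Notation C := R[i].
Local Notation "x %:C" := (real_complex R x) : ring_scope.

Definition frob m n (X : 'M[C]_(m, n)) : R :=
  \sum_i \sum_j (complex.Re (X i j) ^+ 2 + complex.Im (X i j) ^+ 2).

Lemma frob_ge0 m n (X : 'M[C]_(m, n)) : 0 <= frob X.
Proof. by apply: sumr_ge0 => i _; apply: sumr_ge0 => j _; rewrite addr_ge0 ?sqr_ge0. Qed.

Lemma frobE m n (X : 'M[C]_(m, n)) : \tr (X *m adjmx X) = (frob X)%:C.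
Proof. exact: frobenius. Qed.

Section Spectrum.
Variables (n : nat) (U : 'M[C]_n).
Hypotheses (UU : U *m adjmx U = 1%:M) (UU' : adjmx U *m U = 1%:M).
Definition spectral_mx (d : 'rV[R]_n) : 'M[C]_n :=
  adjmx U *m diag_mx (map_mx (real_complex R) d) *m U.

Lemma spectral_mx1 : spectral_mx (const_mx 1) = 1%:M.
Proof.
rewrite /spectral_mx (_ : map_mx _ _ = const_mx 1) ?diag_const_mx ?mulmx1//.
by apply/matrixP => i j; rewrite !mxE.
Qed.

Lemma spectral_mxB d e : spectral_mx (d - e) = spectral_mx d - spectral_mx e.
Proof. by rewrite /spectral_mx map_mxB !linearB/= mulmxBl. Qed.

Lemma spectral_mxM d e :
  spectral_mx d *m spectral_mx e = spectral_mx (\row_i (d 0 i * e 0 i)).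
Proof.
rewrite /spectral_mx !mulmxA -[_ *m U *m adjmx U]mulmxA UU mulmx1.
rewrite -[_ *m diag_mx _ *m diag_mx _]mulmxA mulmx_diag; congr (_ *m diag_mx _ *m _).
by apply/rowP => i; rewrite !mxE rmorphM.
Qed.

Lemma spectral_mxV (d : 'rV[R]_n) : (forall i, d 0 i != 0) ->
  invmx (spectral_mx d) = spectral_mx (\row_i (d 0 i)^-1).
Proof.
move=> d0.
have E : spectral_mx d *m spectral_mx (\row_i (d 0 i)^-1) = 1%:M.
  rewrite spectral_mxM -spectral_mx1; congr spectral_mx; apply/rowP => i.
  by rewrite !mxE divff.
have [uX _] := mulmx1_unit E.
by rewrite -[RHS](mulKmx uX) E mulmx1.
Qed.

Lemma trace_spectral_congr p (r : 'M[C]_(p, n)) d :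
  \tr (r *m spectral_mx d *m adjmx r) =
  (\sum_i d 0 i * \sum_a (complex.Re ((U *m adjmx r) i a) ^+ 2
                         + complex.Im ((U *m adjmx r) i a) ^+ 2))%:C.
Proof.
have -> : r *m spectral_mx d *m adjmx r =
    adjmx (U *m adjmx r) *m (diag_mx (map_mx (real_complex R) d) *m (U *m adjmx r)).
  by rewrite adjmxM adjmxK /spectral_mx !mulmxA.
rewrite mxtrace_mulC rmorph_sum; apply: eq_bigr => i _.
rewrite mxE rmorphM rmorph_sum mulr_sumr; apply: eq_bigr => a _.
by rewrite mul_diag_mx [in LHS]mxE adjmxE mxE -mulrA -sqr_normc -add_Re2_Im2.
Qed.

Lemma frob_unitary p (r : 'M[C]_(p, n)) : frob r =
  \sum_i \sum_a (complex.Re ((U *m adjmx r) i a) ^+ 2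
                         + complex.Im ((U *m adjmx r) i a) ^+ 2).
Proof.
apply: complexI; have := trace_spectral_congr r (const_mx 1).
rewrite spectral_mx1 mulmx1 frobE => ->; congr (_%:C); apply: eq_bigr => i _.
by rewrite mxE mul1r.
Qed.
End Spectrum.

(** The inequality x <= exp(x - 1), multiplied over the eigenvalues. *)
Lemma det_le_exp n (D : 'M[C]_n) : pd D ->
  complex.Re (\det D) <= expR (complex.Re (\tr D) - n%:R).
Proof.
move=> pD; have [U [d [U1 U2 DE]]] := hermitian_spectral pD.1.
have d0 := (pd_spectrum U1 DE).1 pD.
rewrite (det_spectrum U2 DE) (trace_spectrum U1 DE)/=.
have -> : \sum_i d 0 i - n%:R = \sum_i (d 0 i - 1).
  by rewrite sumrB sumr_const card_ord.
rewrite expR_sum; apply: ler_prod => i _; rewrite (ltW (d0 i))/=.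
by have := expR_ge1Dx (d 0 i - 1); rewrite addrCA subrr addr0.
Qed.

(** Take reciprocals in 1 + y <= exp y at y = x / (1 - x), where 1 + y = 1 / (1 - x). *)
Lemma expR_le_onem (x : R) : x < 1 -> expR (- (x / (1 - x))) <= 1 - x.
Proof.
move=> x1; have p1 : 0 < 1 - x by rewrite subr_gt0.
rewrite expRN -[leRHS]invrK lef_pV2 ?posrE ?expR_gt0 ?invr_gt0//.
apply: le_trans (expR_ge1Dx _); have -> : 1 + x / (1 - x) = ((1 - x) + x) / (1 - x) by rewrite mulrDl divff ?gt_eqF.
by rewrite subrK mul1r.
Qed.

(** All eigenvalues of [M] lie between 0 and [t]. The scalar bounds for 1 - x multiply to these,
    once each denominator 1 - x is replaced by the smaller 1 - t. *)
Lemma det_onem_bounds n (M : 'M[C]_n) (t := complex.Re (\tr M)) :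
  herm_psd M -> t < 1 ->
  [/\ pd (1%:M - M), expR (- (t / (1 - t))) <= complex.Re (\det (1%:M - M)) &
      complex.Re (\det (1%:M - M)) <= expR (- t)].
Proof.
move=> pM t1; have [U [d [U1 U2 ME]]] := hermitian_spectral pM.1.
have d0 := psd_spectrum U1 ME pM.
have tE : t = \sum_i d 0 i by rewrite /t (trace_spectrum U1 ME).
have dt i : d 0 i <= t by rewrite tE (bigD1 i)//= lerDl sumr_ge0.
have E : 1%:M - M = spectral_mx U (const_mx 1 - d).
  by rewrite spectral_mxB spectral_mx1// ME.
have pM' : pd (1%:M - M).
  apply/(pd_spectrum U1 E) => i; rewrite !mxE subr_gt0.
  exact: le_lt_trans (dt i) t1.
split=> //.
- rewrite (det_spectrum U2 E)/= {1}tE mulr_suml -sumrN expR_sum.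
  apply: ler_prod => i _; rewrite expR_ge0/= !mxE.
  have di1 : d 0 i < 1 by exact: le_lt_trans (dt i) t1.
  apply: le_trans (expR_le_onem di1); rewrite ler_expR lerN2 ler_wpM2l//.
  by rewrite lef_pV2 ?posrE ?subr_gt0// lerD2l lerN2.
- apply: le_trans (det_le_exp pM') _; rewrite ler_expR.
  have -> : \tr (1%:M - M) = (n%:R - t)%:C.
    by rewrite linearB/= mxtrace1 (trace_spectrum U1 ME) -tE rmorphB rmorph_nat.
  by rewrite /= addrAC subrr sub0r.
Qed.

(** Each eigenvalue of [T] is at most its trace. Crude, but valid for every positive definite [T];
    the Gaussian majorant comes from this bound. *)
Lemma trace_inv_ge n p (T : 'M[C]_n) (r : 'M[C]_(p, n)) : pd T ->
  frob r / complex.Re (\tr T) <= complex.Re (\tr (r *m invmx T *m adjmx r)).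
Proof.
move=> pT; have [U [d [U1 U2 TE]]] := hermitian_spectral pT.1.
have d0 := (pd_spectrum U1 TE).1 pT.
rewrite (trace_spectrum U1 TE)/= TE spectral_mxV//; last by move=> i; rewrite gt_eqF.
rewrite trace_spectral_congr/= (frob_unitary U2) mulr_suml; apply: ler_sum => i _.
rewrite mulrC mxE ler_wpM2r//.
  by apply: sumr_ge0 => a _; rewrite addr_ge0 ?sqr_ge0.
have dpos : 0 < \sum_j d 0 j.
  by rewrite (bigD1 i)//= ltr_wpDr// sumr_ge0// => j _; exact: ltW.
rewrite lef_pV2 ?posrE// (bigD1 i)//= lerDl sumr_ge0// => j _; exact: ltW.
Qed.

(** The Frobenius distance to the identity bounds the distance of each eigenvalue to 1, so the
    eigenvalues of the inverse lie between 1 / (1 + e) and 1 / (1 - e). *)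
Lemma near_identity n (T : 'M[C]_n) (e : R) : adjmx T = T -> 0 <= e < 1 ->
  frob (T - 1%:M) <= e ^+ 2 ->
  pd T /\ forall p (r : 'M[C]_(p, n)),
    frob r / (1 + e) <= complex.Re (\tr (r *m invmx T *m adjmx r)) <= frob r / (1 - e).
Proof.
move=> hT /andP[e0 e1] fe; have [U [d [U1 U2 TE]]] := hermitian_spectral hT.
have de i : `|d 0 i - 1| <= e.
  rewrite -ler_sqr ?nnegrE// real_normK ?num_real//; apply: le_trans fe.
  have TE1 : T - 1%:M = spectral_mx U (d - const_mx 1).
    by rewrite spectral_mxB spectral_mx1// [in LHS]TE.
  have := frobE (T - 1%:M); rewrite adjmxB hT adjmx1 (trace_sqr_spectrum U1 TE1).
  move=> /complexI <-; rewrite (bigD1 i)//= !mxE lerDl.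
  by apply: sumr_ge0 => j _; exact: sqr_ge0.
have dlo i : 1 - e <= d 0 i by have := de i; rewrite ler_distl => /andP[].
have dhi i : d 0 i <= 1 + e by have := de i; rewrite ler_distl => /andP[].
have d0 i : 0 < d 0 i by apply: lt_le_trans (dlo i); rewrite subr_gt0.
split; first by apply/(pd_spectrum U1 TE).
move=> p r; rewrite TE spectral_mxV//; last by move=> i; rewrite gt_eqF.
rewrite trace_spectral_congr/= (frob_unitary U2) !mulr_suml.
have w0 i : 0 <= \sum_a (complex.Re ((U *m adjmx r) i a) ^+ 2
                         + complex.Im ((U *m adjmx r) i a) ^+ 2).
  by apply: sumr_ge0 => a _; rewrite addr_ge0 ?sqr_ge0.
apply/andP; split; apply: ler_sum => i _; rewrite mulrC mxE.
  by rewrite ler_wpM2r// lef_pV2 ?posrE// ltr_wpDr.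
by rewrite ler_wpM2l// lef_pV2 ?posrE// subr_gt0.
Qed.
End SpectralEstimates.

(** * Block Toeplitz matrices *)

Section Kernels.
Variable R : realType.
Local Notation C := R[i].
Local Notation "x %:C" := (real_complex R x) : ring_scope.

(** Matrices are cut out of an infinite array, so that sizes can be rewritten freely and blocks or
    permuted rows are reindexings of the array. *)
Definition kernel_mx (t : nat -> nat -> C) (m n : nat) : 'M[C]_(m, n) :=
  \matrix_(i, j) t i j.

Lemma kernel_mx_block t m1 m2 n1 n2 :
  kernel_mx t (m1 + m2) (n1 + n2) =
  block_mx (kernel_mx t m1 n1) (kernel_mx (fun i j => t i (n1 + j)%N) m1 n2)
           (kernel_mx (fun i j => t (m1 + i)%N j) m2 n1)
           (kernel_mx (fun i j => t (m1 + i)%N (n1 + j)%N) m2 n2).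
Proof.
apply/matrixP => i j; rewrite !mxE.
by case: splitP => i' ->; rewrite !mxE; case: splitP => j' ->; rewrite !mxE.
Qed.

Lemma eq_kernel_mx t t' m n :
  (forall i j, (i < m)%N -> (j < n)%N -> t i j = t' i j) ->
  kernel_mx t m n = kernel_mx t' m n.
Proof. by move=> tt'; apply/matrixP => i j; rewrite !mxE tt'. Qed.

Lemma adj_kernel_mx t m n :
  adjmx (kernel_mx t m n) = kernel_mx (fun i j => conjc (t j i)) n m.
Proof. by apply/matrixP => i j; rewrite !mxE. Qed.

Section Permutation.
Variables (M : nat) (s : nat -> nat).
Hypothesis s_lt : forall i, (i < M)%N -> (s i < M)%N.
Hypothesis s_inj : forall i j, (i < M)%N -> (j < M)%N -> s i = s j -> i = j.

Let f (i : 'I_M) : 'I_M := Ordinal (s_lt (ltn_ord i)).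
Let f_inj : injective f.
Proof. by move=> i j [] /s_inj ij; apply/val_inj/ij. Qed.

Definition kernel_perm : 'M[C]_M := perm_mx (perm f_inj).

Lemma kernel_perm_mul t n :
  kernel_perm *m kernel_mx t M n = kernel_mx (fun i j => t (s i) j) M n.
Proof. by rewrite -row_permE; apply/matrixP => i j; rewrite !mxE permE. Qed.

Lemma kernel_perm_mulr t m :
  kernel_mx t m M *m adjmx kernel_perm = kernel_mx (fun i j => t i (s j)) m M.
Proof.
rewrite -[LHS]adjmxK adjmxM adjmxK adj_kernel_mx kernel_perm_mul adj_kernel_mx.
by apply: eq_kernel_mx => i j _ _; rewrite conjcK.
Qed.

Lemma kernel_perm_unitary :
  kernel_perm *m adjmx kernel_perm = 1%:M /\ adjmx kernel_perm *m kernel_perm = 1%:M.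
Proof.
suff E : kernel_perm *m adjmx kernel_perm = 1%:M by split; last exact: mulmx1C.
rewrite /adjmx tr_perm_mx map_perm_mx -perm_mxM mulgV; exact: perm_mx1.
Qed.

Lemma kernel_perm_unit : kernel_perm \in unitmx.
Proof. by have [/mulmx1_unit[]] := kernel_perm_unitary. Qed.

Lemma kernel_perm_involutive : (forall i, (i < M)%N -> s (s i) = i) ->
  adjmx kernel_perm = kernel_perm.
Proof.
move=> ss; rewrite /adjmx tr_perm_mx map_perm_mx; congr perm_mx.
apply/permP => i; apply: (@perm_inj _ (perm f_inj)).
by rewrite permKV !permE; apply: val_inj; rewrite /= ss.
Qed.

Lemma pd_kernel_perm t :
  pd (kernel_mx (fun i j => t (s i) (s j)) M M) <-> pd (kernel_mx t M M).
Proof.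
by rewrite -(pd_congrE (kernel_mx t M M) kernel_perm_unit) kernel_perm_mul kernel_perm_mulr; split.
Qed.

Lemma det_kernel_perm t :
  \det (kernel_mx (fun i j => t (s i) (s j)) M M) = \det (kernel_mx t M M).
Proof.
have -> : kernel_mx (fun i j => t (s i) (s j)) M M =
    kernel_perm *m kernel_mx t M M *m adjmx kernel_perm.
  by rewrite kernel_perm_mul kernel_perm_mulr.
rewrite !det_mulmx mulrAC -det_mulmx.
by rewrite kernel_perm_unitary.1 det1 mul1r.
Qed.
End Permutation.

Variable p' : nat.
Local Notation p := p'.+1.
Implicit Type c : nat -> 'M[C]_p'.+1.

Definition natdist (a b : nat) : nat := (a - b) + (b - a).

(** A scalar index [i] stands for position [i %% p] in block [i %/ p]; the entry is read off the
    block C_|a - b|. *)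
Definition toep c (i j : nat) : C :=
  c (natdist (i %/ p) (j %/ p)) (inord (i %% p)) (inord (j %% p)).

Definition toepmx c N : 'M[C]_N := kernel_mx (toep c) N N.

Definition hermitian_seq c := c 0%N = 1%:M /\ forall j, adjmx (c j) = c j.

Lemma toep_conj c i j : hermitian_seq c -> conjc (toep c i j) = toep c j i.
Proof. by move=> [_ hc]; rewrite /toep /natdist addnC -[in RHS]hc adjmxE. Qed.

Lemma toepmx_herm c N : hermitian_seq c -> adjmx (toepmx c N) = toepmx c N.
Proof. by move=> hc; rewrite adj_kernel_mx; apply: eq_kernel_mx => i j _ _; exact: toep_conj. Qed.

Lemma toep_shift c i j : toep c (p + i) (p + j) = toep c i j.
Proof.
rewrite /toep !modnDl !divnDl ?dvdnn// divnn /=; congr (c _ _ _).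
Qed.

Section Step.
Variables (c : nat -> 'M[C]_p'.+1) (n : nat).
Hypothesis hc : hermitian_seq c.
Local Notation N := (n * p)%N.
Let T := toepmx c N.
Let X := c n.+1.

Definition toep_col : 'M[C]_(n * p'.+1, p'.+1) :=
  kernel_mx (fun i j => toep c i (n * p'.+1 + j)) _ _.

(** Reverses the order of the [n] blocks and keeps positions inside them. Since |a - b| is unchanged
    by the reversal, it leaves T fixed. *)
Definition block_flip (i : nat) : nat := ((n.-1 - i %/ p'.+1) * p'.+1 + i %% p'.+1)%N.

Let flip_div i : (block_flip i %/ p = n.-1 - i %/ p)%N.
Proof. by rewrite /block_flip divnMDl// (divn_small (ltn_pmod i (ltn0Sn p'))) addn0. Qed.

Let flip_mod i : (block_flip i %% p = i %% p)%N.
Proof. by rewrite /block_flip modnMDl modn_mod. Qed.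

Let div_lt i : (i < N)%N -> (i %/ p < n)%N.
Proof. by rewrite ltn_divLR. Qed.

Let flip_lt i : (i < n * p'.+1)%N -> (block_flip i < n * p'.+1)%N.
Proof.
move=> /div_lt; rewrite -/p -ltn_divLR// flip_div.
by move: (i %/ p)%N => q; lia.
Qed.

Let flip_inj i j : (i < n * p'.+1)%N -> (j < n * p'.+1)%N ->
  block_flip i = block_flip j -> i = j.
Proof.
move=> /div_lt iN /div_lt jN E.
have := congr1 (fun x => x %/ p)%N E; have := congr1 (fun x => x %% p)%N E.
rewrite !flip_div !flip_mod => Em Ed.
rewrite (divn_eq i p) (divn_eq j p) Em; congr (_ * _ + _)%N.
by move: iN jN Ed; move: (i %/ p)%N (j %/ p)%N => a b; lia.
Qed.

Let F := kernel_perm flip_lt flip_inj.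

Definition toep_schur : 'M[C]_p'.+1 :=
  1%:M - adjmx toep_col *m invmx T *m toep_col.

(** The centre of the interval in which C_(n+1) may vary; its half-width is [toep_schur]. *)
Definition toep_center : 'M[C]_p'.+1 :=
  adjmx toep_col *m (adjmx F *m invmx T) *m toep_col.

Let toep_id0 : kernel_mx (toep c) p p = 1%:M.
Proof.
rewrite -hc.1; apply/matrixP => i j; rewrite mxE /toep !divn_small// /natdist subnn.
by rewrite !modn_small// !inord_val.
Qed.

Let shiftN i j : toep c (N + i) (N + j) = toep c i j.
Proof.
by elim: n => [|m IH]; [rewrite mul0n|rewrite mulSn -!addnA toep_shift].
Qed.

Lemma toepmx_succ :
  toepmx c (n * p'.+1 + p'.+1) = block_mx T toep_col (adjmx toep_col) 1%:M.
Proof.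
rewrite /toepmx kernel_mx_block; congr block_mx.
  by rewrite adj_kernel_mx; apply: eq_kernel_mx => i j _ _; rewrite toep_conj.
by rewrite -toep_id0; apply: eq_kernel_mx => i j _ _; exact: shiftN.
Qed.

Let F_T : F *m T = T *m F.
Proof.
have [_ FF'] : F *m adjmx F = 1%:M /\ adjmx F *m F = 1%:M.
  exact: kernel_perm_unitary.
have FTF : F *m T *m adjmx F = T.
  rewrite /T /toepmx kernel_perm_mul kernel_perm_mulr; apply: eq_kernel_mx => i j iN jN.
  rewrite /toep !flip_div !flip_mod; congr (c _ _ _).
  have := div_lt iN; have := div_lt jN; rewrite /natdist.
  by move: (i %/ p)%N (j %/ p)%N => a b; lia.
by rewrite -[in RHS]FTF -[RHS]mulmxA FF' mulmx1.
Qed.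

Let F_adj : adjmx F = F.
Proof.
apply: kernel_perm_involutive => i /div_lt iN; rewrite {1}/block_flip flip_div flip_mod.
rewrite [RHS](divn_eq i p); congr (_ * _ + _)%N.
by move: iN; move: (i %/ p)%N => a; lia.
Qed.

(** Reversal exchanges the two ends: the column joining blocks 0, ..., n - 1 to block n becomes the
    one joining blocks 1, ..., n to block 0. *)
Let F_col : F *m toep_col = adjmx (kernel_mx (fun i j => toep c i (p + j)) p N).
Proof.
rewrite adj_kernel_mx /toep_col kernel_perm_mul; apply: eq_kernel_mx => i j iN jp.
rewrite toep_conj// /toep flip_div flip_mod modnDl modnMDl divnMDl//.
rewrite divnDl ?dvdnn// divnn /= (divn_small jp); congr (c _ _ _).
by have := div_lt iN; rewrite /natdist; move: (i %/ p)%N => a; lia.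
Qed.

Hypothesis pdT : pd T.

Let F_inv : adjmx F *m invmx T = invmx T *m F.
Proof.
have uT := pd_unit pdT.
rewrite F_adj -[LHS](mulKmx uT) [T *m (F *m _)]mulmxA -F_T -[F *m T *m _]mulmxA.
by rewrite mulmxV// mulmx1.
Qed.

Lemma toep_center_herm : adjmx toep_center = toep_center.
Proof.
rewrite /toep_center !adjmxM adjmxK adjmx_inv toepmx_herm// adjmxK.
by rewrite F_inv !mulmxA.
Qed.

Lemma pd_toepmx_succ : pd (toepmx c (n * p'.+1 + p'.+1)) <-> pd toep_schur.
Proof. by rewrite toepmx_succ; exact: pd_schur. Qed.

Lemma det_toepmx_succ :
  \det (toepmx c (n * p'.+1 + p'.+1)) = \det T * \det toep_schur.
Proof. by rewrite toepmx_succ det_schur ?toepmx_herm// pd_unit. Qed.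

(* Lists the n + 2 blocks in the order 1, ..., n, 0, n + 1. *)
Let rot (i : nat) : nat :=
  if (i < n * p'.+1)%N then (p'.+1 + i)%N
  else if (i < n * p'.+1 + p'.+1)%N then (i - n * p'.+1)%N else i.

Let rot_lt i : (i < n * p'.+1 + (p'.+1 + p'.+1))%N ->
  (rot i < n * p'.+1 + (p'.+1 + p'.+1))%N.
Proof. by rewrite /rot; move: (n * p'.+1)%N => m; move=> iM; case: ifP; [lia|case: ifP; lia]. Qed.

Let rot_inj i j : (i < n * p'.+1 + (p'.+1 + p'.+1))%N ->
  (j < n * p'.+1 + (p'.+1 + p'.+1))%N -> rot i = rot j -> i = j.
Proof.
rewrite /rot; move: (n * p'.+1)%N => m iM jM.
by case: ifP => h1; [|case: ifP => h2]; (case: ifP => h3; [|case: ifP => h4]); lia.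
Qed.

Let Y := X - toep_center.

Let rotated_col :
  kernel_mx (fun i j => toep c (rot i) (rot (N + j))) N (p + p) =
  row_mx (F *m toep_col) toep_col.
Proof.
rewrite F_col; apply/matrixP => i j; rewrite [LHS]mxE [RHS]mxE.
have -> : rot i = (p + i)%N by rewrite /rot ltn_ord.
case: splitP => j' jE; rewrite ?adjmxE mxE jE.
  rewrite toep_conj//; congr (toep c _ _); rewrite /rot.
  by rewrite ltnNge leq_addr/= ltn_add2l ltn_ord addKn.
rewrite (_ : rot _ = (p + (N + j'))%N) ?toep_shift//.
by rewrite /rot ltnNge leq_addr/= ltn_add2l ltnNge leq_addr/= addnCA.
Qed.

(** Blocks 0 and n + 1 form the only pair at distance n + 1. With both placed last, the new block X
    occurs in the lower right corner alone, next to a copy of T for the blocks 1, ..., n. *)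
Let rotated :
  kernel_mx (fun i j => toep c (rot i) (rot j)) (N + (p + p)) (N + (p + p)) =
  block_mx T (row_mx (F *m toep_col) toep_col)
    (adjmx (row_mx (F *m toep_col) toep_col)) (block_mx 1%:M X X 1%:M).
Proof.
rewrite kernel_mx_block rotated_col; congr block_mx.
- by apply: eq_kernel_mx => i j iN jN; rewrite /rot iN jN toep_shift.
- rewrite -rotated_col adj_kernel_mx; apply: eq_kernel_mx => i j _ _.
  by rewrite toep_conj.
rewrite kernel_mx_block.
have lo i : (i < p)%N -> rot (N + i) = i.
  by move=> ip; rewrite /rot ltnNge leq_addr/= ltn_add2l ip addKn.
have hi i : rot (N + (p + i)) = (N + (p + i))%N.
  by rewrite /rot ltnNge leq_addr/= ltn_add2l ltnNge leq_addr.
congr block_mx.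
- rewrite -toep_id0; apply: eq_kernel_mx => i j ip jp; by rewrite !lo.
- apply/matrixP => i j; rewrite mxE lo// hi addnA -mulSnr /toep modnMDl divnMDl//.
  by rewrite !divn_small// addn0 !modn_small// !inord_val.
- apply/matrixP => i j; rewrite mxE hi (lo j (ltn_ord j)) addnA -mulSnr /toep modnMDl divnMDl//.
  by rewrite !divn_small// addn0 !modn_small// !inord_val /natdist subn0 sub0n addn0.
- rewrite -toep_id0; apply: eq_kernel_mx => i j ip jp; by rewrite !hi shiftN toep_shift.
Qed.

(** As [F] is an involution commuting with the inverse of T, both diagonal blocks receive the same
    correction, and both off-diagonal blocks are shifted by the same centre. *)
Let rotated_schur : block_mx 1%:M X X 1%:M -
    adjmx (row_mx (F *m toep_col) toep_col) *m invmx T *m row_mx (F *m toep_col) toep_col =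
  block_mx toep_schur Y Y toep_schur.
Proof.
rewrite adjmx_row mul_col_mx mul_col_row opp_block_mx add_block_mx.
have FF : F *m F = 1%:M.
  by rewrite -{2}F_adj; case: (kernel_perm_unitary flip_lt flip_inj).
have E1 : adjmx (F *m toep_col) *m invmx T *m (F *m toep_col) =
    adjmx toep_col *m invmx T *m toep_col.
  rewrite adjmxM -[adjmx _ *m adjmx F *m _]mulmxA F_inv !mulmxA.
  by rewrite -[_ *m F *m F]mulmxA FF mulmx1.
have E2 : adjmx (F *m toep_col) *m invmx T *m toep_col = toep_center.
  by rewrite /toep_center adjmxM !mulmxA.
have E3 : adjmx toep_col *m invmx T *m (F *m toep_col) = toep_center.
  by rewrite /toep_center F_inv !mulmxA.
by rewrite E1 E2 E3.
Qed.

Lemma pd_toepmx_succ2 : pd (toepmx c (N + (p + p))) <->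
  pd (toep_schur + Y) /\ pd (toep_schur - Y).
Proof.
rewrite -(pd_kernel_perm rot_lt rot_inj) rotated pd_schur// rotated_schur.
exact: pd_symmetric_block.
Qed.

Lemma det_toepmx_succ2 : \det (toepmx c (N + (p + p))) =
  \det T * (\det (toep_schur + Y) * \det (toep_schur - Y)).
Proof.
rewrite -(det_kernel_perm rot_lt rot_inj) rotated det_schur ?toepmx_herm ?pd_unit//.
by rewrite rotated_schur det_symmetric_block.
Qed.
End Step.
End Kernels.

(** * Measurability of matrix-valued maps *)

Section ComplexMeasurable.
Variable R : realType.
Local Notation C := R[i].
Local Notation "x %:C" := (real_complex R x) : ring_scope.
Context d (T : measurableType d).
Implicit Types f g : T -> C.

Definition cmeasurable f :=
  measurable_fun setT (fun x => complex.Re (f x)) /\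
  measurable_fun setT (fun x => complex.Im (f x)).

Lemma cmeasurable_cst (z : C) : cmeasurable (fun=> z).
Proof. by split; exact: measurable_cst. Qed.

Lemma cmeasurableD f g : cmeasurable f -> cmeasurable g -> cmeasurable (fun x => f x + g x).
Proof.
move=> [f1 f2] [g1 g2]; split.
  rewrite (_ : (fun _ => _) = (fun x => complex.Re (f x) + complex.Re (g x))).
    exact: measurable_funD.
  by apply/funext => x; case: (f x) (g x) => ? ? [].
rewrite (_ : (fun _ => _) = (fun x => complex.Im (f x) + complex.Im (g x))).
  exact: measurable_funD.
by apply/funext => x; case: (f x) (g x) => ? ? [].
Qed.

Lemma cmeasurableM f g : cmeasurable f -> cmeasurable g -> cmeasurable (fun x => f x * g x).
Proof.
move=> [f1 f2] [g1 g2]; split.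
  rewrite (_ : (fun _ => _) = (fun x => complex.Re (f x) * complex.Re (g x)
      - complex.Im (f x) * complex.Im (g x))).
    by apply: measurable_funB; exact: measurable_funM.
  by apply/funext => x; case: (f x) (g x) => ? ? [].
rewrite (_ : (fun _ => _) = (fun x => complex.Re (f x) * complex.Im (g x)
      + complex.Im (f x) * complex.Re (g x))).
  by apply: measurable_funD; exact: measurable_funM.
by apply/funext => x; case: (f x) (g x) => ? ? [].
Qed.

Lemma cmeasurableN f : cmeasurable f -> cmeasurable (fun x => - f x).
Proof.
move=> mf; have := cmeasurableM (cmeasurable_cst (-1)) mf.
by congr cmeasurable; apply/funext => x; rewrite mulN1r.
Qed.

Lemma cmeasurable_sum I (r : seq I) (P : pred I) (F : I -> T -> C) :
  (forall i, cmeasurable (F i)) -> cmeasurable (fun x => \sum_(i <- r | P i) F i x).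
Proof.
move=> mF; elim: r => [|i r IH].
  rewrite (_ : (fun _ => _) = (fun=> 0)); first exact: cmeasurable_cst.
  by apply/funext => x; rewrite big_nil.
rewrite (_ : (fun _ => _) = (fun x => (if P i then F i x else 0) + \sum_(i <- r | P i) F i x)).
  apply: cmeasurableD => //; case: (P i) => //; exact: cmeasurable_cst.
by apply/funext => x; rewrite big_cons; case: ifP => // _; rewrite add0r.
Qed.

Lemma cmeasurable_prod I (r : seq I) (P : pred I) (F : I -> T -> C) :
  (forall i, cmeasurable (F i)) -> cmeasurable (fun x => \prod_(i <- r | P i) F i x).
Proof.
move=> mF; elim: r => [|i r IH].
  rewrite (_ : (fun _ => _) = (fun=> 1)); first exact: cmeasurable_cst.
  by apply/funext => x; rewrite big_nil.
rewrite (_ : (fun _ => _) = (fun x => (if P i then F i x else 1) * \prod_(i <- r | P i) F i x)).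
  apply: cmeasurableM => //; case: (P i) => //; exact: cmeasurable_cst.
by apply/funext => x; rewrite big_cons; case: ifP => // _; rewrite mul1r.
Qed.

Definition mxmeasurable m n (M : T -> 'M[C]_(m, n)) := forall i j, cmeasurable (fun x => M x i j).

Lemma cmeasurable_det n (M : T -> 'M[C]_n) : mxmeasurable M ->
  cmeasurable (fun x => \det (M x)).
Proof.
move=> mM; apply: cmeasurable_sum => s; apply: cmeasurableM; first exact: cmeasurable_cst.
by apply: cmeasurable_prod => i; exact: mM.
Qed.

Lemma mxmeasurableD m n (M N : T -> 'M[C]_(m, n)) : mxmeasurable M -> mxmeasurable N ->
  mxmeasurable (fun x => M x + N x).
Proof.
move=> mM mN i j; have := cmeasurableD (mM i j) (mN i j).
by congr cmeasurable; apply/funext => x; rewrite mxE.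
Qed.

Lemma mxmeasurableN m n (M : T -> 'M[C]_(m, n)) : mxmeasurable M ->
  mxmeasurable (fun x => - M x).
Proof.
move=> mM i j; have := cmeasurableN (mM i j).
by congr cmeasurable; apply/funext => x; rewrite mxE.
Qed.

Lemma mxmeasurable_cst m n (M : 'M[C]_(m, n)) : mxmeasurable (fun=> M).
Proof. by move=> i j; exact: cmeasurable_cst. Qed.
End ComplexMeasurable.

(** * Leading principal minors and measurability of positive definiteness *)

Section Sylvester.
Variable R : realType.
Local Notation C := R[i].

Lemma pd_mx11 (S : 'M[C]_1) : adjmx S = S -> pd S <-> 0 < \det S.
Proof.
move=> hS; split; first exact: pd_det_gt0.
rewrite det_mx11 => S0; split=> // v v0.
have -> : qf S v = S 0 0 * (conjc (v 0 0) * v 0 0).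
  by rewrite /qf mxE big_ord1 mxE big_ord1 adjmxE mulrAC mulrC.
rewrite mulr_gt0// lt0r mul_conjc_ge0 andbT mulf_eq0 conjc_eq0 orbb.
by apply: contra v0 => /eqP v0; apply/eqP/colP => i; rewrite ord1 v0 mxE.
Qed.

(** Induction on the size with a scalar Schur complement. It expresses positive definiteness by
    finitely many polynomial inequalities, which makes it a measurable condition. *)
Lemma sylvester (t : nat -> nat -> C) N : (forall i j, conjc (t i j) = t j i) ->
  pd (kernel_mx t N N) <-> forall j, (j <= N)%N -> 0 < \det (kernel_mx t j j).
Proof.
move=> ht; have hK m n : adjmx (kernel_mx t m n) = kernel_mx t n m.
  by rewrite adj_kernel_mx; apply: eq_kernel_mx.
elim: N => [|N IH].
  split=> [_ j|_]; first by rewrite leqn0 => /eqP ->; rewrite det_mx00.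
  by split=> // v; rewrite [v]flatmx0 eqxx.
have E : kernel_mx t (N + 1) (N + 1) = block_mx (kernel_mx t N N)
   (kernel_mx (fun i j => t i (N + j)%N) N 1) (adjmx (kernel_mx (fun i j => t i (N + j)%N) N 1))
   (kernel_mx (fun i j => t (N + i)%N (N + j)%N) 1 1).
  rewrite kernel_mx_block; congr block_mx; rewrite adj_kernel_mx.
  by apply: eq_kernel_mx => i j _ _.
have hE := hK (N + 1)%N (N + 1)%N; rewrite -addn1; split.
  move=> pE j; rewrite leq_eqVlt => /predU1P[->|]; first exact: pd_det_gt0.
  by rewrite addn1 ltnS; apply: (IH.1 _); move: pE; rewrite E => /pd_ulsubmx.
move=> dj; have pN : pd (kernel_mx t N N).
  by apply/IH => j jN; apply: dj; rewrite (leq_trans jN)// addn1.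
have := dj _ (leqnn _); rewrite E det_schur ?pN.1 ?pd_unit// (pmulr_rgt0 _ (pd_det_gt0 pN)) => dS.
apply/pd_schur => //; apply/pd_mx11 => //.
rewrite adjmxB !adjmxM adjmxK adjmx_inv pN.1 mulmxA; congr (_ - _).
by rewrite adj_kernel_mx; apply: eq_kernel_mx.
Qed.

(** Extension by 0 to an infinite array, whose corners of size at most [n] are the leading minors of
    [M]. *)
Definition kernel_of n (M : 'M[C]_n) (i j : nat) : C :=
  if (insub i : option 'I_n) is Some i' then
    if (insub j : option 'I_n) is Some j' then M i' j' else 0 else 0.

Lemma kernel_ofK n (M : 'M[C]_n) : kernel_mx (kernel_of M) n n = M.
Proof. by apply/matrixP => i j; rewrite mxE /kernel_of !valK. Qed.

Lemma measurable_pd d (T : measurableType d) n (M : T -> 'M[C]_n) :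
  mxmeasurable M -> (forall x, adjmx (M x) = M x) ->
  measurable [set x | pd (M x)].
Proof.
move=> mM hM.
have mK m : mxmeasurable (fun x => kernel_mx (kernel_of (M x)) m m).
  move=> i j; rewrite (_ : (fun _ => _) = (fun x => kernel_of (M x) i j)); last first.
    by apply/funext => x; rewrite mxE.
  rewrite /kernel_of; case: insub => [i'|]; last exact: cmeasurable_cst.
  by case: insub => [j'|]; [exact: mM|exact: cmeasurable_cst].
rewrite (_ : [set x | _] = \bigcap_(j in [set j | (j <= n)%N])
   ((fun x => complex.Re (\det (kernel_mx (kernel_of (M x)) j j))) @^-1` `]0, +oo[)).
  apply: bigcap_measurable => [|j _]; first (by exists 0%N); rewrite -[X in measurable X]setTI.
  exact: (cmeasurable_det (mK j)).1.
have hk x i j : conjc (kernel_of (M x) i j) = kernel_of (M x) j i.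
  rewrite /kernel_of; case: insub => [i'|]; case: insub => [j'|]; rewrite ?conjc0//.
  by rewrite -[in RHS]hM adjmxE.
(* The order on complex numbers also asks for a vanishing imaginary part; this is automatic, the
   minors being determinants of hermitian matrices. *)
have rd x j : 0 < \det (kernel_mx (kernel_of (M x)) j j) <->
    0 < complex.Re (\det (kernel_mx (kernel_of (M x)) j j)).
  rewrite ltcE; split=> [/andP[]//|->]; rewrite andbT.
  have : conjc (\det (kernel_mx (kernel_of (M x)) j j)) = \det (kernel_mx (kernel_of (M x)) j j).
    by rewrite -det_adjmx adj_kernel_mx; congr determinant; apply: eq_kernel_mx.
  case: (\det _) => a b [] /eqP; rewrite -subr_eq0 -opprD oppr_eq0 -mulr2n mulrn_eq0/=.
  by move=> ->.
apply/seteqP; split=> x /=.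
  rewrite -[M x]kernel_ofK => /(sylvester _ (hk x)) H j jn; rewrite /= in_itv/= andbT.
  exact/rd/H.
move=> H; rewrite -[M x]kernel_ofK; apply/(sylvester _ (hk x)) => j jn; apply/rd.
by have := H j jn; rewrite /= in_itv/= andbT.
Qed.
End Sylvester.

(** * Real coordinates of hermitian matrices *)

Section HermitianCoordinates.
Variable R : realType.
Variable p : nat.
Local Notation C := R[i].
Local Notation "x %:C" := (real_complex R x) : ring_scope.
Local Notation idx := ('I_p * 'I_p)%type.

Definition hmx (y : idx -> R) : 'M[C]_p := herm_of (fun a b => y (a, b)).

Lemma hmx_adj y : adjmx (hmx y) = hmx y.
Proof.
apply/matrixP => a b; rewrite !mxE eq_sym; have [->|ab] := eqVneq a b.
  by rewrite /= oppr0.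
by case: (ltngtP (val a) (val b)) => [| |/val_inj/eqP]; rewrite ?(negbTE ab)//= opprK.
Qed.

Lemma herm_coordsK y : herm_coords (hmx y) = y.
Proof.
apply/funext => -[a b]; rewrite /herm_coords !mxE eqxx/= eq_sym.
have [->//|ab] := eqVneq b a.
by case: (ltngtP (val a) (val b)) => [| |/val_inj/eqP]//; rewrite eq_sym (negbTE ab).
Qed.

Lemma hmxK (X : 'M[C]_p) : adjmx X = X -> hmx (herm_coords X) = X.
Proof.
move=> hX; have hab a b : X b a = conjc (X a b) by rewrite -[in LHS]hX adjmxE.
apply/matrixP => a b; rewrite !mxE /herm_coords eqxx.
have [->|ab] := eqVneq a b.
  have := hab b b; case: (X b b) => u v [] /eqP; rewrite -subr_eq0 opprK -mulr2n mulrn_eq0/=.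
  by move=> /eqP ->.
case: (ltngtP (val a) (val b)) => [_|_|/val_inj/eqP]; last by rewrite (negbTE ab).
  by case: (X a b).
by rewrite (hab b a); case: (X b a).
Qed.

Lemma hmxD y z : hmx (fun j => y j + z j) = hmx y + hmx z.
Proof.
apply/matrixP => a b; rewrite !mxE; case: ifP => _; first by congr (_ +i* _)%C; rewrite addr0.
by case: ifP => _; congr (_ +i* _)%C; rewrite -opprD.
Qed.

Lemma hmxZ t y : hmx (fun j => t * y j) = t%:C *: hmx y.
Proof.
apply/matrixP => a b; rewrite !mxE; case: ifP => _.
  by congr (_ +i* _)%C; rewrite ?mul0r ?mulr0 ?subr0 ?addr0.
by case: ifP => _; congr (_ +i* _)%C; rewrite ?mul0r ?mulr0 ?subr0 ?addr0// mulrN.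
Qed.

Lemma mxmeasurable_hmx d (T : measurableType d) (y : T -> idx -> R) :
  (forall j, measurable_fun setT (fun x => y x j)) -> mxmeasurable (fun x => hmx (y x)).
Proof.
move=> my a b; split.
  rewrite (_ : (fun _ => _) = (fun x => if a == b then y x (a, a) else
     if (a < b)%N then y x (a, b) else y x (b, a))).
    by case: (a == b) => //; case: (a < b)%N.
  by apply/funext => x; rewrite !mxE; case: ifP => _ //; case: ifP.
rewrite (_ : (fun _ => _) = (fun x => if a == b then 0 else
     if (a < b)%N then y x (b, a) else - y x (a, b))).
  case: (a == b); first exact: measurable_cst.
  by case: (a < b)%N => //; exact: measurable_funN.
by apply/funext => x; rewrite !mxE; case: ifP => _ //; case: ifP.
Qed.
End HermitianCoordinates.

(** * Volumes of matrix intervals *)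

Section LebInt.
Variables (R : realType) (I : finType).
Implicit Types f : (I -> R) -> \bar R.
Local Open Scope ereal_scope.
Local Notation Mf f := (measurable_fun [set: RI R I] (f : RI R I -> \bar R)).

(** The variables are reordered so that those in [P] are integrated first, with the others fixed. *)
Lemma leb_int_shift (P : pred I) (g : (I -> R) -> I -> R) f :
  Mf f -> (forall x, 0 <= f x) -> measurable_fun [set: RI R I] (g : RI R I -> RI R I) ->
  (forall y j, ~~ P j -> g y j = 0%R) ->
  (forall y z, (forall j, ~~ P j -> y j = z j) -> g y = g z) ->
  leb_int (fun y => f (fun j => (y j + g y j)%R)) = leb_int f.
Proof.
move=> mf f0 mg g0 gdep; rewrite /leb_int.
have pe : perm_eq (enum I) ([seq j <- enum I | ~~ P j] ++ [seq j <- enum I | P j]).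
  by rewrite perm_sym perm_catC; apply/permPl; exact: perm_filterC.
have mP j : (j \notin [seq j <- enum I | P j]) = ~~ P j by rewrite mem_filter mem_enum andbT.
have mfg : Mf (fun y => f (fun j => (y j + g y j)%R)).
  apply: (measurableT_comp (g := fun y : RI R I => (fun j => (y j + g y j)%R) : RI R I) mf).
  apply: measurable_into_RI => j; apply: measurable_funD; first exact: measurable_coord.
  exact: (measurableT_comp (measurable_coord j) mg).
rewrite (iter_leb_int_perm _ _ _ pe)// (iter_leb_int_perm _ _ _ pe)//.
have us : uniq [seq j <- enum I | P j] by rewrite filter_uniq// enum_uniq.
rewrite iter_leb_int_shift// => [y j|y z yz].
  by rewrite mP; exact: g0.
by apply: gdep => j Pj; apply: yz; rewrite mP.
Qed.

Lemma leb_int_affine (c d : I -> R) f : (forall j, 0 < c j)%R -> Mf f ->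
  (forall x, 0 <= f x) ->
  leb_int (fun y => f (fun j => (c j * y j + d j)%R)) =
  (\prod_j (c j)^-1)%:E * leb_int f.
Proof.
move=> c0 mf f0.
have := @iter_leb_int_affine R I (enum I) c d f (fun=> 0%R) (enum_uniq I) c0 mf f0.
rewrite /leb_int big_enum/= => <-; congr iter_leb_int; apply/funext => y; congr f.
by apply/funext => j; rewrite /affine_on mem_enum.
Qed.

Lemma leb_int_ge0 f : (forall x, 0 <= f x) -> 0 <= leb_int f.
Proof. exact: iter_leb_int_ge0. Qed.
End LebInt.

Section Volume.
Variables (R : realType) (p e : nat).
Local Notation C := R[i].
Local Notation "x %:C" := (real_complex R x) : ring_scope.
Local Notation idx := ('I_p * 'I_p)%type.
Local Notation Rdet X := (complex.Re (\det X)).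
Implicit Types (D : 'M[C]_p) (y : idx -> R).

Definition interval_set D : set (idx -> R) :=
  [set y | pd (D + hmx y) /\ pd (D - hmx y)].

Definition interval_density D y : R :=
  \1_(interval_set D) y * (Rdet (D + hmx y) * Rdet (D - hmx y)) ^+ e.

Lemma pd_Rdet n (X : 'M[C]_n) : pd X -> 0 < Rdet X /\ \det X = (Rdet X)%:C.
Proof.
move=> /pd_det_gt0; rewrite ltcE; case: (\det X) => a b /= /andP[/eqP -> a0].
by split.
Qed.

Lemma interval_density_ge0 D y : 0 <= interval_density D y.
Proof.
rewrite /interval_density indicE; have [/set_mem[p1 p2]|_] := boolP (y \in _); last by rewrite mul0r.
rewrite mul1r exprn_ge0// mulr_ge0// ltW//; [exact: (pd_Rdet p1).1|exact: (pd_Rdet p2).1].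
Qed.

Lemma mxmeasurable_addhmx D : mxmeasurable (fun y : RI R idx => D + hmx y).
Proof.
apply: mxmeasurableD; first exact: mxmeasurable_cst.
by apply: (mxmeasurable_hmx (y := fun y : RI R idx => y)) => j; exact: measurable_coord.
Qed.

Lemma mxmeasurable_subhmx D : mxmeasurable (fun y : RI R idx => D - hmx y).
Proof.
apply: mxmeasurableD; first exact: mxmeasurable_cst.
by apply: mxmeasurableN; apply: (mxmeasurable_hmx (y := fun y : RI R idx => y)) => j; exact: measurable_coord.
Qed.

Lemma measurable_interval_density D : adjmx D = D ->
  measurable_fun [set: RI R idx] (interval_density D : RI R idx -> R).
Proof.
move=> hD; apply: measurable_funM.
  apply: measurable_indic.
  rewrite (_ : interval_set D = [set y | pd (D + hmx y)] `&` [set y | pd (D - hmx y)])//.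
  apply: measurableI.
    by apply: (measurable_pd (mxmeasurable_addhmx D)) => y; rewrite adjmxD hD hmx_adj.
  by apply: (measurable_pd (mxmeasurable_subhmx D)) => y; rewrite adjmxB hD hmx_adj.
apply: measurable_funX; apply: measurable_funM.
  exact: (cmeasurable_det (mxmeasurable_addhmx D)).1.
exact: (cmeasurable_det (mxmeasurable_subhmx D)).1.
Qed.

Definition interval_volume D := leb_int (fun y => (interval_density D y)%:E).

(** This is the covariance of the integrand only: both determinants pick up |det B|^2. The Jacobian
    of X -> B X B^* is found separately, for shears and for diagonal matrices. *)
Lemma interval_density_congr (B : 'M[C]_p) D y : B \in unitmx ->
  interval_density (B *m D *m adjmx B) (herm_coords (B *m hmx y *m adjmx B)) =
  ((complex.Re (\det B * conjc (\det B))) ^+ 2) ^+ e * interval_density D y.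
Proof.
move=> uB; rewrite /interval_density /interval_set !indicE.
set y' := herm_coords _; have hy' : hmx y' = B *m hmx y *m adjmx B.
  by apply: hmxK; rewrite herm_congr ?hmx_adj.
have E1 : B *m D *m adjmx B + hmx y' = B *m (D + hmx y) *m adjmx B.
  by rewrite hy' mulmxDr mulmxDl.
have E2 : B *m D *m adjmx B - hmx y' = B *m (D - hmx y) *m adjmx B.
  by rewrite hy' mulmxBr mulmxBl.
have Emem : (y' \in [set y | pd (B *m D *m adjmx B + hmx y) /\ pd (B *m D *m adjmx B - hmx y)])
   = (y \in [set y | pd (D + hmx y) /\ pd (D - hmx y)]).
  apply/idP/idP => /set_mem/= [p1 p2]; apply/mem_set => /=; move: p1 p2; rewrite E1 E2.
    by move=> /(pd_congrE _ uB) ? /(pd_congrE _ uB).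
  by move=> ? ?; split; exact: pd_congr.
rewrite Emem; have [/set_mem/=[p1 p2]|_] := boolP (y \in _); last by rewrite !mul0r mulr0.
have [_ d1] := pd_Rdet p1; have [_ d2] := pd_Rdet p2.
rewrite !mul1r E1 E2 !det_mulmx d1 d2 det_adjmx -exprMn; congr (_ ^+ e).
have hC : \det B * conjc (\det B) = (complex.Re (\det B * conjc (\det B)))%:C.
  by rewrite -sqr_normc -add_Re2_Im2.
rewrite ![_ * _%:C]mulrC -!mulrA hC -!rmorphM /=; ring.
Qed.

Section Shear.
Variables (l : 'I_p) (u : 'cV[C]_p).
Hypothesis ul : u l 0 = 0.
Let B : 'M[C]_p := 1%:M + \matrix_(a, b) (u a 0 * (b == l)%:R).

Let BE a b : B a b = (a == b)%:R + u a 0 * (b == l)%:R.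
Proof. by rewrite !mxE. Qed.

Let mulB (X : 'M[C]_p) a b : (B *m X) a b = X a b + u a 0 * X l b.
Proof.
rewrite mulmxDl mul1mx mxE; congr (_ + _); rewrite mxE (bigD1 l)//= mxE eqxx mulr1.
by rewrite big1 ?addr0// => j /negbTE jl; rewrite mxE jl mulr0 mul0r.
Qed.

Let mulBadj (X : 'M[C]_p) a b :
  (X *m adjmx B) a b = X a b + X a l * conjc (u b 0).
Proof.
rewrite -[X in X *m _]adjmxK -adjmxM adjmxE mulB !adjmxE rmorphD rmorphM/= !conjcK.
by rewrite mulrC.
Qed.

Lemma shear_congr X a b : (B *m X *m adjmx B) a b =
  X a b + u a 0 * X l b + (X a l + u a 0 * X l l) * conjc (u b 0).
Proof. by rewrite mulBadj !mulB. Qed.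

Lemma det_shear : \det B = 1.
Proof.
rewrite (expand_det_row _ l) (bigD1 l)//= BE eqxx ul mul0r addr0 mul1r.
rewrite big1 ?addr0 => [|j /negbTE jl]; last by rewrite BE eq_sym jl ul !mul0r addr0 mul0r.
rewrite /cofactor -signr_odd oddD addbb expr0 mul1r.
rewrite (_ : row' _ _ = 1%:M) ?det1//; apply/matrixP => i j.
rewrite 2!mxE BE (inj_eq lift_inj) [lift l j == l]eq_sym (negbTE (neq_lift l j)).
by rewrite mulr0 addr0 mxE.
Qed.

Let G y : 'M[C]_p := B *m hmx y *m adjmx B - hmx y.
Let G_herm y : adjmx (G y) = G y.
Proof. by rewrite adjmxB herm_congr hmx_adj. Qed.

Let GE y a b : G y a b = u a 0 * hmx y l b + (hmx y a l + u a 0 * hmx y l l) * conjc (u b 0).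
Proof.
by rewrite /G mxE shear_congr [(- hmx y) a b]mxE -[X in X - _]addrA addrAC subrr add0r.
Qed.

Let touch (ab : idx) := (ab.1 == l) || (ab.2 == l).
Let g1 y (j : idx) : R := if touch j && (j != (l, l)) then herm_coords (G y) j else 0.
Let g2 y (j : idx) : R := if ~~ touch j then herm_coords (G y) j else 0.

Let g12 y j : herm_coords (G y) j = g1 y j + g2 y j.
Proof.
rewrite /g1 /g2; have [|_] := boolP (touch j); last by rewrite add0r.
rewrite addr0; have [->|//] := eqVneq j (l, l) => _.
by rewrite /herm_coords eqxx GE ul conjc0 mulr0 mul0r addr0.
Qed.

Let hmx_touch y z a b : (forall j, touch j -> y j = z j) -> (a == l) || (b == l) ->
  hmx y a b = hmx z a b.
Proof.
move=> yz t; rewrite !mxE; have [abE|ab] := eqVneq a b.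
  by rewrite yz// /touch/=; move: t; rewrite -abE orbb => ->.
by rewrite !yz// /touch/= orbC.
Qed.

Let herm_coords_eq (X Y : 'M[C]_p) (a b : 'I_p) : X a b = Y a b -> X b a = Y b a ->
  herm_coords X (a, b) = herm_coords Y (a, b).
Proof. by rewrite /herm_coords => E1 E2; case: eqP => [abE|_]; [move: E1; rewrite -abE => -> | rewrite E1 E2]. Qed.

(** Entry (a, b) of [G y] involves only the entries (l, b), (a, l) and (l, l) of X. *)
Let g2_dep y z : (forall j, touch j -> y j = z j) -> g2 y = g2 z.
Proof.
move=> yz; apply/funext => -[a b]; rewrite /g2; case: ifP => // _.
have E a' b' : G y a' b' = G z a' b'.
  by rewrite !GE !(hmx_touch yz) ?eqxx ?orbT.
exact: herm_coords_eq.
Qed.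

(** As [u l 0 = 0], row [l] of [G y] is the (l, l) entry of X times the conjugate of [u], and column
    [l] is its adjoint. *)
Let g1_dep y z : y (l, l) = z (l, l) -> g1 y = g1 z.
Proof.
move=> yz; apply/funext => -[a b]; rewrite /g1; case: ifP => // /andP[t ne].
have Hll : hmx y l l = hmx z l l by rewrite !mxE eqxx yz.
have E1 b' : G y l b' = G z l b'.
  rewrite !GE ul !mul0r !add0r !addr0; by rewrite Hll.
have E2 a' : G y a' l = G z a' l.
  by rewrite -[G y]G_herm -[G z]G_herm !adjmxE E1.
by case/orP: t => /= /eqP ->; apply: herm_coords_eq.
Qed.

Let mxmeas_hmx : mxmeasurable (fun y : RI R idx => hmx y).
Proof.
by apply: (mxmeasurable_hmx (y := fun y : RI R idx => y)) => j; exact: measurable_coord.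
Qed.

Let measurable_gi (P : pred idx) : measurable_fun [set: RI R idx]
  ((fun y j => if P j then herm_coords (G y) j else 0) : RI R idx -> RI R idx).
Proof.
apply: measurable_into_RI => -[a b].
have mG : mxmeasurable (fun y : RI R idx => G y).
  move=> i j; rewrite (_ : (fun _ => _) = (fun y : RI R idx =>
     u i 0 * hmx y l j + (hmx y i l + u i 0 * hmx y l l) * conjc (u j 0))); last first.
    by apply/funext => y; rewrite GE.
  apply: cmeasurableD; first by apply: cmeasurableM; [exact: cmeasurable_cst|exact: mxmeas_hmx].
  apply: cmeasurableM; last exact: cmeasurable_cst.
  apply: cmeasurableD; first exact: mxmeas_hmx.
  by apply: cmeasurableM; [exact: cmeasurable_cst|exact: mxmeas_hmx].
case: (P (a, b)); last exact: measurable_cst.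
rewrite /herm_coords; case: (a == b); first exact: (mG a a).1.
by case: (a < b)%N; [exact: (mG a b).1|exact: (mG b a).2].
Qed.

(* X -> B X B^* adds to the coordinates of row and column l functions of
   the (l, l) coordinate, and to all others functions of those of row and
   column l: two measure-preserving shifts. *)
Lemma interval_volume_shear D : adjmx D = D ->
  interval_volume (B *m D *m adjmx B) = interval_volume D.
Proof.
move=> hD; have uB : B \in unitmx by rewrite unitmxE det_shear unitr1.
pose F y : \bar R := (interval_density (B *m D *m adjmx B) y)%:E.
have mF : measurable_fun [set: RI R idx] (F : RI R idx -> \bar R).
  by apply/measurable_EFinP; apply: measurable_interval_density; rewrite herm_congr.
have F0 y : (0 <= F y)%E by rewrite lee_fin interval_density_ge0.
pose F1 y := F (fun j => (y j + g1 y j)%R).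
have mF1 : measurable_fun [set: RI R idx] (F1 : RI R idx -> \bar R).
  apply: (measurableT_comp (g := fun y : RI R idx => (fun j => (y j + g1 y j)%R) : RI R idx) mF).
  apply: measurable_into_RI => j; apply: measurable_funD; first exact: measurable_coord.
  exact: (measurableT_comp (measurable_coord j)
    (measurable_gi (fun j => touch j && (j != (l, l))))).
rewrite /interval_volume -/(leb_int F).
transitivity (leb_int F1).
  apply/esym/(leb_int_shift (P := fun j => touch j && (j != (l, l)))) => //.
  - exact: measurable_gi.
  - by move=> y j /negbTE jP; rewrite /g1 jP.
  - by move=> y z yz; apply: g1_dep; apply: yz; rewrite eqxx andbF.
transitivity (leb_int (fun y => F1 (fun j => (y j + g2 y j)%R))).
  apply/esym/(leb_int_shift (P := fun j => ~~ touch j)) => //.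
  - by move=> y; exact: F0.
  - exact: measurable_gi.
  - by move=> y j /negbTE jP; rewrite /g2 jP.
  - by move=> y z yz; apply: g2_dep => j tj; apply: yz; rewrite negbK.
congr leb_int; apply/funext => y; rewrite /F1.
(* [g1] reads the (l, l) coordinate only, and [g2] does not change it. *)
have -> : g1 (fun j => (y j + g2 y j)%R) = g1 y.
  by apply: g1_dep; rewrite /g2 /touch eqxx addr0.
rewrite /F; congr (_%:E).
have -> : (fun j => (y j + g2 y j + g1 y j)%R) = herm_coords (B *m hmx y *m adjmx B).
  rewrite -[LHS]herm_coordsK; congr herm_coords.
  have -> : (fun j => (y j + g2 y j + g1 y j)%R) = (fun j => (y j + herm_coords (G y) j)%R).
    by apply/funext => j; rewrite g12 -addrA [g1 _ _ + _]addrC.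
  by rewrite hmxD hmxK// /G addrC subrK.
by rewrite interval_density_congr// det_shear conjc1 mulr1 /= !expr1n mul1r.
Qed.
End Shear.

End Volume.

Section IntervalVolume.
Variables (R : realType) (p e : nat).
Local Notation C := R[i].
Local Notation "x %:C" := (real_complex R x) : ring_scope.
Local Notation idx := ('I_p * 'I_p)%type.
Local Notation Rdet X := (complex.Re (\det X)).
Implicit Types (D : 'M[C]_p) (y : idx -> R).
Local Notation vol := (@interval_volume R p e).

(** Congruence by the diagonal matrix of the r_i = sqrt d_i scales coordinate (a, b) by r_a r_b.
    Over all p^2 coordinates this gives the power p of the determinant; the remaining 2e comes from
    the two determinants in the integrand. *)
Lemma interval_volume_diag (d : 'rV[R]_p) : (forall i, 0 < d 0 i) ->
  vol (diag_mx (map_mx (real_complex R) d)) =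
  (((\prod_i d 0 i) ^+ (2 * e + p))%:E * vol 1%:M)%E.
Proof.
move=> d0; pose r (i : 'I_p) := Num.sqrt (d 0 i).
have r0 i : 0 < r i by rewrite sqrtr_gt0.
have rr i : r i * r i = d 0 i by rewrite -expr2 sqr_sqrtr// ltW.
pose B : 'M[C]_p := diag_mx (\row_i (r i)%:C).
have aB : adjmx B = B.
  by apply/matrixP => i j; rewrite !mxE eq_sym; case: eqVneq => [->|_];
    rewrite ?mulr1n ?mulr0n ?conjc_real ?conjc0.
have BB : B *m 1%:M *m adjmx B = diag_mx (map_mx (real_complex R) d).
  rewrite mulmx1 aB mulmx_diag; congr diag_mx; apply/rowP => i.
  by rewrite !mxE -rmorphM rr.
have dB : \det B = (\prod_i r i)%:C.
  by rewrite det_diag rmorph_prod; apply: eq_bigr => i _; rewrite mxE.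
have uB : B \in unitmx.
  by rewrite unitmxE unitfE dB gt_eqF// ltcR prodr_gt0.
pose c (j : idx) := r j.1 * r j.2.
have c0 j : 0 < c j by rewrite mulr_gt0.
have Ec y : (fun j => c j * y j + 0) = herm_coords (B *m hmx y *m adjmx B).
  rewrite -[LHS]herm_coordsK; congr herm_coords; apply/matrixP => a b.
  rewrite aB mul_mx_diag mxE mul_diag_mx !mxE /c /= !addr0.
  case: (eqVneq a b) => [->|_]; first by rewrite mulrAC -rmorphM; congr (_ +i* _)%C; rewrite !(mul0r, mulr0, subr0, addr0).
  case: ifP => _; rewrite [RHS]mulrAC -rmorphM [r b * r a]mulrC;
    by congr (_ +i* _)%C; rewrite !(mul0r, mulr0, subr0, addr0)// mulrN.
have mF : measurable_fun [set: RI R idx]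
    ((fun y => (interval_density e (diag_mx (map_mx (real_complex R) d)) y)%:E) : RI R idx -> \bar R).
  by apply/measurable_EFinP; apply: measurable_interval_density; rewrite -BB herm_congr ?adjmx1.
pose F y := (interval_density e (diag_mx (map_mx (real_complex R) d)) y)%:E.
have F0 y : (0 <= F y)%E by rewrite lee_fin interval_density_ge0.
have := leb_int_affine (fun=> 0) c0 mF F0; rewrite -/(vol _).
have -> : (fun y => F (fun j => c j * y j + 0)) =
    (fun y => ((\prod_i d 0 i) ^+ (2 * e))%:E * (interval_density e 1%:M y)%:E)%E.
  apply/funext => y; rewrite /F Ec -BB interval_density_congr// -EFinM; congr (_ * _)%:E.
  rewrite dB conjc_real -rmorphM/= -exprM; congr (_ ^+ _).
  by rewrite -big_split/=; apply: eq_bigr => i _.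
rewrite {1}/leb_int iter_leb_intZ; last 3 first.
- by apply/measurable_EFinP; apply: measurable_interval_density; exact: adjmx1.
- by move=> y; rewrite lee_fin interval_density_ge0.
- by rewrite lee_fin exprn_ge0// prodr_ge0// => i _; exact: ltW.
rewrite -/(leb_int _) -/(vol _) => E.
have cE : \prod_j c j = (\prod_i d 0 i) ^+ p.
  rewrite /c -(pair_bigA _ (fun a b => r a * r b))/=.
  under eq_bigr do rewrite big_split/= prodr_const card_ord.
  rewrite big_split/= prodr_const card_ord prodrXl -exprMn -big_split/=.
  by congr (_ ^+ _); apply: eq_bigr => i _.
have cc : (\prod_j c j) * (\prod_j (c j)^-1) = 1.
  by rewrite -big_split/= big1// => j _; rewrite divff ?gt_eqF.
by rewrite exprD mulrC EFinM -muleA E muleA -EFinM -cE cc mul1e.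
Qed.

Lemma pd_diag_entry_gt0 D l : pd D -> exists2 x : R, 0 < x & D l l = x%:C.
Proof.
move=> [hD pD]; have := pD (delta_mx l 0).
have -> : qf D (delta_mx l 0) = D l l.
  rewrite /qf mxE (bigD1 l)//= big1 ?addr0 => [|j jl].
    rewrite [delta_mx _ _ _ _]mxE !eqxx mulr1 mxE (bigD1 l)//= big1 ?addr0 => [|j jl].
      by rewrite adjmxE mxE !eqxx conjc1 mul1r.
    by rewrite adjmxE mxE (negbTE jl) conjc0 mul0r.
  by rewrite [delta_mx _ _ _ _]mxE (negbTE jl) mulr0.
have d0 : delta_mx l 0 != 0 :> 'cV[C]_p.
  by apply/eqP => /matrixP/(_ l 0); rewrite !mxE !eqxx => /eqP; rewrite oner_eq0.
move=> /(_ d0); rewrite ltcE; case: (D l l) => a b /= /andP[/eqP -> a0].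
by exists a.
Qed.

(** Symmetric Gaussian elimination: congruences by shears of determinant 1 preserve both sides and
    bring D to diagonal form. *)
Lemma interval_volumeE D : pd D ->
  vol D = (((Rdet D) ^+ (2 * e + p))%:E * vol 1%:M)%E.
Proof.
(* [S] holds the indices that may still be coupled to each other; one elimination removes an index
   from it, and for empty [S] the matrix is diagonal. *)
move: D; suff H m : forall (S : {set 'I_p}) D, (#|S| <= m)%N -> pd D ->
    (forall a b, a != b -> (a \notin S) || (b \notin S) -> D a b = 0) ->
    vol D = (((Rdet D) ^+ (2 * e + p))%:E * vol 1%:M)%E.
  by move=> D pD; apply: (H _ (finset.setTfor _) D (leqnn _) pD) => a b _; rewrite !inE.
elim: m => [|m IH] S D.
  rewrite leqn0 cards_eq0 => /eqP -> pD offD.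
  pose d : 'rV[R]_p := \row_i complex.Re (D i i).
  have d0 i : 0 < d 0 i by rewrite mxE; have [x x0 ->] := pd_diag_entry_gt0 i pD.
  have DE : D = diag_mx (map_mx (real_complex R) d).
    apply/matrixP => a b; rewrite !mxE; have [->|ab] := eqVneq a b.
      by have [x x0 ->] := pd_diag_entry_gt0 b pD; rewrite mulr1n.
    by rewrite mulr0n offD// inE.
  rewrite {1}DE interval_volume_diag//; congr (_%:E * _)%E; congr (_ ^+ _).
  rewrite DE det_diag.
  have -> : \prod_i (map_mx (real_complex R) d) 0 i = (\prod_i d 0 i)%:C.
    by rewrite rmorph_prod; apply: eq_bigr => i _; rewrite !mxE.
  by [].
move=> Sm pD offD; have [S0|/set0Pn[l lS]] := eqVneq S finset.set0.
  by apply: (IH S) => //; rewrite S0 cards0.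
have [x x0 Dll] := pd_diag_entry_gt0 l pD.
have xC0 : x%:C != 0 by rewrite gt_eqF// ltcR.
(* The pivot is the diagonal entry [D l l], and [u] is chosen to clear the rest of column [l]. *)
pose u : 'cV[C]_p := \col_a (if a == l then 0 else - (D a l / x%:C)).
have ul : u l 0 = 0 by rewrite mxE eqxx.
pose B : 'M[C]_p := 1%:M + \matrix_(a, b) (u a 0 * (b == l)%:R).
have dB : \det B = 1 by exact: det_shear.
have uB : B \in unitmx by rewrite unitmxE dB unitr1.
rewrite -(interval_volume_shear e ul pD.1) -/B.
have -> : Rdet D = Rdet (B *m D *m adjmx B).
  by rewrite !det_mulmx det_adjmx dB conjc1 mul1r mulr1.
have congE a b : (B *m D *m adjmx B) a b =
  D a b + u a 0 * D l b + (D a l + u a 0 * D l l) * conjc (u b 0).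
  exact: shear_congr.
have col0 a : a != l -> D a l + u a 0 * D l l = 0.
  by move=> al; rewrite mxE (negbTE al) Dll mulNr divfK// subrr.
apply: (IH (S :\ l)); [|exact: pd_congr|].
  by have := cardsD1 l S; rewrite lS => E; move: Sm; rewrite E.
have hB : adjmx (B *m D *m adjmx B) = B *m D *m adjmx B by rewrite herm_congr// pD.1.
move=> a b ab.
wlog nab : a b ab / (a \notin S :\ l).
  move=> W /orP[na|nb]; first by apply: W => //; rewrite na.
  by rewrite -hB adjmxE (W b a) ?conjc0 1?eq_sym// nb.
move=> _; have [al|al] := eqVneq a l.
  rewrite -hB adjmxE al congE ul conjc0 mulr0 addr0.
  by move: ab; rewrite al eq_sym => bl; rewrite col0// conjc0.
have aS : a \notin S by move: nab; rewrite !inE al.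
rewrite congE col0// mul0r addr0 (offD a b)// ?aS// add0r mxE (negbTE al).
by rewrite (offD a l)// ?aS// mul0r oppr0 mul0r.
Qed.
End IntervalVolume.

(** * Finiteness and positivity of volumes by comparison with boxes *)

Section Boxes.
Variables (R : realType) (I : eqType).
Local Notation mu := (@lebesgue_measure R).
Local Notation box b := (\1_(`[- b, b]%classic) : R -> R).

Lemma measurable_box (b : R) : measurable_fun setT (box b).
Proof. by apply: measurable_indic; exact: measurable_itv. Qed.

Lemma integral_box (b : R) : 0 <= b -> (\int[mu]_t (box b t)%:E = (2 * b)%:E)%E.
Proof.
move=> b0; rewrite integral_indic ?setIT//= lebesgue_measure_itv/= lte_fin.
case: ltP => [_|]; first by rewrite -EFinB opprK mulr_natl mulr2n.
move=> bb; have -> : b = 0 by apply/eqP; rewrite eq_le b0 andbT; lra.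
by rewrite mulr0.
Qed.

(** Only the tail [r] is integrated. The factors of the variables in front of it are constant there
    and go into [K]. This is the tail condition required for dominated convergence and for signed
    integrands. *)
Lemma iter_leb_int_prod_lty (s r : seq I) (k : R) (u : I -> R -> R) (v : I -> R) x :
  uniq s -> suffix r s -> (forall j, measurable_fun setT (u j)) ->
  (forall j t, 0 <= u j t) ->
  (forall j, \int[mu]_t (u j t)%:E = (v j)%:E)%E -> 0 <= k ->
  (iter_leb_int r (fun y => (k * \prod_(j <- s) u j (y j))%:E) x < +oo)%E.
Proof.
move=> us /suffixP[s1 sE] mu_ u0 uv k0; move: us; rewrite sE cat_uniq => /and3P[_ ns ur] {s sE}.
under eq_fun do rewrite big_cat mulrA.
rewrite (iter_leb_int_prod (K := fun y => k * \prod_(j <- s1) u j (y j)) _ _ _ uv)// ?ltry//.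
  by rewrite mulr_ge0// prodr_ge0.
move=> y yx; congr (_ * _); apply: eq_big_seq => j js; rewrite yx//.
by apply: contra ns => jr; apply/hasP; exists j.
Qed.
End Boxes.

Section UnitVolume.
Variables (R : realType) (p e : nat).
Local Notation C := R[i].
Local Notation "x %:C" := (real_complex R x) : ring_scope.
Local Notation idx := ('I_p * 'I_p)%type.
Local Notation Rdet X := (complex.Re (\det X)).
Local Notation box b := (\1_(`[- b, b]%classic) : R -> R).
Local Notation vol := (@interval_volume R p e).
Implicit Types y : idx -> R.

Lemma in_box (b t : R) : box b t = (`|t| <= b)%R%:R.
Proof.
rewrite indicE; congr (nat_of_bool _)%:R; rewrite ler_norml.
by apply/idP/idP => [/set_mem|H]; [|apply/mem_set]; rewrite /= in_itv.
Qed.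

Lemma prod_box (J : eqType) (s : seq J) (b : R) (y : J -> R) : \prod_(j <- s) box b (y j) = (all (fun j => `|y j| <= b)%R s)%:R.
Proof.
elim: s => [|j s IH]; first by rewrite big_nil.
by rewrite big_cons IH in_box -natrM mulnb.
Qed.

Lemma hmx_coord_le y (b : R) : 0 <= b ->
  (forall i j, complex.Re (hmx y i j) ^+ 2 + complex.Im (hmx y i j) ^+ 2 <= b ^+ 2) ->
  forall j, `|y j| <= b.
Proof.
move=> b0 H [i j].
have sq (t s : R) : t ^+ 2 + s ^+ 2 <= b ^+ 2 -> `|t| <= b /\ `|s| <= b.
  by move=> ts; rewrite !ler_norml; split; apply/andP; split; nra.
rewrite -[X in `|X|](congr1 (fun f => f (i, j)) (herm_coordsK y)) /herm_coords.
case: eqP => [_|_]; first by have [] := sq _ _ (H i i).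
by case: ifP => _; [have [] := sq _ _ (H i j)|have [] := sq _ _ (H j i)].
Qed.

Lemma frob_hmx_le y (b : R) : (forall j, `|y j| <= b) ->
  frob (hmx y) <= (p * p)%:R * (2 * b ^+ 2).
Proof.
move=> yb; have sqb (t : R) : `|t| <= b -> t ^+ 2 <= b ^+ 2.
  move=> tb; rewrite -real_normK ?num_real// ler_sqr ?nnegrE//.
  exact: le_trans tb.
have b2 : 0 <= b ^+ 2 by exact: sqr_ge0.
rewrite natrM -mulrA; apply: le_trans (_ : \sum_(i < p) p%:R * (2 * b ^+ 2) <= _); last first.
  by rewrite sumr_const card_ord [leRHS]mulr_natl.
apply: ler_sum => i _; apply: le_trans (_ : \sum_(j < p) (2 * b ^+ 2) <= _); last first.
  by rewrite sumr_const card_ord [leRHS]mulr_natl.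
apply: ler_sum => j _; rewrite mxE mulr_natl mulr2n; case: ifP => _ /=.
  by apply: lerD; [exact: sqb|rewrite expr0n].
by case: ifP => _ /=; rewrite ?sqrrN; apply: lerD; exact: sqb.
Qed.

Lemma pd_trace_ge0 (X : 'M[C]_p) : pd X -> 0 <= complex.Re (\tr X).
Proof.
move=> pX; have [U [d [U1 U2 XE]]] := hermitian_spectral pX.1.
rewrite (trace_spectrum U1 XE)/= sumr_ge0// => i _.
exact/ltW/(pd_spectrum U1 XE).1.
Qed.

Lemma Re_trD (X Y : 'M[C]_p) : complex.Re (\tr (X + Y)) = complex.Re (\tr X) + complex.Re (\tr Y).
Proof. by rewrite linearD/=; case: (\tr X) (\tr Y) => ? ? []. Qed.

Lemma Re_trN (X : 'M[C]_p) : complex.Re (\tr (- X)) = - complex.Re (\tr X).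
Proof. by rewrite linearN/=; case: (\tr X). Qed.

Lemma Re_tr1 : complex.Re (\tr (1%:M : 'M[C]_p)) = p%:R.
Proof. by rewrite mxtrace1 -(rmorph_nat (real_complex R)). Qed.

(** If 1 + X and 1 - X are positive definite, their determinants are at most exp(tr X) and exp(- tr
    X), so the density is at most 1. Both traces are nonnegative and add up to 2p, which bounds the
    entries of 1 + X by 2p and the coordinates of X by 2p + 1. *)
Lemma unit_density_le y :
  interval_density e 1%:M y <= \prod_(j <- enum {: idx}) box (2 * p%:R + 1) (y j).
Proof.
rewrite /interval_density indicE.
have [/set_mem[p1 p2]|_] := boolP (y \in _); last first.
  by rewrite mul0r prod_box ler0n.
have t1 := pd_trace_ge0 p1; have t2 := pd_trace_ge0 p2.
have [d1 _] := pd_Rdet p1; have [d2 _] := pd_Rdet p2.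
rewrite mul1r prod_box (_ : all _ _ = true).
  apply: exprn_ile1; first by rewrite mulr_ge0 ?ltW.
  have := ler_pM (ltW d1) (ltW d2) (det_le_exp p1) (det_le_exp p2).
  rewrite -expRD !Re_trD Re_trN Re_tr1 [X in expR X](_ : _ = 0) ?expR0//; ring.
apply/allP => j _; apply: hmx_coord_le => {j} [|i j]; first by rewrite addr_ge0.
have := psd_entry_bound i j (pd_psd p1).
have t1' : complex.Re (\tr (1%:M + hmx y)) <= 2 * p%:R.
  by move: t1 t2; rewrite !Re_trD Re_trN Re_tr1; lra.
move: t1 t1'; set t := complex.Re (\tr _) => t0 t2p.
rewrite [X in complex.Re X]mxE [X in complex.Im X]mxE.
have -> : complex.Re ((1%:M : 'M[C]_p) i j + hmx y i j) = (i == j)%:R + complex.Re (hmx y i j).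
  by rewrite mxE -(rmorph_nat (real_complex R)); case: (hmx y i j).
have -> : complex.Im ((1%:M : 'M[C]_p) i j + hmx y i j) = complex.Im (hmx y i j).
  by rewrite mxE -(rmorph_nat (real_complex R)); case: (hmx y i j) => ? ? /=; rewrite add0r.
move: (complex.Re _) (complex.Im _) => a b.
have p0 : 0 <= p%:R :> R by [].
have t4 : t ^+ 2 <= (2 * p%:R) ^+ 2 by rewrite ler_sqr ?nnegrE// mulr_ge0.
case: (i == j) => /= H.
  have a1 : - (1 + a) <= 2 * p%:R by nra.
  by nra.
by rewrite add0r in H; nra.
Qed.

Lemma unit_volume_lty : (vol 1%:M < +oo)%E.
Proof.
have p0 : 0 <= p%:R :> R by [].
have b0 : 0 <= 2 * p%:R + 1 :> R by lra.
apply: (@le_lt_trans _ _ (leb_int (fun y => (1 * \prod_(j <- enum {: idx}) box (2 * p%:R + 1) (y j))%:E))).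
  apply: le_iter_leb_int => [||y|y].
  - by apply/measurable_EFinP; apply: measurable_interval_density; exact: adjmx1.
  - apply/measurable_EFinP; apply: measurable_funM; first exact: measurable_cst.
    apply: measurable_prod => j _; exact: (measurableT_comp (measurable_box _) (measurable_coord j)).
  - by rewrite lee_fin interval_density_ge0.
  - by rewrite lee_fin mul1r unit_density_le.
apply: (iter_leb_int_prod_lty (u := fun=> box (2 * p%:R + 1)) (v := fun=> 2 * (2 * p%:R + 1))) => //.
- exact: enum_uniq.
- exact: suffix_refl.
- by move=> j; exact: integral_box.
Qed.

Lemma unit_density_ge y (d := (4 * (p%:R + 1))^-1) : (forall j, `|y j| <= d) ->
  expR (- (1 / 4 / (1 - 1 / 4))) ^+ e <= interval_density e 1%:M y.
Proof.
move=> yd; have p0 : 0 <= p%:R :> R by [].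
have fr : frob (hmx y) <= 1 / 4.
  apply: le_trans (frob_hmx_le yd) _; rewrite /d natrM.
  have q0 : 0 < 4 * (p%:R + 1) :> R by lra.
  have : p%:R * (4 * (p%:R + 1))^-1 <= 1 / 4 :> R by rewrite ler_pdivrMr//; lra.
  have : 0 <= p%:R * (4 * (p%:R + 1))^-1 :> R by rewrite mulr_ge0// invr_ge0 ltW.
  set q := _^-1; nra.
have half : 0 <= (1 / 2 : R) < 1 by apply/andP; split; lra.
have f4 : 1 / 4 = (1 / 2) ^+ 2 :> R by field.
have p1 : pd (1%:M + hmx y).
  have [] // := near_identity (T := 1%:M + hmx y) _ half _.
    by rewrite adjmxD adjmx1 hmx_adj.
  by rewrite addrAC subrr add0r -f4.
have p2 : pd (1%:M - hmx y).
  have [] // := near_identity (T := 1%:M - hmx y) _ half _.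
    by rewrite adjmxB adjmx1 hmx_adj.
  rewrite addrAC subrr add0r -f4; apply: le_trans fr; rewrite le_eqVlt; apply/orP; left; apply/eqP.
  by apply: complexI; rewrite -!frobE adjmxN mulNmx mulmxN opprK.
rewrite /interval_density indicE mem_set// [true%:R * _]mul1r.
apply: lerXn2r; rewrite ?nnegrE ?expR_ge0//.
  by rewrite mulr_ge0// ltW//; [exact: (pd_Rdet p1).1|exact: (pd_Rdet p2).1].
have [_ E1] := pd_Rdet p1; have [_ E2] := pd_Rdet p2.
have pM : herm_psd (hmx y *m adjmx (hmx y)).
  by have := psd_congr (hmx y) (pd_psd (pd1 R p)); rewrite mulmx1.
have tM : complex.Re (\tr (hmx y *m adjmx (hmx y))) = frob (hmx y) by rewrite frobE.
have t1 : complex.Re (\tr (hmx y *m adjmx (hmx y))) < 1 by rewrite tM; lra.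
have [_ lo _] := det_onem_bounds pM t1.
have E : \det (1%:M - hmx y *m adjmx (hmx y)) = \det (1%:M + hmx y) * \det (1%:M - hmx y).
  rewrite -det_mulmx mulmxDl mul1mx mulmxBr mulmx1 hmx_adj; congr determinant.
  by rewrite addrA addrNK.
have -> : Rdet (1%:M + hmx y) * Rdet (1%:M - hmx y) = Rdet (1%:M - hmx y *m adjmx (hmx y)).
  by rewrite E E1 E2 -rmorphM.
apply: le_trans lo; rewrite ler_expR lerN2 tM.
have f0 := frob_ge0 (hmx y).
rewrite ler_pdivrMr; last by lra.
by rewrite mulrAC ler_pdivlMr; lra.
Qed.

Lemma unit_volume_gt0 : (0 < vol 1%:M)%E.
Proof.
have p0 : 0 <= p%:R :> R by [].
pose d : R := (4 * (p%:R + 1))^-1.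
have d0 : 0 < d by rewrite invr_gt0; lra.
pose k : R := expR (- (1 / 4 / (1 - 1 / 4))) ^+ e.
have k0 : 0 < k by rewrite exprn_gt0// expR_gt0.
apply: (@lt_le_trans _ _ (leb_int (fun y => (k * \prod_(j <- enum {: idx}) box d (y j))%:E))).
  rewrite /leb_int (iter_leb_int_prod (K := fun=> k) (u := fun=> box d) (v := fun=> 2 * d))//.
  - by rewrite lte_fin mulr_gt0// prodr_gt0// => j _; rewrite mulr_gt0.
  - exact: enum_uniq.
    - by move=> j; apply: integral_box; exact: ltW.
  - exact: ltW.
apply: le_iter_leb_int => [||y|y].
- apply/measurable_EFinP; apply: measurable_funM; first exact: measurable_cst.
  apply: measurable_prod => j _; exact: (measurableT_comp (measurable_box _) (measurable_coord j)).
- by apply/measurable_EFinP; apply: measurable_interval_density; exact: adjmx1.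
- by rewrite lee_fin prod_box mulr_ge0// ltW.
- rewrite lee_fin prod_box; case: allP => [H|_]; last by rewrite mulr0 interval_density_ge0.
  by rewrite mulr1; apply: unit_density_ge => j; apply: H; rewrite mem_enum.
Qed.
End UnitVolume.

Lemma iter_leb_int0 (R : realType) (I : eqType) (s : seq I) (x : I -> R) :
  iter_leb_int s (fun=> 0%E) x = 0%E.
Proof.
elim: s x => //= i s IH x; under eq_integral do rewrite IH.
exact: integral0.
Qed.

(** * Marginal densities *)

Section ToeplitzLocal.
Variables (R : realType) (p' : nat).
Local Notation C := R[i].
Local Notation p := p'.+1.
Implicit Types c : nat -> 'M[C]_p.

Lemma toep_local c c' n i j : (forall l, (l <= n)%N -> c l = c' l) ->
  (i < n.+1 * p)%N -> (j < n.+1 * p)%N -> toep c i j = toep c' i j.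
Proof.
move=> cc' iN jN; rewrite /toep cc'//.
move: iN jN; rewrite -!ltn_divLR//; move: (i %/ p)%N (j %/ p)%N => a b.
by rewrite /natdist; lia.
Qed.

Lemma toepmx_local c c' n : (forall l, (l <= n)%N -> c l = c' l) ->
  toepmx c (n.+1 * p) = toepmx c' (n.+1 * p).
Proof. by move=> cc'; apply: eq_kernel_mx => i j; exact: toep_local. Qed.

Lemma pd_toepmx_pred c n : pd (toepmx c (n.+1 * p)) -> pd (toepmx c (n * p)).
Proof. by rewrite mulSnr /toepmx kernel_mx_block => /pd_ulsubmx. Qed.

Lemma toep_col_local c c' n : (forall l, (l <= n)%N -> c l = c' l) ->
  toep_col c n = toep_col c' n.
Proof.
move=> cc'; apply: eq_kernel_mx => i j iN jp; apply: (@toep_local _ _ n) => //.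
  by apply: leq_trans iN _; rewrite leq_mul2r leqnSn orbT.
by rewrite mulSnr ltn_add2l.
Qed.

Lemma toepmx_local_pred c c' n : (forall l, (l <= n)%N -> c l = c' l) ->
  toepmx c (n * p) = toepmx c' (n * p).
Proof.
case: n => [_|n cc']; last by apply: toepmx_local => l ln; apply: cc'; exact: leqW.
by apply: eq_kernel_mx => i j; rewrite mul0n.
Qed.
End ToeplitzLocal.

Section Fibre.
Variables (R : realType) (p' : nat).
Local Notation C := R[i].
Local Notation p := p'.+1.
Local Notation "x %:C" := (real_complex R x) : ring_scope.
Local Notation idx := ('I_p * 'I_p)%type.
Local Notation Rdet X := (complex.Re (\det X)).
Implicit Types (y : nat * idx -> R).

(** The coordinates with first index j are those of C_(j+1), while C_0 is fixed. *)
Definition cseq y (j : nat) : 'M[C]_p :=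
  if j is j'.+1 then hmx (fun ab => y (j', ab)) else 1%:M.

Lemma cseq_herm y : hermitian_seq (cseq y).
Proof. by split=> // -[|j]; rewrite /= ?adjmx1 ?hmx_adj. Qed.

Definition Tz y n : 'M[C]_(n * p) := toepmx (cseq y) (n * p).

Lemma Tz_herm y n : adjmx (Tz y n) = Tz y n.
Proof. exact/toepmx_herm/cseq_herm. Qed.

(* [det T_(n+1) / det T_n] on the set where both matrices are positive definite;
   [ln] and [expR] only serve to make the expression measurable everywhere. *)
Definition schur_ratio n y : R := expR (ln (Rdet (Tz y n.+1)) - ln (Rdet (Tz y n))).

(** A weight on (C_1, ..., C_n). For [e = 0] it is the indicator of positive definiteness of
    T_(n+1), the starting point of the fibre integrations. *)
Definition toep_weight n e y : R :=
  \1_[set y | pd (Tz y n.+1)] y * schur_ratio n y ^+ e.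

Lemma schur_ratioE n y : pd (Tz y n.+1) ->
  schur_ratio n y = Rdet (Tz y n.+1) / Rdet (Tz y n).
Proof.
move=> p1; have p0 := pd_toepmx_pred p1.
have [d1 _] := pd_Rdet p1; have [d0 _] := pd_Rdet p0.
by rewrite /schur_ratio expRB !lnK.
Qed.

Lemma toep_weight_ge0 n e y : 0 <= toep_weight n e y.
Proof. by rewrite mulr_ge0 ?exprn_ge0 ?expR_ge0// indicE. Qed.

Lemma mxmeasurable_cseq j : mxmeasurable (fun y : RI R (nat * idx)%type => cseq y j).
Proof.
case: j => [|j]; first exact: mxmeasurable_cst.
apply: (mxmeasurable_hmx (y := fun (y : RI R (nat * idx)%type) ab => y (j, ab))) => ab.
exact: measurable_coord.
Qed.

Lemma mxmeasurable_Tz n : mxmeasurable (fun y : RI R (nat * idx)%type => Tz y n).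
Proof.
move=> i j; rewrite (_ : (fun _ => _) = (fun y : RI R (nat * idx)%type => toep (cseq y) i j)).
  exact: mxmeasurable_cseq.
by apply/funext => y; rewrite mxE.
Qed.

Lemma measurable_Tz_pd n : measurable ([set y | pd (Tz y n)] : set (RI R (nat * idx)%type)).
Proof. exact: (measurable_pd (@mxmeasurable_Tz n) (fun y => Tz_herm y n)). Qed.

Lemma measurable_toep_weight n e :
  measurable_fun [set: RI R (nat * idx)%type] (toep_weight n e : RI R (nat * idx)%type -> R).
Proof.
apply: measurable_funM; first by apply: measurable_indic; exact: measurable_Tz_pd.
apply: measurable_funX; apply: (measurableT_comp (@measurable_expR R)).
have md m : measurable_fun [set: RI R (nat * idx)%type]
    ((fun y => ln (Rdet (Tz y m))) : RI R (nat * idx)%type -> R).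
  apply: (measurableT_comp (@measurable_ln R)).
  exact: (cmeasurable_det (@mxmeasurable_Tz m)).1.
by apply: measurable_funB; exact: md.
Qed.

Definition block (n : nat) : seq (nat * idx) := [seq (n, ab) | ab <- enum {: idx}].

Lemma mem_block n j : (j \in block n) = (j.1 == n).
Proof.
case: j => m ab; apply/mapP/eqP => [[ab' _ [-> _]]//|/= ->]; exists ab => //.
by rewrite mem_enum.
Qed.

Lemma block_uniq n : uniq (block n).
Proof. by rewrite map_inj_uniq ?enum_uniq// => a b [->]. Qed.

Definition set_block n y (z : idx -> R) : nat * idx -> R :=
  fun j => if j.1 == n then z j.2 else y j.

Lemma iter_leb_int_block n (f : (nat * idx -> R) -> \bar R) y :
  iter_leb_int (block n) f y = leb_int (fun z => f (set_block n y z)).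
Proof.
have {1}-> : y = set_block n y (fun ab => y (n, ab)).
  by apply/funext => -[m ab]; rewrite /set_block/=; case: eqP => // ->.
rewrite (iter_leb_int_map (phi := pair n) _ f (ext := set_block n y)).
  by apply: iter_leb_int_outer => j; rewrite mem_enum.
move=> z j t; apply/funext => -[m ab]; rewrite /set_block /upd/= xpair_eqE.
by case: eqP.
Qed.

Lemma cseq_set_block_lt n y z l : (l <= n)%N -> cseq (set_block n y z) l = cseq y l.
Proof.
case: l => // l ln; congr hmx; apply/funext => ab; rewrite /set_block/=.
by rewrite (ltn_eqF ln).
Qed.

Lemma cseq_set_block_eq n y z : cseq (set_block n y z) n.+1 = hmx z.
Proof. by congr hmx; apply/funext => ab; rewrite /set_block/= eqxx. Qed.

(** With Y the deviation of C_(n+1) from its centre, det T_(n+2) / det T_(n+1) equals det(D + Y)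
    det(D - Y) / det D. Its power e integrates to a constant times det D^(2e+p) / det D^e, and det D
    is det T_(n+1) / det T_n. So the weight keeps its shape and the exponent grows by p. *)
Lemma fibre_volume n e y :
  iter_leb_int (block n) (fun y => (toep_weight n.+1 e y)%:E) y =
  (@interval_volume R p e 1%:M * (toep_weight n (e + p) y)%:E)%E.
Proof.
rewrite iter_leb_int_block.
have loc z : Tz (set_block n y z) n.+1 = Tz y n.+1.
  by apply: toepmx_local => l; exact: cseq_set_block_lt.
have loc0 z : Tz (set_block n y z) n = Tz y n.
  by apply: toepmx_local_pred => l; exact: cseq_set_block_lt.
(* If T_(n+1) is not positive definite, the weight vanishes on the whole fibre and so does the
   right-hand side. *)
have [p1|np1] := pselect (pd (Tz y n.+1)); last first.
  rewrite [X in leb_int X](_ : _ = fun=> (0 * 0)%E); last first.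
    apply/funext => z; rewrite /toep_weight indicE memNset ?mul0r ?mul0e//=.
    by move=> /pd_toepmx_pred; rewrite -/(Tz _ _) loc.
  rewrite mul0e /leb_int iter_leb_int0.
  by rewrite /toep_weight indicE memNset// mul0r mule0.
have p0 : pd (Tz y n) := pd_toepmx_pred p1.
have hc := cseq_herm y.
pose D := toep_schur (cseq y) n; pose m := toep_center (cseq y) n.
have p1' : pd (toepmx (cseq y) (n * p + p)) by rewrite -mulSnr.
have pD : pd D by apply/(pd_toepmx_succ hc p0).
have [dD dDE] := pd_Rdet pD.
have [d0 d0E] := pd_Rdet p0.
have detE : \det (Tz y n.+1) = \det (Tz y n) * \det D.
  by rewrite /Tz mulSnr; exact: det_toepmx_succ.
have ratio : schur_ratio n y = Rdet D.
  by rewrite schur_ratioE// detE d0E dDE -rmorphM/= mulrAC divff ?gt_eqF// mul1r.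
have hm : adjmx m = m by exact: toep_center_herm.
have E z : toep_weight n.+1 e (set_block n y z) =
    (Rdet D ^- e) * interval_density e D (fun j => 1 * z j + - herm_coords m j).
  pose c := cseq (set_block n y z); have hc' : hermitian_seq c := cseq_herm _.
  have cc l : (l <= n)%N -> c l = cseq y l by exact: cseq_set_block_lt.
  have p0' : pd (toepmx c (n * p)) by rewrite (toepmx_local_pred cc).
  have sE : toep_schur c n = D by rewrite /toep_schur (toepmx_local_pred cc) (toep_col_local cc).
  have mE : toep_center c n = m by rewrite /toep_center (toepmx_local_pred cc) (toep_col_local cc).
  have hz : hmx (fun j => 1 * z j + - herm_coords m j) = hmx z - m.
    have -> : (fun j => 1 * z j + - herm_coords m j) = (fun j => z j + (-1) * herm_coords m j).
      by apply/funext => j; rewrite mul1r mulN1r.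
    by rewrite hmxD hmxZ hmxK// rmorphN rmorph1 scaleN1r.
  have := pd_toepmx_succ2 hc' p0'; have := det_toepmx_succ2 hc' p0'.
  rewrite sE mE [c n.+1]cseq_set_block_eq -hz addnA -!mulSnr -/(Tz (set_block n y z) n.+2).
  set y' := (fun j => _) => detE2 pdE2.
  rewrite /toep_weight /interval_density !indicE.
  have [p2|np2] := pselect (pd (Tz (set_block n y z) n.+2)); last first.
    by rewrite memNset// mul0r memNset ?mul0r ?mulr0//= => /pdE2.
  have [pp pm] := pdE2.1 p2.
  rewrite !mem_set// !mul1r schur_ratioE// detE2 loc detE.
  have [_ e1] := pd_Rdet pp; have [_ e2] := pd_Rdet pm.
  rewrite (toepmx_local_pred cc) -/(Tz y n) d0E dDE e1 e2 -!rmorphM/= -exprVn -exprMn.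
  congr (_ ^+ _); field; by rewrite !gt_eqF.
under [X in leb_int X]eq_fun do rewrite E EFinM.
pose F z := (interval_density e D z)%:E.
have F0 z : (0 <= F z)%E by rewrite lee_fin interval_density_ge0.
have mF : measurable_fun [set: RI R idx] (F : RI R idx -> \bar R).
  by apply/measurable_EFinP; apply: measurable_interval_density; exact: pD.1.
have aff := leb_int_affine (fun j => - herm_coords m j) (fun=> ltr01) mF F0.
rewrite {1}/leb_int (@iter_leb_intZ R _ _ (fun z => F (fun j => 1 * z j + - herm_coords m j)))//.
- rewrite -/(leb_int _) aff big1 ?mul1e => [|j _]; last by rewrite invr1.
  rewrite -/(interval_volume e D) interval_volumeE// muleA -EFinM muleC; congr (_ * _%:E)%E.
  rewrite /toep_weight indicE mem_set// mul1r ratio mul2n -addnn -addnA exprD mulrA.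
  by rewrite mulVf ?mul1r// expf_neq0// gt_eqF.
- apply: (measurableT_comp (g := fun z : RI R idx => (fun j => 1 * z j + - herm_coords m j) : RI R idx) mF).
  apply: measurable_into_RI => j; apply: measurable_funD => //.
  by apply: measurable_funM => //; exact: measurable_coord.
- by rewrite lee_fin invr_ge0 exprn_ge0// ltW.
Qed.

Definition blocks (k m : nat) : seq (nat * idx) := flatten [seq block j | j <- iota k m].

Lemma blocks_succ k m : blocks k m.+1 = blocks k m ++ block (k + m).
Proof. by rewrite /blocks -[m.+1]addn1 iotaD map_cat flatten_cat/= cats0. Qed.

Lemma mem_blocks k m j : (j \in blocks k m) = (k <= j.1 < k + m)%N.
Proof.
elim: m => [|m IH]; first by rewrite addn0 in_nil; lia.
by rewrite blocks_succ mem_cat IH mem_block; lia.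
Qed.

Lemma blocks_uniq k m : uniq (blocks k m).
Proof.
elim: m => // m IH; rewrite blocks_succ cat_uniq IH block_uniq andbT /=.
apply/hasPn => j; rewrite mem_block mem_blocks => /eqP ->; by rewrite ltnn andbF.
Qed.

Lemma fibre_volumes k m e : exists2 K : R, 0 < K & forall y,
  iter_leb_int (blocks k m) (fun y => (toep_weight (k + m) e y)%:E) y =
  (K * toep_weight k (e + m * p) y)%:E.
Proof.
elim: m e => [|m IH] e.
  by exists 1 => // y; rewrite /= mul1r !addn0.
have [K K0 HK] := IH (e + p)%N.
have v0 := unit_volume_gt0 R p e; have voo := unit_volume_lty R p e.
pose v : R := fine (@interval_volume R p e 1%:M).
have vE : @interval_volume R p e 1%:M = v%:E by rewrite fineK// ge0_fin_numE// ltW.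
have vpos : 0 < v by rewrite -lte_fin -vE.
exists (v * K) => [|y]; first by rewrite mulr_gt0.
rewrite blocks_succ iter_leb_int_cat.
rewrite (_ : iter_leb_int (block _) _ =
    (fun z => v%:E * (toep_weight (k + m) (e + p) z)%:E)%E); last first.
  by apply/funext => z; rewrite addnS fibre_volume vE.
rewrite iter_leb_intZ//.
- by rewrite HK -EFinM mulrA mulSn addnA.
- apply/measurable_EFinP; exact: measurable_toep_weight.
- by move=> z; rewrite lee_fin toep_weight_ge0.
- by rewrite lee_fin ltW.
Qed.
End Fibre.

(** * Laplace asymptotics of the marginal densities *)

Section Laplace.
Variables (R : realType) (p' k : nat).
Hypothesis k_gt0 : (0 < k)%N.
Local Notation C := R[i].
Local Notation p := p'.+1.
Local Notation "x %:C" := (real_complex R x) : ring_scope.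
Local Notation idx := ('I_p * 'I_p)%type.
Local Notation Rdet X := (complex.Re (\det X)).
Local Notation Rtr X := (complex.Re (\tr X)).
Implicit Types (y z w : nat * idx -> R).

Definition energy z : R := \sum_(j < k) frob (cseq z j.+1).

Lemma energy_ge0 z : 0 <= energy z.
Proof. by apply: sumr_ge0 => j _; exact: frob_ge0. Qed.

Lemma sum_div_mod (n : nat) (f : nat -> nat -> R) :
  \sum_(i < n * p) f (i %/ p)%N (i %% p)%N = \sum_(l < n) \sum_(r < p) f l r.
Proof.
elim: n => [|n IH]; first by rewrite !big_ord0.
rewrite [RHS]big_ord_recr/= -IH mulSnr big_split_ord/=; congr (_ + _).
apply: eq_bigr => r _; rewrite divnMDl// modnMDl divn_small// modn_small//.
by rewrite addn0.
Qed.

(** The last block column contains each of C_1, ..., C_k exactly once, in reverse order. *)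
Lemma frob_toep_col z : frob (adjmx (toep_col (cseq z) k)) = energy z.
Proof.
rewrite /frob exchange_big/=.
pose f (l r : nat) := \sum_(a < p) (complex.Re (cseq z (k - l)%N (inord r) a) ^+ 2
    + complex.Im (cseq z (k - l)%N (inord r) a) ^+ 2).
transitivity (\sum_(i < k * p) f (i %/ p)%N (i %% p)%N).
  apply: eq_bigr => i _; apply: eq_bigr => a _; rewrite adjmxE mxE /toep.
  rewrite divnMDl// modnMDl (divn_small (ltn_ord a)) (modn_small (ltn_ord a)) addn0 inord_val.
  have -> : natdist (i %/ p) k = (k - i %/ p)%N.
    have : (i %/ p < k)%N by rewrite ltn_divLR.
    by move: (i %/ p)%N => l; rewrite /natdist; lia.
  by case: (cseq z _ _ _) => u v /=; rewrite sqrrN.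
rewrite sum_div_mod (reindex_inj rev_ord_inj)/=; apply: eq_bigr => l _.
apply: eq_bigr => r _; apply: eq_bigr => a _; rewrite inord_val.
by rewrite (_ : k - _ = l.+1)%N//; have := ltn_ord l; lia.
Qed.

Lemma frob_entry m n (X : 'M[C]_(m, n)) i j :
  complex.Re (X i j) ^+ 2 + complex.Im (X i j) ^+ 2 <= frob X.
Proof.
rewrite /frob (bigD1 i)//= (bigD1 j)//= -addrA lerDl addr_ge0//.
  by apply: sumr_ge0 => a _; rewrite addr_ge0 ?sqr_ge0.
by apply: sumr_ge0 => a _; apply: sumr_ge0 => b _; rewrite addr_ge0 ?sqr_ge0.
Qed.

(** The diagonal blocks cancel, every other entry belongs to one of the C_j, and there are (kp)^2
    entries in all. *)
Lemma frob_Tz_le z : frob (Tz z k - 1%:M) <= (k * p)%:R ^+ 2 * energy z.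
Proof.
have H (i j : 'I_(k * p)) : complex.Re ((Tz z k - 1%:M) i j) ^+ 2 +
    complex.Im ((Tz z k - 1%:M) i j) ^+ 2 <= energy z.
  have divlt (a : 'I_(k * p)) : (a %/ p < k)%N by rewrite ltn_divLR.
  rewrite !mxE /toep; have [dij|dij] := eqVneq (i %/ p)%N (j %/ p)%N.
    rewrite dij /natdist subnn/= !mxE.
    have -> : ((inord (i %% p) : 'I_p) == inord (j %% p)) = (i == j).
      apply/eqP/eqP => [/(congr1 val)|->//].
      rewrite /= !inordK ?ltn_mod// => mij; apply/val_inj.
      by rewrite /= (divn_eq i p) (divn_eq j p) dij mij.
    by rewrite subrr/= expr0n/= addr0 energy_ge0.
  have ij : (i == j) = false by apply/negP => /eqP E; rewrite E eqxx in dij.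
  rewrite ij subr0.
  have [l lk ->] : exists2 l, (l < k)%N & natdist (i %/ p) (j %/ p) = l.+1.
    move: (divlt i) (divlt j) dij; move: (i %/ p)%N (j %/ p)%N => a b ak bk ab.
    exists (natdist a b).-1; rewrite /natdist; move/eqP: ab; lia.
  apply: le_trans (frob_entry _ _ _) _.
  rewrite /energy (bigD1 (Ordinal lk))//= lerDl.
  by apply: sumr_ge0 => j' _; exact: frob_ge0.
rewrite /frob; apply: le_trans (_ : \sum_(i < k * p) \sum_(j < k * p) energy z <= _).
  by apply: ler_sum => i _; apply: ler_sum => j _; exact: H.
by rewrite !sumr_const card_ord -mulrnA expr2 -natrM mulr_natl.
Qed.

Lemma trace_Tz z : Rtr (Tz z k) = (k * p)%:R.
Proof.
rewrite /mxtrace (eq_bigr (fun=> 1)) => [|i _].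
  by rewrite sumr_const card_ord -(rmorph_nat (real_complex R)).
by rewrite mxE /toep /natdist subnn mxE eqxx.
Qed.

(** The weight is a power of det(1 - M). Close to the origin T_k is almost the identity and tr M
    almost the energy, so estimates for det(1 - M) in terms of tr M suffice. *)
Lemma schur_ratio_trace z (D := toep_schur (cseq z) k)
    (M := adjmx (toep_col (cseq z) k) *m invmx (Tz z k) *m toep_col (cseq z) k) :
  pd (Tz z k) -> [/\ D = 1%:M - M, herm_psd M,
    pd (Tz z k.+1) <-> pd D & pd D -> schur_ratio k z = Rdet D].
Proof.
move=> p0; have hc := cseq_herm z; split=> //.
- have := psd_congr (adjmx (toep_col (cseq z) k)) (pd_psd (pd_inv p0)).
  by rewrite adjmxK.
- by rewrite /Tz mulSnr; exact: pd_toepmx_succ.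
- move=> pD; have p1 : pd (Tz z k.+1).
    by rewrite /Tz mulSnr; exact/(pd_toepmx_succ hc p0).
  rewrite schur_ratioE//.
  have detE : \det (Tz z k.+1) = \det (Tz z k) * \det D.
    by rewrite /Tz mulSnr; exact: det_toepmx_succ.
  have [dD dDE] := pd_Rdet pD; have [d0 d0E] := pd_Rdet p0.
  by rewrite detE d0E dDE -rmorphM/= mulrAC divff ?gt_eqF// mul1r.
Qed.

(** det(1 - M) <= exp(- tr M), and tr M is at least the energy divided by tr T_k = kp. No closeness
    to the origin is assumed, as a majorant requires. *)
Lemma toep_weight_le e z :
  toep_weight k e z <= expR (- (e%:R * (energy z / (k * p)%:R))).
Proof.
rewrite /toep_weight indicE; have [/set_mem/= p1|_] := boolP (z \in _); last first.
  by rewrite mul0r expR_ge0.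
rewrite mul1r; have p0 : pd (Tz z k) := pd_toepmx_pred p1.
have [DE pM pdE ratio] := schur_ratio_trace p0.
have pD := pdE.1 p1; rewrite ratio//.
rewrite -mulrN expRM_natl; apply: lerXn2r; rewrite ?nnegrE ?expR_ge0//.
  by rewrite ltW// (pd_Rdet pD).1.
apply: le_trans (det_le_exp pD) _; rewrite ler_expR.
rewrite DE Re_trD Re_trN Re_tr1 addrAC subrr sub0r lerN2.
have := trace_inv_ge (adjmx (toep_col (cseq z) k)) p0.
by rewrite frob_toep_col trace_Tz adjmxK.
Qed.

Lemma toep_weight_bounds e z (eps : R) (F := energy z) :
  0 <= eps < 1 -> (k * p)%:R ^+ 2 * F <= eps ^+ 2 -> F / (1 - eps) < 1 ->
  expR (- (e%:R * (F / (1 - eps) / (1 - F / (1 - eps))))) <= toep_weight k e z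
    <= expR (- (e%:R * (F / (1 + eps)))).
Proof.
move=> eps01 Feps F1; have /andP[e0 e1] := eps01.
have [p0 near] := near_identity (Tz_herm z k) eps01 (le_trans (frob_Tz_le z) Feps).
have [DE pM pdE ratio] := schur_ratio_trace p0.
have := near _ (adjmx (toep_col (cseq z) k)); rewrite frob_toep_col adjmxK -/F.
set M := _ *m _ *m _ in DE pM *; set t := Rtr M => /andP[lo hi].
have t1 : t < 1 := le_lt_trans hi F1.
have [pD dlo dhi] := det_onem_bounds pM t1.
rewrite -DE in pD dlo dhi.
rewrite /toep_weight indicE mem_set; last by apply/pdE.
have hexp u : expR (- (e%:R * u)) = expR (- u) ^+ e by rewrite -mulrN expRM_natl.
rewrite mul1r ratio// !hexp; apply/andP; split; apply: lerXn2r;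
  rewrite ?nnegrE ?expR_ge0// ?(ltW (pd_Rdet pD).1)//.
- apply: le_trans dlo; rewrite ler_expR lerN2; apply: ler_pM => //.
  + have F0 : 0 <= F := energy_ge0 z.
    by apply: le_trans lo; rewrite divr_ge0// addr_ge0.
  + by rewrite invr_ge0 subr_ge0 ltW.
  + by rewrite lef_pV2 ?posrE ?subr_gt0// lerD2l lerN2.
- by apply: le_trans dhi _; rewrite ler_expR lerN2.
Qed.

Lemma frobZ m n (t : R) (X : 'M[C]_(m, n)) : frob (t%:C *: X) = t ^+ 2 * frob X.
Proof.
rewrite /frob mulr_sumr; apply: eq_bigr => i _; rewrite mulr_sumr; apply: eq_bigr => j _.
by rewrite mxE; case: (X i j) => a b /=; ring.
Qed.

Lemma energyZ t w : energy (fun j => t * w j) = t ^+ 2 * energy w.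
Proof.
rewrite /energy mulr_sumr; apply: eq_bigr => j _.
by rewrite -frobZ -hmxZ.
Qed.

Definition scale (m : nat) : R := Num.sqrt (2 * (k + m) * p)%:R.

Lemma scale_gt0 m : 0 < scale m.
Proof. by rewrite sqrtr_gt0 ltr0n !muln_gt0 addn_gt0 k_gt0. Qed.

Lemma scale_sqr m : (scale m)^-1 ^+ 2 = (2 * (k + m)%:R * p%:R)^-1.
Proof. by rewrite exprVn sqr_sqrtr// !natrM. Qed.

Definition scaled_weight m w : R := toep_weight k (m * p) (fun j => (scale m)^-1 * w j).

(** The index [m.+1] is essential: for n = k the exponent is 0 and nothing decays. The constant
    comes from (m + 1) / (k + m + 1) >= 1 / (k + 1). *)
Lemma scaled_weight_le m w :
  scaled_weight m.+1 w <= expR (- (energy w / (2 * k%:R * (k%:R + 1) * p%:R))).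
Proof.
apply: le_trans (toep_weight_le _ _) _; rewrite ler_expR lerN2 energyZ scale_sqr.
have F0 := energy_ge0 w; set F := energy w in F0 *.
have kR : 0 < k%:R :> R by rewrite ltr0n.
have pR : 0 < p%:R :> R by [].
have mR : 0 <= m%:R :> R by [].
rewrite !natrM natrD (_ : m.+1%:R = m%:R + 1)%R; last by rewrite -natr1.
have -> : (m%:R + 1) * p%:R * ((2 * (k%:R + (m%:R + 1)) * p%:R)^-1 * F / (k%:R * p%:R)) =
    F / (2 * k%:R * p%:R) * ((m%:R + 1) / (k%:R + (m%:R + 1))).
  by field; rewrite !gt_eqF//; lra.
have -> : F / (2 * k%:R * (k%:R + 1) * p%:R) = F / (2 * k%:R * p%:R) * (1 / (k%:R + 1)).
  by field; rewrite !gt_eqF//; lra.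
apply: ler_wpM2l; first by rewrite divr_ge0// !mulr_ge0// ltW.
rewrite ler_pdivrMr ?addr_gt0// mulrAC ler_pdivlMr; last lra.
nra.
Qed.

Lemma scaled_weight_cvg w :
  (fun m => scaled_weight m w) @ \oo --> expR (- (energy w / 2)).
Proof.
have F0 := energy_ge0 w; set F := energy w in F0 *.
have kR : 0 < k%:R :> R by rewrite ltr0n.
have pR : 0 < p%:R :> R by [].
pose t (m : nat) : R := (k + m)%:R^-1.
have t0 : t @ \oo --> 0.
  have := @cvg_harmonic R; rewrite -(cvg_shiftn k.-1) => H.
  apply: cvg_trans H; apply: near_eq_cvg; near=> m.
  by rewrite /t /harmonic/=; congr (_%:R^-1); lia.
pose a := F / (2 * p%:R).
have a0 : 0 <= a by rewrite divr_ge0// mulr_ge0// ltW.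
(* The rescaled energy is [a * t m]; this [eps] gives equality in the hypothesis of
   [toep_weight_bounds] on the distance of T_k to the identity. *)
pose eps m := (k * p)%:R * Num.sqrt (a * t m).
have at0 : (fun m => a * t m) @ \oo --> 0 by rewrite -[X in _ --> X](mulr0 a); exact: cvgMr.
have eps_cvg : eps @ \oo --> 0.
  rewrite -[X in _ --> X](mulr0 (k * p)%:R); apply: cvgMr.
  rewrite -[X in _ --> X]sqrtr0; apply: cvg_comp at0 _; exact: sqrt_continuous.
have inv1 (u : nat -> R) : u @ \oo --> 0 -> (fun m => (1 - u m)^-1) @ \oo --> (1 : R).
  move=> u0; rewrite -[X in _ --> X]invr1; apply: cvgV; first exact: oner_neq0.
  by rewrite -[X in _ --> X](subr0 1); apply: cvgB => //; exact: cvg_cst.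
have inv1p (u : nat -> R) : u @ \oo --> 0 -> (fun m => (1 + u m)^-1) @ \oo --> (1 : R).
  move=> u0; have := inv1 (fun m => - u m); rewrite -[X in (_ --> X) -> _]oppr0.
  move=> /(_ (cvgN u0)); by under eq_fun do rewrite opprK.
have atE m : energy (fun j => (scale m)^-1 * w j) = a * t m.
  rewrite energyZ scale_sqr -/F /a /t natrD; field.
  by rewrite !gt_eqF//; have : 0 <= m%:R :> R by []; lra.
(* Exponent times rescaled energy is (F / 2) m / (k + m): the loss of k blocks is invisible in the
   limit. *)
have mpE m : (m * p)%:R * (a * t m) = F / 2 * (1 - k%:R * t m).
  rewrite /a /t natrM natrD; field.
  by rewrite !gt_eqF//; have : 0 <= m%:R :> R by []; lra.
have main_cvg : (fun m => F / 2 * (1 - k%:R * t m)) @ \oo --> F / 2.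
  rewrite -[X in _ --> X]mulr1; apply: cvgMr.
  rewrite [X in _ --> X](_ : _ = 1 - k%:R * 0 :> R); last by rewrite mulr0 subr0.
  by apply: cvgB; [exact: cvg_cst|exact: cvgMr].
have q_cvg : (fun m => a * t m / (1 - eps m)) @ \oo --> 0.
  by rewrite -[X in _ --> X](mulr1 0); apply: cvgM => //; exact: inv1.
apply: (@squeeze_cvgr _ _ _ _
   (fun m => expR (- (F / 2 * (1 - k%:R * t m) * (1 - eps m)^-1
                       * (1 - a * t m / (1 - eps m))^-1)))
   (fun m => expR (- (F / 2 * (1 - k%:R * t m) * (1 + eps m)^-1)))).
- near=> m; rewrite -!mpE /scaled_weight.
  have e01 : 0 <= eps m < 1.
    apply/andP; split; first by rewrite mulr_ge0// sqrtr_ge0.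
    near: m; exact: (cvgr_lt _ eps_cvg).
  have C1 : (k * p)%:R ^+ 2 * (a * t m) <= eps m ^+ 2.
    by rewrite /eps exprMn sqr_sqrtr// mulr_ge0// /t invr_ge0.
  have C2 : a * t m / (1 - eps m) < 1 by near: m; exact: (cvgr_lt _ q_cvg).
  have := toep_weight_bounds (m * p) (z := fun j => (scale m)^-1 * w j) e01.
  by rewrite atE => /(_ C1 C2); rewrite !mulrA.
- apply: cvg_comp; last exact: continuous_expR.
  apply: cvgN; rewrite -[X in _ --> X]mulr1; apply: cvgM; last exact: inv1.
  by rewrite -[X in _ --> X]mulr1; apply: cvgM => //; exact: inv1.
- apply: cvg_comp; last exact: continuous_expR.
  by apply: cvgN; rewrite -[X in _ --> X]mulr1; apply: cvgM => //; exact: inv1p.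
Unshelve.
all: by end_near.
Qed.
End Laplace.

(** * Signed measures and Riemann sums *)

Section SignedMeasures.
Variable R : realType.
Implicit Types (rho : set R -> R) (f : R -> R).
Local Notation J01 := (@I01 R).

Definition node (m i : nat) : R := i%:R / m.+1%:R.
Definition cell (m i : nat) : set R := J01 `&` [set x | i%:R <= x * m.+1%:R < i.+1%:R].
(** The cells are half-open of length 1 / (m + 1), so the point 1 forms a cell of its own; this
    accounts for [m.+2] summands. *)
Definition cell_sum rho f m : R := \sum_(i < m.+2) f (node m i) * rho (cell m i).

Lemma measurable_I01 : measurable J01.
Proof.
rewrite (_ : J01 = `[0, 1]%classic); first exact: measurable_itv.
by apply/seteqP; split=> x /=; rewrite in_itv.
Qed.

Lemma cellE m i : cell m i = J01 `&` `[node m i, node m i.+1[%classic.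
Proof.
have m0 : 0 < m.+1%:R :> R by [].
by apply/seteqP; split=> x /= [x01 H]; split=> //; move: H;
  rewrite in_itv/= /node ler_pdivrMr// ltr_pdivlMr.
Qed.

Lemma measurable_cell m i : measurable (cell m i).
Proof. by rewrite cellE; apply: measurableI; [exact: measurable_I01|exact: measurable_itv]. Qed.

Definition cell_index m (x : R) : nat := Num.truncn (x * m.+1%:R).

Lemma mem_cell m i x : J01 x -> cell m i x <-> i = cell_index m x.
Proof.
move=> x01; have x0 : 0 <= x * m.+1%:R by rewrite mulr_ge0//; case/andP: x01.
have tr := truncn_itv x0; split=> [[_ /= H]|->]; last by split.
by apply/esym/truncn_def.
Qed.

Lemma cell_index_lt m x : J01 x -> (cell_index m x < m.+2)%N.
Proof.
move=> x01; have /andP[x0 x1] := x01.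
have : (cell_index m x)%:R <= m.+1%:R :> R.
  apply: le_trans (_ : x * m.+1%:R <= _); first by rewrite truncn_le// mulr_ge0.
  by rewrite ler_piMl.
by rewrite ler_nat ltnS.
Qed.

Lemma node_dist m x : J01 x -> `|x - node m (cell_index m x)| <= m.+1%:R^-1.
Proof.
move=> x01; have [_ /= /andP[lo hi]] := (mem_cell m _ x01).2 erefl.
have m0 : 0 < m.+1%:R :> R by [].
have lo' : node m (cell_index m x) <= x by rewrite /node ler_pdivrMr.
rewrite ger0_norm ?subr_ge0// lerBlDr /node -[X in X + _]mul1r -mulrDl ler_pdivlMr//.
by rewrite addrC natr1 ltW.
Qed.

Lemma node_in m i : (i < m.+2)%N -> 0 <= node m i <= 1.
Proof.
move=> im; rewrite divr_ge0//= ler_pdivrMr// mul1r ler_nat; exact: im.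
Qed.

Lemma sum_indic_cell (g : nat -> R) m x : J01 x ->
  \sum_(i < m.+2) g i * \1_(cell m i) x = g (cell_index m x).
Proof.
move=> x01; pose i0 := Ordinal (cell_index_lt m x01).
rewrite (bigD1 i0)//= indicE mem_set ?mulr1; last exact/mem_cell.
rewrite big1 ?addr0// => i ii0; rewrite indicE memNset ?mulr0// => /(mem_cell _ _ x01) E.
by move/eqP: ii0; apply; apply/val_inj.
Qed.

Lemma cell_bound m x : J01 x -> node m (cell_index m x) <= 1 /\ 0 <= node m (cell_index m x).
Proof. by move=> /(cell_index_lt m)/node_in/andP[]. Qed.

Lemma node_cvg x : J01 x -> (fun m => node m (cell_index m x)) @ \oo --> x.
Proof.
move=> x01; apply/cvgrPdist_le => eps e0; near=> m.
apply: le_trans (node_dist m x01) _.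
near: m; have := @cvg_harmonic R => /cvgrPdist_le/(_ _ e0); apply: filterS => m.
by rewrite sub0r normrN ger0_norm// invr_ge0.
Unshelve.
all: by end_near.
Qed.

(** The cell sum is the integral of a step function that is bounded by 1 and converges pointwise to
    [f], by continuity. *)
Lemma integral01_cell_sum (mu : {measure set R -> \bar R}) f :
  (mu J01 < +oo)%E -> continuous f -> (forall x, J01 x -> 0 <= f x <= 1) ->
  cell_sum (fun B => fine (mu B)) f @ \oo --> fine (\int[mu]_(x in J01) (f x)%:E)%E.
Proof.
move=> mufin cf f01; have mI := measurable_I01.
pose g m x : R := \sum_(i < m.+2) f (node m i) * \1_(cell m i) x.
have fn0 m (i : 'I_m.+2) : 0 <= f (node m i).
  by have /f01/andP[] : J01 (node m i) by exact: node_in.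
have mcell m i : (mu (cell m i) < +oo)%E.
  by apply: le_lt_trans mufin; apply: le_measure; rewrite ?inE//; [exact: measurable_cell|exact: subIsetl].
have gE m : (\int[mu]_(x in J01) (g m x)%:E)%E = (cell_sum (fun B => fine (mu B)) f m)%:E.
  under eq_integral do rewrite /g -sumEFin.
  rewrite ge0_integral_sum//; last 2 first.
  - move=> i; apply/measurable_EFinP; apply: measurable_funM; first exact: measurable_cst.
    by apply: measurable_indic; exact: measurable_cell.
  - by move=> i x _; rewrite lee_fin mulr_ge0// indicE.
  rewrite /cell_sum -sumEFin; apply: eq_bigr => i _.
  under eq_integral do rewrite EFinM.
  rewrite ge0_integralZl//; last 2 first.
  - by apply/measurable_EFinP; apply: measurable_indic; exact: measurable_cell.
  - by rewrite lee_fin.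
  rewrite integral_indic//; last exact: measurable_cell.
  by rewrite (setIidl (@subIsetl _ _ _)) EFinM fineK// ge0_fin_numE.
have Hc : (fun m => (cell_sum (fun B => fine (mu B)) f m)%:E) @ \oo -->
    (\int[mu]_(x in J01) (f x)%:E)%E.
  under eq_fun do rewrite -gE.
  apply: (@dominated_cvg _ _ _ mu J01 mI _ _ (cst 1%E)) => //.
  - move=> m; apply/measurable_EFinP; apply: measurable_sum => i.
    apply: measurable_funM; first exact: measurable_cst.
    by apply: measurable_indic; exact: measurable_cell.
  - move=> x x01; apply: cvg_EFin; first by near=> m.
    under eq_fun do rewrite /= /g (sum_indic_cell (fun i => f (node _ i)))//.
    by apply: (@cvg_comp _ _ _ (fun m => node m (cell_index m x)) f); [exact: node_cvg|exact: cf].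
  - by apply/integrableP; split=> //; rewrite (eq_integral (cst 1%E)) ?integral_cst ?mul1e// => x _ /=; rewrite normr1.
  - move=> m x x01; rewrite /g (sum_indic_cell (fun i => f (node _ i)))// /=.
    have [n1 n0] := cell_bound m x01.
    have /f01/andP[h0 h1] : J01 (node m (cell_index m x)) by rewrite /J01/= n0.
    by rewrite lee_fin ger0_norm.
have int0 : (0 <= \int[mu]_(x in J01) (f x)%:E)%E.
  by apply: integral_ge0 => x /f01/andP[h0 _]; rewrite lee_fin.
suff intfin : (\int[mu]_(x in J01) (f x)%:E < +oo)%E.
  by rewrite -[X in _ --> X]fineK ?ge0_fin_numE// in Hc; exact: (fine_cvg Hc).
apply: le_lt_trans mufin; rewrite -[leRHS]mul1e -integral_cst//.
apply: ge0_le_integral => //; last by move=> x /f01/andP[_ h1]; rewrite lee_fin.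
- by move=> x /f01/andP[h0 _]; rewrite lee_fin.
- apply/measurable_EFinP/measurable_funTS; exact: continuous_measurable_fun.
Unshelve.
all: by end_near.
Qed.

Section Jordan.
Variables (rho : set R -> R) (P N : set R).
Hypotheses (srho : real_sigma_additive rho) (mP : measurable P) (mN : measurable N).
Hypothesis PN : P `|` N = setT.
Hypotheses (Ppos : forall A, measurable A -> A `<=` P -> 0 <= rho A).
Hypotheses (Nneg : forall A, measurable A -> A `<=` N -> rho A <= 0).
Hypothesis rhoU : forall A B, measurable A -> measurable B -> A `&` B = set0 ->
  rho (A `|` B) = rho A + rho B.

Lemma rho_split A B : measurable A -> measurable B -> rho A = rho (A `&` B) + rho (A `\` B).
Proof.
move=> mA mB; rewrite -rhoU ?setUIDK//; first exact: measurableI; first exact: measurableD.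
by apply/seteqP; split=> x // [[_ Bx] [_ nBx]].
Qed.

(** The supremum is attained at the intersection with the positive set [P] of a Hahn decomposition:
    a competitor D loses mass on D minus P and can only gain from the rest of the intersection of B
    and P. *)
Lemma pos_variationE B : measurable B -> pos_variation rho B = (rho (B `&` P))%:E.
Proof.
move=> mB; apply/eqP; rewrite eq_le; apply/andP; split.
  apply: ge_ereal_sup => _ [D [mD DB] <-]; rewrite lee_fin.
  rewrite (rho_split mD mP) (rho_split (measurableI _ _ mB mP) mD).
  have -> : B `&` P `&` D = D `&` P.
    apply/seteqP; split=> x; first by move=> [[]].
    by move=> [Dx Px]; do 2?split => //; exact: DB.
  rewrite lerD2l; apply: (@le_trans _ _ 0).
    apply: Nneg; first exact: measurableD.
    by move=> x [_ nPx]; have [] : (P `|` N) x by rewrite PN.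
  by apply: Ppos; [apply: measurableD => //; exact: measurableI|move=> x [[]]].
apply: ereal_sup_ubound; exists (B `&` P) => //; split; first exact: measurableI.
exact: subIsetl.
Qed.

Lemma pos_variation_sigma : rho set0 = 0 -> semi_sigma_additive (pos_variation rho).
Proof.
move=> rho0 F mF tF mU; rewrite pos_variationE// setI_bigcupl.
under eq_fun do under eq_bigr do rewrite pos_variationE//.
rewrite (_ : (fun n => _) = EFin \o (fun n => \sum_(0 <= i < n) rho (F i `&` P))); last first.
  by apply/funext => n /=; rewrite sumEFin.
apply: cvg_EFin; first by near=> n.
have tFP : trivIset setT (fun i => F i `&` P).
  by move=> i j _ _ [x [[Fix _] [Fjx _]]]; apply: tF => //; exists x.
have := srho (fun i => measurableI _ _ (mF i) mP) tFP.
by under eq_fun do rewrite -(big_mkord xpredT (fun i => rho (F i `&` P))).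
Unshelve. all: by end_near.
Qed.

Lemma cell_sum_pos_variation f : rho set0 = 0 ->
  continuous f -> (forall x, J01 x -> 0 <= f x <= 1) ->
  cell_sum (fun B => rho (B `&` P)) f @ \oo -->
  fine (\int[pos_variation rho]_(x in J01) (f x)%:E)%E.
Proof.
move=> rho0 cf f01.
have v0 : pos_variation rho set0 = 0%E by rewrite pos_variationE// set0I rho0.
have vge0 x : (0 <= pos_variation rho x)%E.
  apply: ereal_sup_ubound; exists set0; last by rewrite rho0.
  by split; [exact: measurable0|exact: sub0set].
pose nu : {measure set R -> \bar R} := HB.pack (pos_variation rho)
  (isMeasure.Build _ _ _ (pos_variation rho) v0 vge0 (pos_variation_sigma rho0)).
have /(_ f) := @integral01_cell_sum nu.
rewrite [nu J01]pos_variationE ?ltry//; last exact: measurable_I01.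
move=> /(_ isT cf f01).
rewrite (_ : cell_sum _ f = cell_sum (fun B => rho (B `&` P)) f)//.
apply/funext => m; apply: eq_bigr => i _.
by rewrite [nu _]pos_variationE//; exact: measurable_cell.
Qed.
End Jordan.

(** For the constant sequence of empty sets the partial sums converge to [rho set0]; comparing with
    the shifted sums gives [rho set0 = rho set0 + rho set0]. *)
Lemma sigma_additive0 rho : real_sigma_additive rho -> rho set0 = 0.
Proof.
move=> srho.
have t0 : trivIset setT (fun _ : nat => set0 : set R) by move=> i j _ _ [x []].
have /= H := srho (fun=> set0) (fun=> measurable0) t0.
rewrite bigcup0// in H.
have H1 := H; rewrite -cvg_shiftS/= in H1.
have H2 := cvgD H (cvg_cst (rho set0)).
rewrite (_ : (fun n => _) = (fun n => \sum_(i < n) rho set0) + cst (rho set0)) in H1; last first.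
  by apply/funext => n; rewrite big_ord_recr.
by apply: (@addrI _ (rho set0)); rewrite addr0; apply: (cvg_unique _ (H2 _ _) H1).
Qed.

Lemma sigma_additiveN rho : real_sigma_additive rho -> real_sigma_additive (fun B => - rho B).
Proof.
by move=> srho F mF tF; under eq_fun do rewrite sumrN; apply: cvgN; exact: srho.
Qed.

Lemma sigma_additiveU rho A B : real_sigma_additive rho ->
  measurable A -> measurable B -> A `&` B = set0 -> rho (A `|` B) = rho A + rho B.
Proof.
move=> srho mA mB AB.
have mF n : measurable (bigcup2 A B n) by case: n => [|[|n]]; rewrite /bigcup2/=.
have := srho (bigcup2 A B); rewrite bigcup2E.
move=> /(_ mF); rewrite -trivIset_bigcup2 => /(_ AB).
move/cvg_lim => <-//; apply/cvg_lim => //.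
rewrite -(cvg_shiftn 2)/=; apply: cvg_near_cst; near=> n.
rewrite addn2 !big_ord_recl/= big1 ?addr0// => i _.
exact: sigma_additive0.
Unshelve. all: by end_near.
Qed.

Lemma sigma_additive_charge rho : real_sigma_additive rho ->
  semi_sigma_additive (fun B => (rho B)%:E).
Proof.
move=> srho F mF tF mU.
rewrite (_ : (fun n => _) = EFin \o (fun n => \sum_(0 <= i < n) rho (F i))); last first.
  by apply/funext => n /=; rewrite sumEFin.
apply: cvg_EFin; first by near=> n.
have /= := srho _ mF tF.
by under eq_fun do rewrite -(big_mkord xpredT (fun i => rho (F i))).
Unshelve. all: by end_near.
Qed.

(** A Hahn decomposition reduces this to two positive measures. Afterwards signed integrals are
    handled through these sums, which are evidently linear in [rho] and in [f]. *)
Lemma signed_int01_cvg rho f : real_sigma_additive rho ->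
  continuous f -> (forall x, J01 x -> 0 <= f x <= 1) ->
  cell_sum rho f @ \oo --> signed_int01 rho f.
Proof.
move=> srho cf f01.
have rho0 := sigma_additive0 srho.
pose nu : {charge set R -> \bar R} := HB.pack (fun B => (rho B)%:E)
  (isCharge.Build _ _ _ (fun B => (rho B)%:E) (congr1 EFin rho0) (fun _ _ => isT)
   (sigma_additive_charge srho)).
have [P [N [[mP Ppos] [mN Nneg] PN PN0]]] := Hahn_decomposition nu.
have rhoU A B := @sigma_additiveU rho A B srho.
have rhoNU A B : measurable A -> measurable B -> A `&` B = set0 ->
    - rho (A `|` B) = - rho A + - rho B.
  by move=> *; rewrite rhoU// opprD.
have Hp : cell_sum (fun B => rho (B `&` P)) f @ \oo -->
    fine (\int[pos_variation rho]_(x in J01) (f x)%:E)%E.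
  by apply: (@cell_sum_pos_variation rho P N).
have Hn : cell_sum (fun B => - rho (B `&` N)) f @ \oo -->
    fine (\int[pos_variation (fun B => (- rho B)%R)]_(x in J01) (f x)%:E)%E.
  apply: (@cell_sum_pos_variation (fun B => - rho B) N P) => //.
  - exact: sigma_additiveN.
  - by rewrite setUC.
  - by move=> A mA AN; rewrite oppr_ge0 -lee_fin; exact: Nneg.
  - by move=> A mA AN; rewrite oppr_le0 -lee_fin; exact: Ppos.
  - by rewrite rho0 oppr0.
suff E : cell_sum rho f = cell_sum (fun B => rho (B `&` P)) f - cell_sum (fun B => - rho (B `&` N)) f.
  by rewrite E; exact: cvgB.
apply/funext => m; rewrite -[RHS]/(_ - _) /cell_sum -sumrB; apply: eq_bigr => i _.
have mC := measurable_cell m i.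
rewrite -mulrBr opprK -rhoU; [|exact: measurableI|exact: measurableI|].
  by rewrite -setIUr PN setIT.
by rewrite setIACA PN0 setI0.
Qed.

Lemma sum_cell rho m : real_sigma_additive rho -> \sum_(i < m.+2) rho (cell m i) = rho J01.
Proof.
move=> srho.
have UE n : \sum_(i < n) rho (cell m i) = rho (\bigcup_(i < n) cell m i).
  elim: n => [|n IH]; first by rewrite big_ord0 bigcup_mkord big_ord0 (sigma_additive0 srho).
  rewrite big_ord_recr/= IH -sigma_additiveU//.
  - congr rho; rewrite !bigcup_mkord big_ord_recr/=. by [].
  - by apply: bigcup_measurable => i _; exact: measurable_cell.
  - exact: measurable_cell.
  apply/seteqP; split=> // x [[i /= im ci] cn].
  have x01 : J01 x by case: cn.
  by move: ci cn im => /(mem_cell _ _ x01) -> /(mem_cell _ _ x01) ->; rewrite ltnn.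
rewrite UE; congr rho; apply/seteqP; split=> x.
  by move=> [i _ []].
by move=> x01; exists (cell_index m x); [exact: cell_index_lt|exact/mem_cell].
Qed.
End SignedMeasures.

(** * The moment space as a set of Toeplitz matrices *)

Section UnitaryExtension.
Variable R : realType.
Local Notation C := R[i].
Local Notation "x %:C" := (real_complex R x) : ring_scope.

(** The rows of P are an orthonormal basis of the orthogonal complement of the row space of Q,
    obtained by the Gram-Schmidt process. *)
Lemma unitary_complement r N (Q : 'M[C]_(r, N)) : Q *m adjmx Q = 1%:M ->
  exists P : 'M[C]_(N - r, N), [/\ P *m adjmx P = 1%:M, Q *m adjmx P = 0 &
    adjmx Q *m Q + adjmx P *m P = 1%:M].
Proof.
move=> QQ; have uQ : Q \is unitarymx by apply/unitarymxP.
have rQ := mxrank_unitary uQ.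
have E : \rank (orthomx Num.conj 1%:M Q) = (N - r)%N by rewrite rank_ortho rQ.
have [V VE] : exists V : 'M[C]_(N - r, N), (V :=: orthomx Num.conj 1%:M Q)%MS.
  by rewrite -E; exists (row_base (orthomx Num.conj 1%:M Q)); exact: eq_row_base.
pose P := schmidt V.
have uP : P \is unitarymx by apply: schmidt_unitarymx; exact: leq_subr.
have VP : (V :=: P)%MS.
  apply/eqmxP; rewrite schmidt_sub/= -(geq_leqif (mxrank_leqif_sup (schmidt_sub V))).
  by rewrite (mxrank_unitary uP) VE E.
have PP : P *m adjmx P = 1%:M by apply/unitarymxP.
have PQ : P *m adjmx Q = 0 by apply/orthomx1P; rewrite -VP VE.
have QP : Q *m adjmx P = 0 by rewrite -[LHS]adjmxK adjmxM adjmxK PQ adjmx0.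
exists P; split => //.
have : (1%:M <= Q + P)%MS.
  by rewrite -(adds_eqmx (eqmx_refl Q) (eqmx_trans (eqmx_sym VE) VP)) addsmx_ortho submx1.
move=> /sub_addsmxP[[X Y] /= XY].
have -> : adjmx Q = X.
  by rewrite -[LHS]mul1mx XY mulmxDl -!mulmxA QQ PQ mulmx1 mulmx0 addr0.
have -> : adjmx P = Y.
  by rewrite -[LHS]mul1mx XY mulmxDl -!mulmxA PP QP mulmx1 mulmx0 add0r.
by rewrite -XY.
Qed.

Lemma mul_adj_eq0 m n (X : 'M[C]_(m, n)) : X *m adjmx X = 0 -> X = 0.
Proof.
move=> X0; apply/matrixP => i j; rewrite mxE.
have /eqP := congr1 (fun M : 'M[C]_m => M i i) X0; rewrite !mxE.
under eq_bigr do rewrite adjmxE.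
rewrite psumr_eq0; last by move=> l _; rewrite mulcJ_ge0.
by move=> /allP/(_ j); rewrite mem_index_enum => /(_ isT); rewrite mulf_eq0 conjc_eq0 orbb => /eqP.
Qed.

(** [S] is an inverse square root of the Gram matrix, up to a unitary factor. Its defining equation
    mentions only the Gram matrix, so the same [S] orthonormalises the rows of any other matrix with
    that Gram matrix. *)
Lemma gram_orthonormal r N (A : 'M[C]_(r, N)) : row_free A ->
  exists S T : 'M[C]_r, T *m S = 1%:M /\ S *m (A *m adjmx A) *m adjmx S = 1%:M.
Proof.
move=> fA; have hH : adjmx (A *m adjmx A) = A *m adjmx A by rewrite adjmxM adjmxK.
have [U [d [U1 U2 HE]]] := hermitian_spectral hH.
have pH : pd (A *m adjmx A).
  split=> // v v0; have : herm_psd (A *m adjmx A).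
    have := @psd_congr R _ _ A 1%:M; rewrite mulmx1; apply; apply: pd_psd; exact: pd1.
  move=> [_ /(_ v)]; rewrite le_eqVlt => /orP[/eqP E|//]; exfalso.
  move/eqP: v0; apply.
  have : adjmx v *m A = 0.
    apply: mul_adj_eq0; apply/matrixP => i j; rewrite !ord1.
    by rewrite adjmxM adjmxK mulmxA -[adjmx v *m A *m _]mulmxA -E mxE.
  rewrite -(mul0mx _ A) => /(row_free_inj fA) v0.
  by rewrite -[v]adjmxK v0 adjmx0.
have d0 := (pd_spectrum U1 HE).1 pH.
pose D := diag_mx (\row_i ((Num.sqrt (d 0 i))^-1)%:C).
pose E := diag_mx (\row_i ((Num.sqrt (d 0 i)))%:C).
have DE : D *m E = 1%:M.
  rewrite /D /E mulmx_diag -diag_const_mx; congr diag_mx; apply/rowP => i; rewrite !mxE.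
  by rewrite -rmorphM/= mulVf ?rmorph1// gt_eqF// sqrtr_gt0.
exists (D *m U), (adjmx U *m E).
have ED : E *m D = 1%:M by exact: mulmx1C.
split; first by rewrite mulmxA -[_ *m E *m D]mulmxA ED mulmx1.
have -> : adjmx (D *m U) = adjmx U *m D.
  rewrite adjmxM; congr (_ *m _); apply/matrixP => i j; rewrite adjmxE !mxE eq_sym.
  by case: eqP => [->|_]; rewrite ?mulr1n ?mulr0n ?conjc0// conjc_real.
rewrite HE !mulmxA -[D *m U *m _]mulmxA U1 mulmx1 -[_ *m U *m adjmx U]mulmxA U1 mulmx1.
have -> : diag_mx (map_mx (real_complex R) d) = E *m E.
  rewrite /E mulmx_diag; congr diag_mx; apply/rowP => i; rewrite !mxE.
  by rewrite -rmorphM/= -expr2 sqr_sqrtr// ltW.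
by rewrite mulmxA DE mul1mx ED.
Qed.

(** Equal Gram matrices make the correspondence of rows an isometry between the two row spaces.
    These have equal dimension, hence so do their complements, and the isometry extends to a unitary
    map. *)
Lemma unitary_extension M N (A B : 'M[C]_(M, N)) : A *m adjmx A = B *m adjmx B ->
  exists2 W : 'M[C]_N, W *m adjmx W = 1%:M & A *m W = B.
Proof.
move=> AB; pose f := maxrankfun A; pose A1 := rowsub f A; pose B1 := rowsub f B.
have fA : row_free A1 by exact: maxrowsub_free.
have AX : A = A *m pinvmx A1 *m A1 by rewrite mulmxKpV// eq_maxrowsub.
set X := A *m pinvmx A1 in AX.
have rs (D E : 'M[C]_(M, N)) : rowsub f D *m adjmx (rowsub f E) = mxsub f f (D *m adjmx E).
  by rewrite mxsub_mul; congr (_ *m _); apply/matrixP => i j; rewrite !mxE.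
have A1B1 : A1 *m adjmx A1 = B1 *m adjmx B1 by rewrite !rs AB.
have cross (D E : 'M[C]_(M, N)) : D *m adjmx (rowsub f E) = colsub f (D *m adjmx E).
  by apply/matrixP => i j; rewrite !mxE; apply: eq_bigr => l _; rewrite !mxE.
have crossl (D E : 'M[C]_(M, N)) : rowsub f D *m adjmx E = rowsub f (D *m adjmx E).
  by apply/matrixP => i j; rewrite !mxE; apply: eq_bigr => l _; rewrite !mxE.
(* The Gram matrix of D - X (rows of D) is a function of the Gram matrix of D. It vanishes for A,
   hence for B. *)
have BX : B = X *m B1.
  apply/subr0_eq/mul_adj_eq0.
  have gram (D : 'M[C]_(M, N)) : (D - X *m rowsub f D) *m adjmx (D - X *m rowsub f D) =
      D *m adjmx D - colsub f (D *m adjmx D) *m adjmx X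
      - X *m rowsub f (D *m adjmx D) + X *m mxsub f f (D *m adjmx D) *m adjmx X.
    rewrite adjmxB adjmxM mulmxBl !mulmxBr -rs -crossl -cross !mulmxA opprB addrA.
    by rewrite -!addrA; congr (_ + (_ + _)); rewrite addrC.
  by rewrite gram -AB -gram -/A1 -AX subrr mul0mx.
have [S [T [TS SH]]] := gram_orthonormal fA.
pose QA := S *m A1; pose QB := S *m B1.
have QAQ : QA *m adjmx QA = 1%:M by rewrite adjmxM !mulmxA -[S *m A1 *m _]mulmxA.
have QBQ : QB *m adjmx QB = 1%:M.
  by rewrite adjmxM !mulmxA -[S *m B1 *m _]mulmxA -A1B1.
have A1E : A1 = T *m QA by rewrite mulmxA TS mul1mx.
have B1E : B1 = T *m QB by rewrite mulmxA TS mul1mx.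
clearbody QA QB.
have [PA [PAP QPA sumA]] := unitary_complement QAQ.
have [PB [PBP QPB sumB]] := unitary_complement QBQ.
have PQB : PB *m adjmx QB = 0 by rewrite -[LHS]adjmxK adjmxM adjmxK QPB adjmx0.
exists (adjmx QA *m QB + adjmx PA *m PB).
  rewrite adjmxD !adjmxM !adjmxK mulmxDr !mulmxDl.
  rewrite -!mulmxA ![QB *m (_ *m _)]mulmxA ![PB *m (_ *m _)]mulmxA QBQ QPB PQB PBP.
  by rewrite !mul0mx !mulmx0 !mul1mx addr0 add0r.
have A1W : A1 *m (adjmx QA *m QB + adjmx PA *m PB) = B1.
  rewrite A1E B1E -mulmxA; congr (_ *m _).
  by rewrite mulmxDr !mulmxA QAQ QPA mul0mx addr0 mul1mx.
rewrite [X in _ = X]BX -A1W mulmxA; congr (_ *m _); exact: AX.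
Qed.

Lemma unitary_spectral n (W : 'M[C]_n) : W *m adjmx W = 1%:M ->
  exists (V : 'M[C]_n) (d : 'rV[C]_n), [/\ adjmx V *m V = 1%:M, V *m adjmx V = 1%:M,
    W = adjmx V *m diag_mx d *m V & forall l, d 0 l * conjc (d 0 l) = 1].
Proof.
move=> W1; have W2 := mulmx1C W1.
have nW : W \is normalmx by apply/normalmxP; exact: etrans W1 (esym W2).
have uV := spectral_unitarymx W.
have V1 : spectralmx W *m adjmx (spectralmx W) = 1%:M by apply/unitarymxP.
have V2 := mulmx1C V1.
have WE : W = adjmx (spectralmx W) *m diag_mx (spectral_diag W) *m spectralmx W.
  by have /orthomx_spectralP {1}-> := nW; rewrite invmx_unitary.
exists (spectralmx W), (spectral_diag W); split=> //.
set V := spectralmx W in V1 V2 WE *; set d := spectral_diag W in WE *.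
have DE : diag_mx d = V *m W *m adjmx V.
  by rewrite WE !mulmxA V1 mul1mx -mulmxA V1 mulmx1.
move=> l; have : diag_mx d *m adjmx (diag_mx d) = 1%:M.
  rewrite DE !adjmxM adjmxK !mulmxA -[_ *m adjmx V *m V]mulmxA V2 mulmx1.
  by rewrite -[_ *m W *m adjmx W]mulmxA W1 mulmx1.
move/(congr1 (fun M : 'M[C]_n => M l l)); rewrite mul_diag_mx !mxE eqxx.
by rewrite !mulr1n.
Qed.

Lemma psd_factor n (T : 'M[C]_n) : herm_psd T -> exists G : 'M[C]_n, T = G *m adjmx G.
Proof.
move=> pT; have [U [d [U1 U2 TE]]] := hermitian_spectral pT.1.
have d0 := psd_spectrum U1 TE pT.
exists (adjmx U *m diag_mx (\row_i ((Num.sqrt (d 0 i)))%:C)).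
rewrite adjmxM adjmxK TE mulmxA; congr (_ *m _); rewrite -mulmxA; congr (_ *m _).
have -> : adjmx (diag_mx (\row_i (Num.sqrt (d 0 i))%:C)) = diag_mx (\row_i (Num.sqrt (d 0 i))%:C).
  apply/matrixP => i j; rewrite adjmxE !mxE eq_sym.
  by case: eqP => [->|_]; rewrite ?mulr1n ?mulr0n ?conjc0// conjc_real.
rewrite mulmx_diag; congr diag_mx; apply/rowP => i; rewrite !mxE.
by rewrite -rmorphM/= -expr2 sqr_sqrtr.
Qed.
End UnitaryExtension.

Section ToeplitzRepresentation.
Variables (R : realType) (p' : nat).
Local Notation p := p'.+1.
Local Notation C := R[i].
Local Notation "x %:C" := (real_complex R x) : ring_scope.

Lemma Re_half_sum (z : C) : (complex.Re z)%:C = 2^-1 * (z + conjc z).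
Proof.
have -> : z + conjc z = 2 * (complex.Re z)%:C.
  by case: z => x y; apply/eqP; rewrite mulr_natl mulr2n eq_complex/= subrr addr0 !eqxx.
by rewrite mulrA mulVf ?mul1r// pnatr_eq0.
Qed.

Lemma expr_unimodular (d : C) j : d * conjc d = 1 -> d ^+ j * conjc d ^+ j = 1.
Proof. by move=> dd; rewrite -exprMn dd expr1n. Qed.

(* If T = G G^*, then G and its block-shifted rows have the same Gram matrix, so
   the block rows of G satisfy g_(i+1) = g_i W for a unitary W, and
   C_j = g_j g_0^* is read off the eigenvalues of W. *)
Lemma toep_psd_atoms (c : nat -> 'M[C]_p) n : hermitian_seq c ->
  herm_psd (toepmx c (n.+1 * p)) ->
  exists N (w : 'I_N -> 'M[C]_p) (d : 'I_N -> C),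
   [/\ forall l, herm_psd (w l), forall l, d l * conjc (d l) = 1 &
    forall j, (j <= n)%N -> c j = \sum_l (complex.Re (d l ^+ j))%:C *: w l].
Proof.
move=> [c0 hc] /psd_factor[G TG].
pose g i : 'M[C]_(p, n.+1 * p) := \matrix_(a, l) G (@inord (p' + n * p) (i * p + a)) l.
have lt_ind i (a : 'I_p) : (i <= n)%N -> (i * p + a < n.+1 * p)%N.
  by move=> le_in; have := leq_mul2r p i n; have := ltn_ord a; nia.
have gg i j : (i <= n)%N -> (j <= n)%N -> g i *m adjmx (g j) = c (natdist i j).
  move=> le_in le_jn; apply/matrixP => a b.
  have := congr1 (fun M : 'M[C]_(n.+1 * p) => M (inord (i * p + a)) (inord (j * p + b))) TG.
  rewrite /toepmx mxE !inordK; [|exact: lt_ind|exact: lt_ind].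
  rewrite /toep !divnMDl// !(divn_small (ltn_ord _))// !addn0 !modnMDl !(modn_small (ltn_ord _)).
  rewrite !inord_val => ->; rewrite !mxE; apply: eq_bigr => l _; rewrite !mxE.
  by [].
pose A : 'M[C]_(n * p, n.+1 * p) := \matrix_(i, l) G (@inord (p' + n * p) i) l.
pose B : 'M[C]_(n * p, n.+1 * p) := \matrix_(i, l) G (@inord (p' + n * p) (p + i)) l.
have AB : A *m adjmx A = B *m adjmx B.
  apply/matrixP => i j.
  have lt1 (i' : 'I_(n * p)) : (i' < (p' + n * p).+1)%N by have := ltn_ord i'; lia.
  have lt2 (i' : 'I_(n * p)) : (p + i' < (p' + n * p).+1)%N by have := ltn_ord i'; lia.
  have E1 := congr1 (fun M : 'M[C]_(n.+1 * p) => M (@inord (p' + n * p) i) (@inord (p' + n * p) j)) TG.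
  have E2 := congr1 (fun M : 'M[C]_(n.+1 * p) => M (@inord (p' + n * p) (p + i)) (@inord (p' + n * p) (p + j))) TG.
  rewrite /= [LHS]mxE !inordK// in E1; rewrite /= [LHS]mxE !inordK// toep_shift in E2.
  rewrite E1 !mxE in E2; rewrite !mxE; move: E2.
  under eq_bigr do rewrite !mxE; under [in X in _ = X -> _]eq_bigr do rewrite !mxE.
  by move=> E2; under eq_bigr do rewrite !mxE; under [RHS]eq_bigr do rewrite !mxE.
have [W W1 AW] := unitary_extension AB.
have W2 := mulmx1C W1.
have gS i : (i < n)%N -> g i.+1 = g i *m W.
  move=> lt_in; apply/matrixP => a l; have -> : g i.+1 a l = G (@inord (p' + n * p) (p + (i * p + a))) l.
    by rewrite mxE; congr (G (inord _) l); rewrite mulSn addnA.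
  have lt_ia : (i * p + a < n * p)%N by have := ltn_ord a; nia.
  have := congr1 (fun M : 'M[C]_(n * p, n.+1 * p) => M (Ordinal lt_ia) l) AW.
  rewrite [RHS]mxE/= => <-; rewrite !mxE; apply: eq_bigr => l' _; rewrite !mxE.
  by [].
have [V [d [V1 V2 WE dd]]] := unitary_spectral W1.
have gE i : (i <= n)%N -> g i = g 0%N *m adjmx V *m diag_mx (\row_l d 0 l ^+ i) *m V.
  elim: i => [_|i IH lt_in].
    have -> : diag_mx (\row_l d 0 l ^+ 0) = 1%:M.
      by rewrite -diag_const_mx; congr diag_mx; apply/rowP => l; rewrite !mxE.
    by rewrite mulmx1 -mulmxA V1 mulmx1.
  rewrite gS// IH; last exact: ltnW.
  rewrite {1}WE !mulmxA -[_ *m V *m adjmx V]mulmxA V2 mulmx1 -[_ *m diag_mx _ *m diag_mx _]mulmxA.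
  rewrite mulmx_diag; do 2!congr (_ *m _); congr diag_mx; apply/rowP => l; rewrite !mxE.
  by rewrite exprSr.
pose u l := col l (g 0%N *m adjmx V).
have cE j : (j <= n)%N -> c j = \sum_l (d 0 l ^+ j) *: (u l *m adjmx (u l)).
  move=> le_jn; have := gg j 0%N le_jn isT; rewrite /natdist subn0 sub0n addn0 => <-.
  rewrite gE// -!mulmxA -[V *m _]adjmxK adjmxM adjmxK; set Q := g 0%N *m adjmx V.
  rewrite mulmxA -/Q; apply/matrixP => a b.
  rewrite summxE mxE; apply: eq_bigr => l _.
  by rewrite mul_diag_mx !mxE big_ord1 !mxE mulrCA.
exists _, (fun l => u l *m adjmx (u l)), (fun l => d 0 l); split=> //.
  by move=> l; have := @psd_congr R _ _ (u l) 1%:M; rewrite mulmx1; apply; exact/pd_psd/pd1.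
move=> j le_jn.
(* As C_j is hermitian, d^j may be replaced by its conjugate; averaging the two expressions leaves
   Re d^j. *)
have E : c j = \sum_l conjc (d 0 l ^+ j) *: (u l *m adjmx (u l)).
  rewrite -hc cE// adjmx_sum; apply: eq_bigr => l _.
  by rewrite adjmxZ adjmxM adjmxK.
have half : 2^-1 + 2^-1 = 1 :> C by rewrite [RHS](splitr 1) mul1r.
rewrite -[LHS]scale1r -half scalerDl {1}E {1}cE// -scalerDr -big_split/= scaler_sumr.
apply: eq_bigr => l _; rewrite -scalerDl scalerA; congr (_ *: _).
by rewrite Re_half_sum addrC.
Qed.
End ToeplitzRepresentation.

(** * Powers of (1 + cos)/2 and the matrix A *)

Section ChebyshevMoments.
Variable R : realType.
Local Notation C := R[i].
Local Notation "x %:C" := (real_complex R x) : ring_scope.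

Lemma central_sum (V : nmodType) (K : nat) (f : nat -> V) :
  \sum_(l < (2 * K).+1) f l = f K + \sum_(j < K) (f (K - j.+1)%N + f (K + j.+1)%N).
Proof.
have -> : ((2 * K).+1 = K + (1 + K))%N by lia.
rewrite big_split_ord big_split_ord /= big_ord1 addn0 [LHS]addrCA; congr (_ + _).
rewrite big_split/=; congr (_ + _).
  by rewrite (reindex_inj rev_ord_inj); apply: eq_bigr.
Qed.

(** For x = (1 + Re d) / 2 and |d| = 1 one has 4 x d = (1 + d)^2, hence (4x)^K = (1 + d)^(2K)
    conj(d)^K. In the binomial expansion, terms symmetric about the middle one are conjugate and
    combine to real parts. *)
Lemma power_cos (d : C) K : d * conjc d = 1 ->
  (2^+(2 * K) * ((1 + complex.Re d) / 2) ^+ K)%:C =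
  ('C(2 * K, K)%:R + \sum_(j < K) 'C(2 * K, K - j.+1)%:R * (2 * complex.Re (d ^+ j.+1)))%:C.
Proof.
move=> dd; set x := (1 + complex.Re d) / 2.
have xE : 4 * x%:C * d = (1 + d) ^+ 2.
  have -> : 4 * x%:C = 2 + d + conjc d.
    have -> : x%:C = (1 + (complex.Re d)%:C) / 2.
      by rewrite /x rmorphM/= fmorphV/= rmorphD/= rmorph1 rmorph_nat.
    by rewrite Re_half_sum; field.
  rewrite !mulrDl [conjc d * d]mulrC dd; ring.
have -> : (2 ^+ (2 * K) * x ^+ K)%:C = (1 + d) ^+ (2 * K) * conjc d ^+ K.
  have -> : (1 + d) ^+ (2 * K) * conjc d ^+ K = (4 * x%:C) ^+ K.
    by rewrite exprM -xE -exprMn -[_ * d * _]mulrA dd mulr1.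
  rewrite exprM -exprMn rmorphXn/= rmorphM/=.
  by congr ((_ * _) ^+ _); rewrite -natrX rmorph_nat.
rewrite exprDn mulr_suml.
under eq_bigr do rewrite expr1n mul1r mulrnAl.
rewrite (central_sum K (fun l => d ^+ l * conjc d ^+ K *+ 'C(2 * K, l))) expr_unimodular//.
rewrite rmorphD/= rmorph_nat rmorph_sum/=; congr (_ + _); apply: eq_bigr => j _.
have jK : (j < K)%N by [].
have binE : 'C(2 * K, K + j.+1) = 'C(2 * K, K - j.+1).
  by rewrite -bin_sub; [congr 'C(_, _); lia|lia].
have E1 : d ^+ (K - j.+1) * conjc d ^+ K = conjc (d ^+ j.+1).
  have -> : conjc d ^+ K = conjc d ^+ (K - j.+1) * conjc d ^+ j.+1 by rewrite -exprD subnK.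
  by rewrite mulrA expr_unimodular// mul1r rmorphXn.
have E2 : d ^+ (K + j.+1) * conjc d ^+ K = d ^+ j.+1.
  by rewrite exprD mulrAC expr_unimodular// mul1r.
rewrite binE E1 E2 -mulrnDl rmorphM/= rmorph_nat rmorphM/= rmorph_nat mulr_natl Re_half_sum.
by rewrite mulrA mulfV ?mul1r ?pnatr_eq0// addrC.
Qed.

(** The origin of both constants: after division by 4^(i+1), the central binomial coefficient is the
    arcsine moment and the others form half a row of A. *)
Lemma node_power (d : C) n (i : 'I_n) : d * conjc d = 1 ->
  ((1 + complex.Re d) / 2) ^+ i.+1 =
  s0 R i.+1 + 2^-1 * \sum_(j < n) Amat R n i j * complex.Re (d ^+ j.+1).
Proof.
move=> /(@power_cos _ i.+1)/complexI E.
have p0 : 2 ^+ (2 * i.+1) != 0 :> R by rewrite expf_neq0.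
apply: (mulfI p0); rewrite E mulrDr /s0 mulrA mulfV// mul1r; congr (_ + _).
have -> : \sum_(j < n) Amat R n i j * complex.Re (d ^+ j.+1) =
  \sum_(j < i.+1) 2 ^- (2 * i) * 'C((2 * i).+2, i - j)%:R * complex.Re (d ^+ j.+1).
  rewrite (big_ord_widen _ (fun j => 2 ^- (2 * i) * 'C((2 * i).+2, i - j)%:R * complex.Re (d ^+ j.+1)) (ltn_ord i)).
  rewrite [RHS]big_mkcond/=; apply: eq_bigr => j _; rewrite mxE ltnS.
  by case: ifP => // _; rewrite mul0r.
rewrite !mulr_sumr; apply: eq_bigr => j _; rewrite subSS.
have -> : (2 * i.+1 = (2 * i).+2)%N by lia.
rewrite !exprS; field.
by rewrite expf_neq0.
Qed.
End ChebyshevMoments.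

Section AtomicMeasures.
Variable R : realType.
Local Notation C := R[i].
Local Notation "x %:C" := (real_complex R x) : ring_scope.
Local Notation J01 := (@I01 R).

Lemma cvg_sumr I (r : seq I) (u : nat -> I -> R) (v : I -> R) :
  (forall i, u^~ i @ \oo --> v i) -> (fun m => \sum_(i <- r) u m i) @ \oo --> \sum_(i <- r) v i.
Proof.
move=> uv; elim: r => [|i r IH].
  by rewrite big_nil; under eq_fun do rewrite big_nil; exact: cvg_cst.
by rewrite big_cons; under eq_fun do rewrite big_cons; apply: cvgD.
Qed.

Lemma sigma_additive_atoms N (x c : 'I_N -> R) :
  real_sigma_additive (fun B => \sum_l \1_B (x l) * c l).
Proof.
move=> F mF tF; under eq_fun do rewrite exchange_big/=.
apply: cvg_sumr => l; under eq_fun do rewrite -mulr_suml.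
apply: cvgMl; have [[i _ Fi]|nF] := pselect ((\bigcup_i F i) (x l)); last first.
  rewrite indicE memNset//.
  apply: cvg_near_cst; near=> n; apply: big1 => i _.
  by rewrite indicE memNset// => Fi; apply: nF; exists i.
rewrite indicE mem_set; last by exists i.
apply: cvg_near_cst; near=> n.
have lt_in : (i < n)%N by near: n; exact: nbhs_infty_gt.
rewrite (bigD1 (Ordinal lt_in))//= indicE mem_set// big1 ?addr0// => j ji.
rewrite indicE memNset// => Fj; move/eqP: ji; apply; apply/val_inj => /=.
by apply: tF => //; exists (x l).
Unshelve. all: by end_near.
Qed.

Lemma signed_int01_atoms N (x c : 'I_N -> R) (f : R -> R) : (forall l, J01 (x l)) ->
  continuous f -> (forall t, J01 t -> 0 <= f t <= 1) ->
  signed_int01 (fun B => \sum_l \1_B (x l) * c l) f = \sum_l f (x l) * c l.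
Proof.
move=> x01 cf f01.
have H := signed_int01_cvg (@sigma_additive_atoms N x c) cf f01.
apply: (cvg_unique (@norm_hausdorff _ R^o) H).
rewrite (_ : cell_sum _ f = fun m => \sum_l f (node R m (cell_index m (x l))) * c l).
  apply: cvg_sumr => l; apply: cvgMl.
  by apply: (@cvg_comp _ _ _ (fun m => node R m (cell_index m (x l))) f); [exact: node_cvg|exact: cf].
apply/funext => m; rewrite /cell_sum; under eq_bigr do rewrite mulr_sumr.
rewrite exchange_big/=; apply: eq_bigr => l _.
rewrite -(sum_indic_cell (fun i => f (node R m i)) m (x01 l)) mulr_suml.
by apply: eq_bigr => i _; rewrite mulrA.
Qed.

Lemma power_I01 j (t : R) : J01 t -> 0 <= t ^+ j <= 1.
Proof. by move=> /andP[t0 t1]; rewrite exprn_ge0// exprn_ile1. Qed.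

Lemma power_continuous j : continuous (fun t : R => t ^+ j).
Proof. exact: exprn_continuous. Qed.
End AtomicMeasures.

Section Amat.
Variables (R : realType) (n : nat).
Local Notation A := (Amat R n).

Lemma Amat_unit : A \in unitmx.
Proof.
rewrite unitmxE det_trig; last first.
  by apply/is_trig_mxP => i j ij; rewrite mxE leqNgt ij.
rewrite unitfE; apply/prodf_neq0 => i _.
by rewrite mxE leqnn subnn bin0 mulr1 invr_neq0// expf_neq0.
Qed.

Lemma Amat_inv (v : 'I_n -> R) j :
  \sum_i invmx A j i * (\sum_l A i l * v l) = v j.
Proof.
have := congr1 (fun M : 'cV_n => M j 0) (mulKmx Amat_unit (\col_l v l)).
rewrite [X in X = _]mxE [X in _ = X]mxE => <-; apply: eq_bigr => i _; congr (_ * _).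
by rewrite [RHS]mxE; apply: eq_bigr => l _; congr (_ * _); rewrite mxE.
Qed.

(** Invertibility of A transfers convergence from power sums to cosine sums. *)
Lemma Amat_cvg (v : nat -> 'I_n -> R) (v0 : 'I_n -> R) :
  (forall i, (fun m => \sum_l A i l * v m l) @ \oo --> \sum_l A i l * v0 l) ->
  forall j, v^~ j @ \oo --> v0 j.
Proof.
move=> cv j; rewrite -(Amat_inv v0 j).
under eq_fun do rewrite -[v _ j]Amat_inv.
by apply: cvg_sumr => i; apply: cvgMr; exact: cv.
Qed.
End Amat.

Section CosineSums.
Variables (R : realType) (n : nat).
Local Notation C := R[i].
Local Notation J01 := (@I01 R).

(** The point of the upper unit semicircle lying over [t] under d -> (1 + Re d) / 2. *)
Definition circle_point (t : R) : C := ((2 * t - 1)%R +i* Num.sqrt (1 - (2 * t - 1) ^+ 2))%C.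

Lemma circle_point_unimodular t : J01 t -> circle_point t * conjc (circle_point t) = 1.
Proof.
move=> /andP[t0 t1]; have h : 0 <= 1 - (2 * t - 1) ^+ 2 by nra.
rewrite /circle_point; apply/eqP; rewrite eq_complex/=; apply/andP; split; apply/eqP.
  by rewrite mulrN opprK -!expr2 sqr_sqrtr//; ring.
by ring.
Qed.

Lemma circle_pointE t : (1 + complex.Re (circle_point t)) / 2 = t.
Proof. by rewrite /circle_point/=; field. Qed.

Lemma I01_circle (d : C) : d * conjc d = 1 -> J01 ((1 + complex.Re d) / 2).
Proof.
case: d => x y /= /eqP; rewrite eq_complex/= => /andP[/eqP h _]; rewrite /I01/=.
have h1 : x ^+ 2 + y ^+ 2 = 1 by rewrite -h; ring.
by apply/andP; split; nra.
Qed.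

(** Cell sums of powers converge to the moments; at each node, powers are s0 plus half of A applied
    to cosines. Inverting A shows that the cosine sums converge to the Chebyshev coordinates [g]. *)
Lemma cos_sum_cvg rho (g : 'I_n -> R) : real_sigma_additive rho ->
  (forall i : 'I_n, signed_int01 rho (fun t => t ^+ i.+1) =
     s0 R i.+1 * rho J01 + 2^-1 * \sum_j Amat R n i j * g j) ->
  forall j : 'I_n, (fun m => \sum_(i < m.+2)
     complex.Re (circle_point (node R m i) ^+ j.+1) * rho (cell m i)) @ \oo --> g j.
Proof.
move=> srho rhoE.
apply: (@Amat_cvg R n (fun m j => \sum_(i < m.+2)
     complex.Re (circle_point (node R m i) ^+ j.+1) * rho (cell m i))) => i.
have H := signed_int01_cvg srho (@power_continuous R i.+1) (@power_I01 R i.+1).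
rewrite rhoE in H.
have -> : \sum_l Amat R n i l * g l =
  2 * ((s0 R i.+1 * rho J01 + 2^-1 * \sum_j Amat R n i j * g j) - s0 R i.+1 * rho J01).
  by rewrite addrAC subrr add0r mulrA mulfV ?mul1r.
rewrite (_ : (fun m => _) = fun m => 2 * (cell_sum rho (fun t => t ^+ i.+1) m - s0 R i.+1 * rho J01)).
  by apply: cvgMr; apply: cvgB => //; exact: cvg_cst.
apply/funext => m; rewrite /cell_sum.
rewrite -(sum_cell m srho) mulr_sumr -sumrB mulr_sumr.
under eq_bigr do rewrite mulr_sumr.
rewrite exchange_big/=; apply: eq_bigr => l _.
have n01 : J01 (node R m l) by exact: node_in.
have := node_power i (circle_point_unimodular n01); rewrite circle_pointE => ->.
rewrite -mulrBl addrAC subrr add0r mulrA mulrA mulfV// mul1r mulr_suml.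
by apply: eq_bigr => j _; rewrite mulrA.
Qed.
End CosineSums.

Section ComplexLimits.
Variable R : realType.
Local Notation C := R[i].

Definition ccvg (u : nat -> C) (l : C) :=
  (fun m => complex.Re (u m)) @ \oo --> complex.Re l /\
  (fun m => complex.Im (u m)) @ \oo --> complex.Im l.

Lemma ccvg_cst z : ccvg (fun=> z) z.
Proof. by split; exact: cvg_cst. Qed.

Lemma ccvgD u v a b : ccvg u a -> ccvg v b -> ccvg (fun m => u m + v m) (a + b).
Proof.
move=> [u1 u2] [v1 v2]; split.
  have -> : complex.Re (a + b) = complex.Re a + complex.Re b by case: a b {u1 u2 v1 v2} => ? ? [].
  rewrite (_ : (fun m => _) = (fun m => complex.Re (u m) + complex.Re (v m))); first exact: cvgD.
  by apply/funext => m; case: (u m) (v m) => ? ? [].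
have -> : complex.Im (a + b) = complex.Im a + complex.Im b by case: a b {u1 u2 v1 v2} => ? ? [].
rewrite (_ : (fun m => _) = (fun m => complex.Im (u m) + complex.Im (v m))); first exact: cvgD.
by apply/funext => m; case: (u m) (v m) => ? ? [].
Qed.

Lemma ccvgM u v a b : ccvg u a -> ccvg v b -> ccvg (fun m => u m * v m) (a * b).
Proof.
move=> [u1 u2] [v1 v2]; split.
  have -> : complex.Re (a * b) = complex.Re a * complex.Re b - complex.Im a * complex.Im b.
    by case: a b {u1 u2 v1 v2} => ? ? [].
  rewrite (_ : (fun m => _) = (fun m => complex.Re (u m) * complex.Re (v m)
      - complex.Im (u m) * complex.Im (v m))); first by apply: cvgB; exact: cvgM.
  by apply/funext => m; case: (u m) (v m) => ? ? [].
have -> : complex.Im (a * b) = complex.Re a * complex.Im b + complex.Im a * complex.Re b.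
  by case: a b {u1 u2 v1 v2} => ? ? [].
rewrite (_ : (fun m => _) = (fun m => complex.Re (u m) * complex.Im (v m)
    + complex.Im (u m) * complex.Re (v m))); first by apply: cvgD; exact: cvgM.
by apply/funext => m; case: (u m) (v m) => ? ? [].
Qed.

Lemma ccvg_sum I (r : seq I) (u : nat -> I -> C) (v : I -> C) :
  (forall i, ccvg (u^~ i) (v i)) -> ccvg (fun m => \sum_(i <- r) u m i) (\sum_(i <- r) v i).
Proof.
move=> uv; elim: r => [|i r IH].
  rewrite big_nil (_ : (fun m => _) = fun=> 0); first exact: ccvg_cst.
  by apply/funext => m; rewrite big_nil.
rewrite big_cons (_ : (fun m => _) = fun m => u m i + \sum_(j <- r) u m j); first exact: ccvgD.
by apply/funext => m; rewrite big_cons.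
Qed.

Lemma psd_limit n (T : nat -> 'M[C]_n) (L : 'M[C]_n) : adjmx L = L ->
  (forall m, herm_psd (T m)) -> (forall i j, ccvg (fun m => T m i j) (L i j)) -> herm_psd L.
Proof.
move=> hL psdT TL; split=> // v.
have [q1 q2] : ccvg (fun m => qf (T m) v) (qf L v).
  rewrite /qf mxE (_ : (fun m => _) = fun m => \sum_j (\sum_k adjmx v 0 k * T m k j) * v j 0).
    apply: ccvg_sum => j; apply: ccvgM; last exact: ccvg_cst.
    rewrite mxE; apply: ccvg_sum => k; apply: ccvgM; [exact: ccvg_cst|exact: TL].
  apply/funext => m; rewrite mxE; apply: eq_bigr => j _; congr (_ * _); by rewrite mxE.
have q0 m : 0 <= complex.Re (qf (T m) v) /\ complex.Im (qf (T m) v) = 0.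
  by have := (psdT m).2 v; rewrite -/(qf _ _) lecE/= => /andP[/eqP -> ->].
rewrite -/(qf _ _) lecE/=; apply/andP; split.
  have E : (fun m => complex.Im (qf (T m) v)) = fun=> 0 by apply/funext => m; exact: (q0 m).2.
  rewrite E in q2; apply/eqP; apply: (cvg_unique (@norm_hausdorff _ R^o) q2); exact: cvg_cst.
have E := cvg_lim (@norm_hausdorff _ R^o) q1; rewrite -E.
by apply: limr_ge; [exact: cvgP q1|apply: nearW => m; exact: (q0 m).1].
Qed.
End ComplexLimits.

Section MomentSpace.
Variables (R : realType) (p' n : nat).
Local Notation p := p'.+1.
Local Notation C := R[i].
Local Notation idx := ('I_p * 'I_p)%type.
Local Notation "x %:C" := (real_complex R x) : ring_scope.
Local Notation J01 := (@I01 R).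

(** For |d| = 1, Re d^|a-b| is the mean of d^a conj(d)^b and its conjugate. Each atom thus
    contributes half the sum of two congruences B w B^*, with B the block column of powers of d or
    of its conjugate. *)
Lemma toep_psd_of_atoms N (w : 'I_N -> 'M[C]_p) (d : 'I_N -> C) M :
  (forall l, herm_psd (w l)) -> (forall l, d l * conjc (d l) = 1) ->
  herm_psd (toepmx (fun j => \sum_l (complex.Re (d l ^+ j))%:C *: w l) M).
Proof.
move=> pw dd.
pose B (z : C) : 'M[C]_(M, p) := \matrix_(i, a) (z ^+ (i %/ p) * (inord (i %% p) == a)%:R).
have -> : toepmx (fun j => \sum_l (complex.Re (d l ^+ j))%:C *: w l) M =
  \sum_l (2^-1)%:C *: (B (d l) *m w l *m adjmx (B (d l)) +
     B (conjc (d l)) *m w l *m adjmx (B (conjc (d l)))).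
  apply/matrixP => i j; rewrite mxE /toep !summxE; apply: eq_bigr => l _.
  have BE z : (B z *m w l *m adjmx (B z)) i j =
     z ^+ (i %/ p) * conjc z ^+ (j %/ p) * w l (inord (i %% p)) (inord (j %% p)).
    rewrite mxE (bigD1 (inord (j %% p)))//= big1 ?addr0; last first.
      by move=> b bj; rewrite !mxE eq_sym (negbTE bj) mulr0 conjc0 mulr0.
    rewrite mxE (bigD1 (inord (i %% p)))//= big1 ?addr0; last first.
      by move=> b bj; rewrite !mxE eq_sym (negbTE bj) mulr0 mul0r.
    rewrite !mxE !eqxx !mulr1 rmorphXn/=; ring.
  rewrite [LHS]mxE [RHS]mxE [X in _ = _ * X]mxE !BE conjcK -mulrDl mulrA; congr (_ * _).
  rewrite Re_half_sum fmorphV/= rmorph_nat; congr (_ * _).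
  have dpow a b : d l ^+ a * conjc (d l) ^+ b + conjc (d l) ^+ a * d l ^+ b =
      d l ^+ natdist a b + conjc (d l ^+ natdist a b).
    wlog ab : a b / (b <= a)%N.
      move=> H; case: (leqP b a) => ab; first exact: H.
      by rewrite /natdist addnC -/(natdist b a) -H ?(ltnW ab)// addrC; congr (_ + _); rewrite mulrC.
    have -> : natdist a b = (a - b)%N by rewrite /natdist; move: ab; lia.
    have da : d l ^+ a = d l ^+ (a - b) * d l ^+ b by rewrite -exprD subnK.
    have ca : conjc (d l) ^+ a = conjc (d l) ^+ (a - b) * conjc (d l) ^+ b by rewrite -exprD subnK.
    rewrite da ca rmorphXn/= -!mulrA expr_unimodular// [_ ^+ b * d l ^+ b]mulrC expr_unimodular//.
    by rewrite !mulr1.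
  by rewrite dpow.
apply: psd_sum => l _; apply: psdZ; first by rewrite invr_ge0.
by apply: psdD; exact: psd_congr.
Qed.

(* S_{j+1} = s0_{j+1} I + (1/2) sum_i A_{j,i} C_{i+1}, where C_{i+1} has coordinates z(i, .). *)
Definition moment_coords (z : nat * idx -> R) : 'I_n * idx -> R :=
  fun jab => s0 R jab.1.+1 * (jab.2.1 == jab.2.2)%:R +
             2^-1 * \sum_i Amat R n jab.1 i * z (val i, jab.2).

Lemma hmx_sum I (r : seq I) (F : I -> idx -> R) :
  hmx (fun ab => \sum_(i <- r) F i ab) = \sum_(i <- r) hmx (F i).
Proof.
elim: r => [|i r IH].
  rewrite big_nil; under eq_fun do rewrite big_nil.
  have -> : (fun=> 0 : R) = (fun ab : idx => 0 * (0 : R)) by apply/funext => ab; rewrite mul0r.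
  by rewrite (hmxZ 0 (fun=> 0)) scale0r.
rewrite big_cons -IH -hmxD; congr hmx.
by apply/funext => ab; rewrite big_cons.
Qed.

Lemma hmx1 : hmx (fun ab : idx => (ab.1 == ab.2)%:R : R) = 1%:M.
Proof.
apply/matrixP => a b; rewrite !mxE /= eqxx; case: (eqVneq a b) => [_|ab] /=; first by [].
by rewrite oppr0; case: ifP.
Qed.

Lemma hmx_moment_coords z (j : 'I_n) : hmx (fun ab => moment_coords z (j, ab)) =
  (s0 R j.+1)%:C%:M + (2^-1)%:C *: \sum_i (Amat R n j i)%:C *: cseq z i.+1.
Proof.
rewrite /moment_coords/= hmxD hmxZ hmx1 scalemx1; congr (_ + _).
rewrite hmxZ hmx_sum; congr (_ *: _); apply: eq_bigr => i _.
by rewrite hmxZ.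
Qed.

(** The atoms on the circle are projected to [0,1] by d -> (1 + Re d) / 2. The total mass is the
    identity because the atomic formula at j = 0 gives C_0. *)
Lemma moment_space_of_psd z : herm_psd (Tz z n.+1) -> moment_space (moment_coords z).
Proof.
move=> /(toep_psd_atoms (cseq_herm z))[N [w [d [pw dd cE]]]].
pose x l := (1 + complex.Re (d l)) / 2.
have x01 l : J01 (x l) by exact: I01_circle.
pose mu (B : set R) := \sum_l (\1_B (x l))%:C *: w l.
have muRe B a b : complex.Re (mu B a b) = \sum_l \1_B (x l) * complex.Re (w l a b).
  rewrite /mu summxE raddf_sum/=; apply: eq_bigr => l _; rewrite mxE.
  by case: (w l a b) => ? ?; rewrite /= mul0r subr0.
have muIm B a b : complex.Im (mu B a b) = \sum_l \1_B (x l) * complex.Im (w l a b).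
  rewrite /mu summxE raddf_sum/=; apply: eq_bigr => l _; rewrite mxE.
  by case: (w l a b) => ? ?; rewrite /= mul0r addr0.
exists mu; split.
  split.
  - move=> a b; split.
    + by under eq_fun do rewrite muRe; exact: sigma_additive_atoms.
    + by under eq_fun do rewrite muIm; exact: sigma_additive_atoms.
    + move=> B _; rewrite /mu; congr (fun_of_matrix _ a b); apply: eq_bigr => l _.
      by rewrite !indicE; congr (((_ : bool)%:R)%:C *: _); rewrite in_setI (mem_set (x01 l)) andbT.
  - by move=> B _; apply: psd_sum => l _; apply: psdZ => //; rewrite indicE.
  - rewrite /mu -[RHS]/(cseq z 0) cE//; apply: eq_bigr => l _.
    by rewrite indicE mem_set.
move=> j; rewrite -/(hmx (fun ab => moment_coords z (j, ab))) hmx_moment_coords.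
have -> : (s0 R j.+1)%:C%:M + (2^-1)%:C *: \sum_i (Amat R n j i)%:C *: cseq z i.+1 =
    \sum_l (x l ^+ j.+1)%:C *: w l.
  have -> : (s0 R j.+1)%:C%:M = \sum_l (s0 R j.+1)%:C *: w l.
    rewrite -scaler_sumr -scalemx1 -[1%:M]/(cseq z 0) cE//; congr (_ *: _).
    by apply: eq_bigr => l _; rewrite expr0 scale1r.
  under [X in _ + _ *: X]eq_bigr => i _ do rewrite cE// scaler_sumr.
  rewrite exchange_big scaler_sumr -big_split/=; apply: eq_bigr => l _.
  under eq_bigr => i _ do rewrite scalerA.
  rewrite -scaler_suml scalerA -scalerDl; congr (_ *: _).
  rewrite [RHS](_ : _ = real_complex R (s0 R j.+1 + 2^-1 * \sum_i Amat R n j i * complex.Re (d l ^+ i.+1))); last by rewrite /x (node_power j (dd l)).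
  rewrite [RHS]rmorphD [X in _ = _ + X]rmorphM; congr (_ + _ * _); rewrite [RHS]rmorph_sum.
  by apply: eq_bigr => i _; rewrite rmorphM.
apply/matrixP => a b; rewrite /moment mxE /complex_int01.
rewrite (funext (fun B => muRe B a b)) (funext (fun B => muIm B a b)).
rewrite !(signed_int01_atoms _ x01 (@power_continuous R j.+1) (@power_I01 R j.+1)).
rewrite summxE; apply/eqP; rewrite eq_complex !raddf_sum/=; apply/andP; split; apply/eqP;
  apply: eq_bigr => l _; rewrite mxE; case: (w l a b) => ? ?; by rewrite /= mul0r ?subr0 ?addr0.
Qed.

(** Placing the mass of each cell at its node gives atomic measures whose Toeplitz matrices are
    nonnegative definite; by [cos_sum_cvg] they converge entrywise to T_(n+1). *)
Lemma psd_of_moment_space z : moment_space (moment_coords z) -> herm_psd (Tz z n.+1).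
Proof.
move=> [mu [[cmu pmu mu1] momE]].
pose d m i := circle_point (node R m i).
have d1 m (i : 'I_m.+2) : d m i * conjc (d m i) = 1 by apply: circle_point_unimodular; exact: node_in.
apply: (@psd_limit R _ (fun m => toepmx (fun j => \sum_(i < m.+2) (complex.Re (d m i ^+ j))%:C *: mu (cell m i)) (n.+1 * p))).
- exact: Tz_herm.
- by move=> m; apply: toep_psd_of_atoms => // i; apply: pmu; exact: measurable_cell.
move=> i j; rewrite /Tz /toepmx mxE /toep.
under eq_fun do rewrite mxE /toep.
set D := natdist _ _; set a := inord _; set b := inord _.
have Dn : (D <= n)%N.
  have h1 : (i %/ p < n.+1)%N by rewrite ltn_divLR.
  have h2 : (j %/ p < n.+1)%N by rewrite ltn_divLR.
  by rewrite /D /natdist; move: (i %/ p)%N (j %/ p)%N h1 h2 => x y; lia.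
have [sRe sIm _] := cmu a b.
have reE m : complex.Re ((\sum_(i < m.+2) (complex.Re (d m i ^+ D))%:C *: mu (cell m i)) a b) =
    \sum_(i < m.+2) complex.Re (d m i ^+ D) * complex.Re (mu (cell m i) a b).
  rewrite summxE raddf_sum/=; apply: eq_bigr => l _; rewrite mxE.
  by case: (mu _ a b) => ? ?; rewrite /= mul0r subr0.
have imE m : complex.Im ((\sum_(i < m.+2) (complex.Re (d m i ^+ D))%:C *: mu (cell m i)) a b) =
    \sum_(i < m.+2) complex.Re (d m i ^+ D) * complex.Im (mu (cell m i) a b).
  rewrite summxE raddf_sum/=; apply: eq_bigr => l _; rewrite mxE.
  by case: (mu _ a b) => ? ?; rewrite /= mul0r addr0.
rewrite /ccvg (funext reE) (funext imE).
have momentE (l : 'I_n) : moment mu l.+1 a b =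
   (s0 R l.+1)%:C * (a == b)%:R + (2^-1)%:C * \sum_i (Amat R n l i)%:C * cseq z i.+1 a b.
  rewrite -momE -/(hmx (fun ab => moment_coords z (l, ab))) hmx_moment_coords mxE mxE mxE summxE.
  rewrite -[_ *+ _]mulr_natr; congr (_ + _ * _); by apply: eq_bigr => i' _; rewrite mxE.
(* At distance 0 the sums are constant, the cells being a partition of [0,1]; the other distances
   are Chebyshev coordinates, handled for real and imaginary parts separately. *)
case: D Dn {reE imE} => [_|D Dn].
  have EE : (cseq z 0) a b = mu (@I01 R) a b by rewrite mu1.
  split; rewrite EE.
    under eq_fun do under eq_bigr do rewrite expr0 mul1r.
    by under eq_fun do rewrite (sum_cell _ sRe); exact: cvg_cst.
  under eq_fun do under eq_bigr do rewrite expr0 mul1r.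
  by under eq_fun do rewrite (sum_cell _ sIm); exact: cvg_cst.
have ReE (t : R) (u : C) : complex.Re (t%:C * u) = t * complex.Re u.
  by case: u => ? ?; rewrite /= mul0r subr0.
have ImE (t : R) (u : C) : complex.Im (t%:C * u) = t * complex.Im u.
  by case: u => ? ?; rewrite /= mul0r addr0.
split.
  have := @cos_sum_cvg R n (fun B => complex.Re (mu B a b)) (fun l => complex.Re (cseq z l.+1 a b)) sRe.
  move=> /(_ _ (Ordinal Dn)); apply=> l.
  have /(congr1 (@complex.Re R)) := momentE l; rewrite mxE/= => ->.
  rewrite raddfD/= ReE ReE raddf_sum/=; congr (_ + _ * _); last by apply: eq_bigr => i' _; rewrite ReE.
  by congr (_ * _); rewrite mu1 mxE.
have := @cos_sum_cvg R n (fun B => complex.Im (mu B a b)) (fun l => complex.Im (cseq z l.+1 a b)) sIm.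
move=> /(_ _ (Ordinal Dn)); apply=> l.
have /(congr1 (@complex.Im R)) := momentE l; rewrite mxE/= => ->.
rewrite raddfD/= ImE ImE raddf_sum/=; congr (_ + _ * _); last by apply: eq_bigr => i' _; rewrite ImE.
by congr (_ * _); rewrite mu1 mxE.
Qed.
End MomentSpace.

(** * Integration over the moment space *)

Section ChangeOfVariables.
Variables (R : realType) (p' n : nat).
Local Notation p := p'.+1.
Local Notation idx := ('I_p * 'I_p)%type.
Local Notation In := ('I_n * idx)%type.

Definition restrict_coords (y : nat * idx -> R) : In -> R := fun j => y (val j.1, j.2).

Definition extend_coords (z : In -> R) : nat * idx -> R :=
  fun j => if insub j.1 is Some l then z (l, j.2) else 0.

Lemma extend_coordsK z : restrict_coords (extend_coords z) = z.
Proof. by apply/funext => -[j ab]; rewrite /restrict_coords /extend_coords /= valK. Qed.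

Lemma measurable_restrict_coords : measurable_fun setT (restrict_coords : RI R (nat * idx)%type -> RI R In).
Proof. by apply: measurable_into_RI => i; exact: measurable_coord. Qed.

Lemma leb_int_restrict_coords (f : (In -> R) -> \bar R) :
  measurable_fun [set: RI R In] (f : RI R In -> \bar R) -> (forall x, 0 <= f x)%E ->
  leb_int f = iter_leb_int (blocks p' 0 n) (f \o restrict_coords) (fun=> 0).
Proof.
move=> mf f0; pose phi (j : In) : nat * idx := (val j.1, j.2).
have ext_upd (z : In -> R) j t : extend_coords (upd z j t) = upd (extend_coords z) (phi j) t.
  apply/funext => -[l ab]; rewrite /extend_coords /upd /phi /=; case: insubP => [l' _ <-|nl].
    by rewrite -!pair_eqE /= (inj_eq val_inj).
  rewrite -pair_eqE/=; case: eqP => // E; move: nl; rewrite E; by rewrite (ltn_ord j.1).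
have perm : perm_eq (blocks p' 0 n) (map phi (enum {: In})).
  apply: uniq_perm; first exact: blocks_uniq.
    rewrite map_inj_uniq ?enum_uniq// => -[i a] [j b] [] /val_inj -> ->; by [].
  move=> [l ab]; rewrite mem_blocks/= add0n; apply/idP/mapP => [ln|[[j b] _ [-> _]]].
    by exists (Ordinal ln, ab); rewrite ?mem_enum.
  exact: ltn_ord.
have mfr : measurable_fun [set: RI R (nat * idx)%type] (f \o restrict_coords : RI R (nat * idx)%type -> \bar R).
  exact: (measurableT_comp mf measurable_restrict_coords).
rewrite (iter_leb_int_perm _ mfr _ perm); last by move=> y /=; exact: f0.
have -> : (fun=> 0) = extend_coords (fun=> 0) by apply/funext => j; rewrite /extend_coords; case: insub.
rewrite (iter_leb_int_map _ _ _ ext_upd) /leb_int; apply: eq_iter_leb_int => y _ /=.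
by rewrite extend_coordsK.
Qed.

Local Notation A := (Amat R n).

Let diag (i : 'I_n) : R := 2^-1 * 2 ^- (2 * i).
Let diag_gt0 i : 0 < diag i.
Proof. by rewrite mulr_gt0 ?invr_gt0 ?exprn_gt0. Qed.

Let lower (y : In -> R) (j : In) : R :=
  s0 R j.1.+1 * (j.2.1 == j.2.2)%:R + 2^-1 * \sum_(l < n) ((l < j.1)%N%:R * A j.1 l) * y (l, j.2).

(** Interpolates between the diagonal part of the triangular map ([r = 0]) and the whole of it
    ([r = n]), by adding the lower terms one row at a time. *)
Let partial_coords (r : nat) (y : In -> R) : In -> R :=
  fun j => diag j.1 * y j + (if (j.1 < r)%N then lower y j else 0).

Let shear (r : nat) (y : In -> R) : In -> R :=
  fun j => if val j.1 == r then (diag j.1)^-1 * lower y j else 0.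

Let lower_local (y z : In -> R) (j : In) : (forall l : 'I_n, (l < j.1)%N -> y (l, j.2) = z (l, j.2)) -> lower y j = lower z j.
Proof.
move=> yz; congr (_ + _ * _); apply: eq_bigr => l _.
by case: (ltnP l j.1) => [/yz->//|_]; rewrite !mul0r.
Qed.

(** The added term of row [r] only involves blocks before [r], so it can be produced by shifting
    block [r], without affecting the other rows below [r]. *)
Let partial_shear r y : partial_coords r.+1 y = partial_coords r (fun j => y j + shear r y j).
Proof.
apply/funext => -[i ab]; rewrite /partial_coords /= ltnS leq_eqVlt /shear/=.
have [ir|ir] := eqVneq (val i) r.
  by rewrite ir ltnn mulrDr mulrA mulfV ?mul1r ?gt_eqF// addr0.
rewrite addr0 /=; case: ifP => // lt_ir; congr (_ + _); apply: lower_local => l /= li.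
by rewrite ltn_eqF ?addr0// (ltn_trans li).
Qed.

Let measurable_lower (j : In) : measurable_fun [set: RI R In] ((fun y => lower y j) : RI R In -> R).
Proof.
apply: measurable_funD; first exact: measurable_cst.
apply: measurable_funM; first exact: measurable_cst.
apply: measurable_sum => l.
by apply: measurable_funM; [exact: measurable_cst|exact: measurable_coord].
Qed.

Let measurable_partial r : measurable_fun [set: RI R In] (partial_coords r : RI R In -> RI R In).
Proof.
apply: measurable_into_RI => j; apply: measurable_funD.
  by apply: measurable_funM; [exact: measurable_cst|exact: measurable_coord].
by case: (j.1 < r)%N; [exact: measurable_lower|exact: measurable_cst].
Qed.

Let measurable_shear r : measurable_fun [set: RI R In] (shear r : RI R In -> RI R In).
Proof.
apply: measurable_into_RI => j; rewrite /shear; case: (val j.1 == r); last exact: measurable_cst.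
by apply: measurable_funM; [exact: measurable_cst|exact: measurable_lower].
Qed.

Let moment_coordsE : (@moment_coords R p' n) = partial_coords n \o restrict_coords.
Proof.
apply/funext => z; apply/funext => -[i ab].
rewrite /moment_coords /partial_coords/= ltn_ord /lower/= [RHS]addrCA; congr (_ + _).
rewrite (bigD1 i)//= mulrDr; congr (_ + _).
  by rewrite mxE leqnn subnn bin0 mulr1 mulrA.
congr (_ * _); rewrite [LHS]big_mkcond; apply: eq_bigr => l _ /=.
rewrite !mxE; case: (ltngtP l i) => [li|li|/val_inj ->]; rewrite ?mul0r ?mul1r ?eqxx//.
  by have -> : l != i by rewrite -(inj_eq val_inj) neq_ltn li.
by case: ifP; rewrite ?mul0r.
Qed.

Lemma leb_int_moment_coords : exists2 c : R, 0 < c & forall f : (In -> R) -> \bar R,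
  measurable_fun [set: RI R In] (f : RI R In -> \bar R) -> (forall x, 0 <= f x)%E ->
  leb_int f = (c%:E * iter_leb_int (blocks p' 0 n) (f \o @moment_coords R p' n) (fun=> 0%R))%E.
Proof.
pose c0 : R := \prod_(j : In) (diag j.1)^-1.
have c00 : 0 < c0 by apply: prodr_gt0 => j _; rewrite invr_gt0.
exists c0^-1; first by rewrite invr_gt0.
move=> f mf f0.
have mfr r : measurable_fun [set: RI R In] (f \o partial_coords r : RI R In -> \bar R).
  exact: (measurableT_comp mf (measurable_partial r)).
(* The shears preserve the integral, so only the diagonal map contributes a factor. *)
have E r : leb_int (f \o partial_coords r) = (c0%:E * leb_int f)%E.
  elim: r => [|r <-].
    by rewrite -(leb_int_affine (fun=> 0) (fun j : In => diag_gt0 j.1) mf f0).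
  rewrite -[in RHS](@leb_int_shift R In (fun j => val j.1 == r) (shear r) _ (mfr r))//.
  - by congr leb_int; apply/funext => y /=; rewrite partial_shear.
  - by move=> y; exact: f0.
  - by move=> y j; rewrite /shear => /negbTE ->.
  move=> y z yz; apply/funext => j; rewrite /shear; case: eqP => // jr; congr (_ * _).
  by apply: lower_local => l /= lj; apply: yz => /=; rewrite -jr ltn_eqF.
rewrite moment_coordsE -[X in iter_leb_int _ X]/((f \o partial_coords n) \o restrict_coords).
rewrite -leb_int_restrict_coords//; last by move=> y; exact: f0.
by rewrite E muleA -EFinM mulVf ?mul1e// gt_eqF.
Qed.
End ChangeOfVariables.

Section BoxIntegrals.
Variables (R : realType) (J : eqType).
Local Notation box b := (\1_(`[- b, b]%classic) : R -> R).

Lemma measurable_prod_box (s : seq J) (b : R) :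
  measurable_fun [set: RI R J] ((fun z : J -> R => \prod_(j <- s) box b (z j)) : RI R J -> R).
Proof. by apply: measurable_prod => j _; exact: (measurableT_comp (measurable_box _) (measurable_coord j)). Qed.

Lemma iter_box_lty (s r : seq J) (b k : R) (x : J -> R) : uniq s -> suffix r s -> 0 <= b -> 0 <= k ->
  (iter_leb_int r (fun y : J -> R => (k * \prod_(j <- s) box b (y j))%:E) x < +oo)%E.
Proof.
move=> us rs b0 k0.
apply: (iter_leb_int_prod_lty (u := fun=> box b) (v := fun=> 2 * b)) => //.
by move=> j; exact: integral_box.
Qed.

End BoxIntegrals.

(** * Nonnegative definite Toeplitz matrices: boundedness and negligible boundary *)

Section PsdSet.
Variables (R : realType) (p' n : nat).
Local Notation C := R[i].
Local Notation p := p'.+1.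
Local Notation "x %:C" := (real_complex R x) : ring_scope.
Local Notation idx := ('I_p * 'I_p)%type.
Local Notation RN := (RI R (nat * idx)%type).
Local Notation box b := (\1_(`[- b, b]%classic) : R -> R).
Implicit Types (y z : nat * idx -> R).

(** Presents the closed condition as a countable intersection of open ones, whose measurability is
    known. *)
Lemma psd_approx m (T : 'M[C]_m) : adjmx T = T ->
  herm_psd T <-> forall l : nat, pd (T + (l.+1%:R^-1)%:C *: 1%:M).
Proof.
move=> hT; split=> [pT l|pT].
  by rewrite addrC; apply: pdD => //; apply: pdZ; [rewrite invr_gt0|exact: pd1].
apply: (psd_limit hT (fun l => pd_psd (pT l))) => i j.
rewrite -[T i j]addr0 (_ : (fun _ => _) = fun l => T i j + (l.+1%:R^-1)%:C * (i == j)%:R); last first.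
  by apply/funext => l; rewrite !mxE.
apply: ccvgD; first exact: ccvg_cst.
rewrite -(mul0r (i == j)%:R); apply: ccvgM; last exact: ccvg_cst.
by split; [exact: cvg_harmonic|exact: cvg_cst].
Qed.

Lemma measurable_psd d (T : measurableType d) m (M : T -> 'M[C]_m) :
  mxmeasurable M -> (forall x, adjmx (M x) = M x) -> measurable [set x | herm_psd (M x)].
Proof.
move=> mM hM.
rewrite (_ : [set x | _] = \bigcap_l [set x | pd (M x + (l.+1%:R^-1)%:C *: 1%:M)]); last first.
  apply/seteqP; split=> x /=.
    by move=> /(psd_approx (hM x)) H l _; exact: H.
  by move=> H; apply/(psd_approx (hM x)) => l; exact: H.
apply: bigcap_measurable => [|l _]; first by exists 0%N.
apply: measurable_pd => [|x].
  by apply: mxmeasurableD => //; exact: mxmeasurable_cst.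
by rewrite adjmxD hM adjmxZ adjmx1 conjc_real.
Qed.

Definition psd_ind (z : nat * idx -> R) : R := \1_[set z | herm_psd (Tz z n.+1)] z.
Definition pd_ind (z : nat * idx -> R) : R := \1_[set z | pd (Tz z n.+1)] z.

Lemma measurable_psd_ind : measurable_fun [set: RN] (psd_ind : RN -> R).
Proof.
apply: measurable_indic; apply: (@measurable_psd _ RN _ (fun z => Tz z n.+1)).
  exact: mxmeasurable_Tz.
by move=> z; exact: Tz_herm.
Qed.

Lemma measurable_pd_ind : measurable_fun [set: RN] (pd_ind : RN -> R).
Proof. by apply: measurable_indic; exact: measurable_Tz_pd. Qed.

Lemma pd_ind_le z : pd_ind z <= psd_ind z.
Proof.
rewrite /pd_ind /psd_ind !indicE; case: (boolP (z \in [set z | pd (Tz z n.+1)])) => [|_] //.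
by rewrite inE => /pd_psd h; rewrite mem_set.
Qed.

Lemma Tz_block0 z (l : nat) (a b : 'I_p) : (l < n)%N ->
  exists i j, Tz z n.+1 i j = hmx (fun ab => z (l, ab)) a b.
Proof.
move=> ln.
have ia : (a < n.+1 * p)%N by have := ltn_ord a; nia.
have jb : (l.+1 * p + b < n.+1 * p)%N by have := ltn_ord b; nia.
exists (Ordinal ia), (Ordinal jb); rewrite mxE /toep/=.
rewrite divnMDl// modnMDl !(divn_small (ltn_ord _)) !(modn_small (ltn_ord _)) addn0.
by rewrite /natdist sub0n subn0 add0n !inord_val.
Qed.

(** The diagonal of T_(n+1) consists of ones, so its trace is constant, and the trace bounds every
    entry of a nonnegative definite matrix. *)
Lemma psd_coord_le z (l : nat) ab : (l < n)%N -> herm_psd (Tz z n.+1) ->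
  `|z (l, ab)| <= (n.+1 * p)%:R.
Proof.
move=> ln pT; apply: (@hmx_coord_le R p (fun ab => z (l, ab))) => // a b.
have [i [j <-]] := Tz_block0 z a b ln.
apply: le_trans (psd_entry_bound i j pT) _.
by rewrite trace_Tz.
Qed.

Lemma psd_ind_le z :
  psd_ind z <= \prod_(j <- blocks p' 0 n) box ((n.+1 * p)%:R) (z j).
Proof.
rewrite prod_box /psd_ind indicE; case: (boolP (z \in _)) => [|_] //; rewrite inE/= => pT.
rewrite (_ : all _ _ = true)//; apply/allP => -[l ab]; rewrite mem_blocks/= add0n => ln.
exact: psd_coord_le.
Qed.

Lemma psd_ind_lty r x : suffix r (blocks p' 0 n) ->
  (iter_leb_int r (fun z => (psd_ind z)%:E) x < +oo)%E.
Proof.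
move=> rs; apply: le_lt_trans (iter_box_lty (b := (n.+1 * p)%:R) x (blocks_uniq _ _ _) rs _ ler01) => //.
apply: le_iter_leb_int.
- by apply/measurable_EFinP; exact: measurable_psd_ind.
- by apply/measurable_EFinP/measurable_funM; [exact: measurable_cst|exact: measurable_prod_box].
- by move=> z; rewrite lee_fin.
- by move=> z; rewrite lee_fin mul1r psd_ind_le.
Qed.

Lemma Tz_scale z (t : R) : Tz (fun j => t * z j) n.+1 = t%:C *: Tz z n.+1 + (1 - t)%:C *: 1%:M.
Proof.
apply/matrixP => i j; rewrite !mxE /toep.
have [dij|dij] := eqVneq (natdist (i %/ p) (j %/ p)) 0%N.
  have E : (i %/ p)%N = (j %/ p)%N by move: dij; rewrite /natdist; move: (i %/ p)%N (j %/ p)%N => a b; lia.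
  have Em : (inord (i %% p) == inord (j %% p) :> 'I_p) = (i == j).
    apply/eqP/eqP => [/(congr1 val)|->//].
    rewrite /= !inordK ?ltn_pmod// => Em; apply/val_inj => /=.
    by rewrite (divn_eq i p) (divn_eq j p) E Em.
  by rewrite dij /= !mxE Em -mulrDl -rmorphD/= addrC subrK rmorph1 mul1r.
have -> : (i == j) = false by apply/eqP => ij; move: dij; rewrite ij /natdist subnn.
rewrite mulr0 addr0; case: (natdist _ _) dij => // l _ /=.
by rewrite hmxZ mxE.
Qed.

Lemma psd_ind_scale z (t : R) : 0 <= t < 1 -> psd_ind z <= pd_ind (fun j => t * z j).
Proof.
move=> /andP[t0 t1]; rewrite /psd_ind /pd_ind !indicE.
case: (boolP (z \in _)) => [|_] //; rewrite inE/= => pT.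
rewrite mem_set//= Tz_scale addrC; apply: pdD; last exact: psdZ.
by apply: pdZ; [rewrite subr_gt0|exact: pd1].
Qed.

Local Notation s := (blocks p' 0 n).
Local Notation V f := (iter_leb_int s (fun z => (f z)%:E) (fun=> 0)).

Lemma pd_ind_local y z : (forall j, j \in s -> y j = z j) -> pd_ind y = pd_ind z.
Proof.
move=> yz; have E : Tz y n.+1 = Tz z n.+1.
  apply: toepmx_local => -[//|l] ln /=; congr hmx; apply/funext => ab.
  by apply: yz; rewrite mem_blocks.
have pdE x : pd_ind x = `[< pd (Tz x n.+1) >]%:R by [].
by rewrite !pdE E.
Qed.

(* For t < 1, the convex combination of T with weight t and of I with weight
   1 - t is positive definite as soon as T is nonnegative definite. *)
Lemma psd_volume_scale (t : R) : 0 < t < 1 ->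
  (V psd_ind <= ((t ^+ size s)^-1)%:E * V pd_ind)%E.
Proof.
move=> /andP[t0 t1].
have mpd : measurable_fun [set: RN] ((fun z => (pd_ind z)%:E) : RN -> \bar R).
  by apply/measurable_EFinP; exact: measurable_pd_ind.
have pd0 z : (0 <= (pd_ind z)%:E)%E by rewrite lee_fin.
have := @iter_leb_int_affine _ _ s (fun=> t) (fun=> 0) _ (fun=> 0) (blocks_uniq p' 0 n) (fun=> t0) mpd pd0.
have -> : \prod_(j <- s) t^-1 = (t ^+ size s)^-1.
  by rewrite big_const_seq count_predT iter_mulr_1 exprVn.
move=> <-; apply: le_iter_leb_int.
- by apply/measurable_EFinP; exact: measurable_psd_ind.
- exact: (measurableT_comp mpd (measurable_affine_on _ _ _)).
- by move=> z; rewrite lee_fin.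
move=> z; rewrite lee_fin.
rewrite (@pd_ind_local _ (fun j => t * z j)); first by apply: psd_ind_scale; rewrite ltW.
by move=> j js; rewrite /affine_on js addr0.
Qed.

Lemma psd_volume_le : (V psd_ind <= V pd_ind)%E.
Proof.
have psd0 z : (0 <= (psd_ind z)%:E)%E by rewrite lee_fin.
have pd0 z : (0 <= (pd_ind z)%:E)%E by rewrite lee_fin.
have Vfin : (V psd_ind < +oo)%E by apply: psd_ind_lty; exact: suffix_refl.
have vV : (V pd_ind <= V psd_ind)%E.
  apply: le_iter_leb_int => //; try by apply/measurable_EFinP; [exact: measurable_pd_ind|exact: measurable_psd_ind].
  - by apply/measurable_EFinP; exact: measurable_pd_ind.
  - by apply/measurable_EFinP; exact: measurable_psd_ind.
  - by move=> z; rewrite lee_fin pd_ind_le.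
have Vnum : V psd_ind \is a fin_num by rewrite ge0_fin_numE ?iter_leb_int_ge0.
have vnum : V pd_ind \is a fin_num.
  by rewrite ge0_fin_numE ?iter_leb_int_ge0//; apply: le_lt_trans Vfin.
rewrite -(fineK Vnum) -(fineK vnum) lee_fin.
set a := fine _; set b := fine _; set N := size s.
(* [l.+2] instead of [l.+1] keeps [t 0] positive. *)
pose t (l : nat) : R := 1 - l.+2%:R^-1.
have t01 l : 0 < t l < 1.
  rewrite /t subr_gt0 invf_lt1// ltr1n/= ltrBlDr ltrDl invr_gt0//.
have H l : a * t l ^+ N <= b.
  have /andP[tl0 tl1] := t01 l.
  have := psd_volume_scale (t01 l); rewrite -(fineK Vnum) -(fineK vnum) -EFinM lee_fin.
  by rewrite mulrC ler_pdivlMr ?exprn_gt0.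
have Ht : (fun l => a * t l ^+ N) @ \oo --> a * 1 ^+ N.
  apply: cvgMr; apply: (@cvg_comp _ _ _ t (fun x => x ^+ N)); last exact: exprn_continuous.
  have h : (fun l => l.+2%:R^-1) @ \oo --> (0 : R).
    by have := @cvg_harmonic R; rewrite -cvg_shiftS; exact.
  by have := cvgB (cvg_cst (1 : R)) h; rewrite subr0; exact.
rewrite expr1n mulr1 in Ht.
have <- := cvg_lim (@norm_hausdorff _ R^o) Ht.
by apply: limr_le; [exact: cvgP Ht|apply: nearW].
Qed.

(** The difference of the two indicators is nonnegative with integral 0, and a bounded factor does
    not change that. *)
Lemma psd_pd_integral (g : (nat * idx -> R) -> R) (B : R) :
  measurable_fun [set: RN] (g : RN -> R) -> (forall z, 0 <= g z <= B) ->
  V (fun z => psd_ind z * g z) = V (fun z => pd_ind z * g z).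
Proof.
move=> mg gB; have B0 : 0 <= B by have /andP[a b] := gB (fun=> 0); exact: le_trans b.
pose D z := psd_ind z - pd_ind z.
have D0 z : 0 <= D z by rewrite subr_ge0 pd_ind_le.
have mD : measurable_fun [set: RN] (D : RN -> R).
  by apply: measurable_funB; [exact: measurable_psd_ind|exact: measurable_pd_ind].
have VD : V D = 0%E.
  have E : V psd_ind = (V pd_ind + V D)%E.
    rewrite -iter_leb_intD.
    - by congr iter_leb_int; apply/funext => z; rewrite -EFinD /D addrC subrK.
    - by apply/measurable_EFinP; exact: measurable_pd_ind.
    - exact/measurable_EFinP.
    - by move=> z; rewrite lee_fin.
    - by move=> z; rewrite lee_fin.
  have Vfin : (V psd_ind < +oo)%E by apply: psd_ind_lty; exact: suffix_refl.
  have VD0 : (0 <= V D)%E by apply: iter_leb_int_ge0 => z; rewrite lee_fin.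
  have vnum : V pd_ind \is a fin_num.
    rewrite ge0_fin_numE; last by apply: iter_leb_int_ge0 => z; rewrite lee_fin.
    by apply: le_lt_trans Vfin; rewrite E leeDl.
  apply/eqP; rewrite eq_le VD0 andbT.
  by have := psd_volume_le; rewrite E -leeBrDl// subee.
have -> : V (fun z => psd_ind z * g z) =
    (V (fun z => pd_ind z * g z) + V (fun z => D z * g z))%E.
  rewrite -iter_leb_intD.
  - by congr iter_leb_int; apply/funext => z; rewrite -EFinD /D -mulrDl addrC subrK.
  - by apply/measurable_EFinP/measurable_funM => //; exact: measurable_pd_ind.
  - by apply/measurable_EFinP/measurable_funM.
  - by move=> z; have /andP[g0 _] := gB z; rewrite lee_fin mulr_ge0.
  - by move=> z; have /andP[g0 _] := gB z; rewrite lee_fin mulr_ge0.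
suff -> : V (fun z => D z * g z) = 0%E by rewrite adde0.
apply/eqP; rewrite eq_le; apply/andP; split; last first.
  by apply: iter_leb_int_ge0 => z; have /andP[g0 _] := gB z; rewrite lee_fin mulr_ge0.
rewrite -(mule0 B%:E) -VD -iter_leb_intZ//; last exact/measurable_EFinP.
apply: le_iter_leb_int.
- by apply/measurable_EFinP/measurable_funM.
- by apply/measurable_EFinP/measurable_funM; first exact: measurable_cst.
- by move=> z; have /andP[g0 _] := gB z; rewrite lee_fin mulr_ge0.
- by move=> z; have /andP[_ g1] := gB z; rewrite -EFinM lee_fin mulrC ler_wpM2r.
Qed.
End PsdSet.

(** * Measurability of continuous test functions *)

Section ContinuousMeasurable.
Variables (R : realType) (I : finType).

Let grid (l : nat) (x : I -> R) : {ffun I -> int} := [ffun i => Num.floor (x i * l.+1%:R)].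
Let point (l : nat) (v : {ffun I -> int}) : I -> R := fun i => (v i)%:~R / l.+1%:R.

Let grid_dist l x i : `|x i - point l (grid l x) i| <= l.+1%:R^-1.
Proof.
have L0 : 0 < l.+1%:R :> R by [].
have /andP[lo hi] := floor_itv (x i * l.+1%:R).
rewrite /point ffunE ger0_norm ?subr_ge0 ?ler_pdivrMr//.
by rewrite lerBlDr -[X in X + _]mul1r -mulrDl ler_pdivlMr// addrC -intrD1 ltW.
Qed.

Let measurable_grid l v : measurable ([set x | grid l x = v] : set (RI R I)).
Proof.
rewrite (_ : [set x | _] = \bigcap_(i in [set: I])
   ((fun x : RI R I => x i) @^-1` `[(v i)%:~R / l.+1%:R, ((v i + 1)%R%:~R) / l.+1%:R[)).
  apply: fin_bigcap_measurable; first exact: finite_finset.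
  move=> i _; rewrite -[X in measurable X]setTI.
  by apply: measurable_coord => //; exact: measurable_itv.
apply/seteqP; split=> x /=.
  move=> <- i _ /=; rewrite ffunE in_itv/= ler_pdivrMr// ltr_pdivlMr//.
  by rewrite floor_itv.
move=> H; apply/ffunP => i; rewrite ffunE; have := H i Logic.I.
rewrite /= in_itv/= ler_pdivrMr// ltr_pdivlMr// => h.
exact: floor_def.
Qed.

(** Rounding every coordinate down to a grid of mesh 1 / (l + 1) gives functions with countably many
    measurable level cells, which converge pointwise to [h] by continuity. *)
Lemma bounded_continuous_measurable (h : (I -> R) -> R) :
  bounded_continuous h -> measurable_fun [set: RI R I] (h : RI R I -> R).
Proof.
move=> [_ ch]; pose hl (l : nat) : RI R I -> R := fun x => h (point l (grid l x)).
apply: (@measurable_fun_cvg _ (RI R I) R setT hl (h : RI R I -> R)) => //.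
  move=> l _ B mB; rewrite setTI.
  rewrite (_ : _ @^-1` B = \bigcup_v ([set x | grid l x = v] `&` [set _ | B (h (point l v))])).
    apply: countable_bigcupT_measurable => [|v]; first exact: countableP.
    apply: measurableI; first exact: measurable_grid.
    have [Bv|nBv] := pselect (B (h (point l v))).
      by rewrite (_ : [set _ | _] = setT)//; apply/seteqP; split.
    by rewrite (_ : [set _ | _] = set0)//; apply/seteqP; split.
  apply/seteqP; split=> x /=; first by move=> Bx; exists (grid l x).
  by move=> [v _ [<-]].
move=> x _; apply/cvgrPdist_lt => e e0; have [d d0 hd] := ch x e e0.
near=> l; apply: hd => i; apply: le_lt_trans (grid_dist l x i) _.
near: l; have := @cvg_harmonic R => /cvgrPdist_lt/(_ _ d0); apply: filterS => l.
by rewrite sub0r normrN ger0_norm// invr_ge0.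
Unshelve. all: by end_near.
Qed.
End ContinuousMeasurable.

Section MomentSpaceIndicator.
Variables (R : realType) (p' n : nat).
Local Notation p := p'.+1.
Local Notation idx := ('I_p * 'I_p)%type.
Local Notation In := ('I_n * idx)%type.
Local Notation A := (Amat R n).
Local Notation box b := (\1_(`[- b, b]%classic) : R -> R).

(** Recovers the C_j from the moments, by inverting A. It carries measurability and boundedness from
    Toeplitz matrices to the moment space. *)
Definition cheb_coords (x : In -> R) : nat * idx -> R :=
  extend_coords (fun j => \sum_i invmx A j.1 i * (2 * (x (i, j.2) - s0 R i.+1 * (j.2.1 == j.2.2)%:R))).

Lemma cheb_coordsK x : moment_coords (cheb_coords x) = x.
Proof.
apply/funext => -[i ab]; rewrite /moment_coords /cheb_coords/=.
pose v : 'cV[R]_n := \col_l (2 * (x (l, ab) - s0 R l.+1 * (ab.1 == ab.2)%:R)).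
have := congr1 (fun M : 'cV[R]_n => M i 0) (mulKVmx (Amat_unit R n) v).
rewrite [X in X = _]mxE [X in _ = X]mxE => E.
suff -> : \sum_l A i l * extend_coords (fun j : In => \sum_i0 invmx A j.1 i0 *
   (2 * (x (i0, j.2) - s0 R i0.+1 * (j.2.1 == j.2.2)%:R))) (val l, ab) =
   2 * (x (i, ab) - s0 R i.+1 * (ab.1 == ab.2)%:R).
  by rewrite mulrA mulVf// mul1r addrC subrK.
rewrite -E; apply: eq_bigr => l _; congr (_ * _).
rewrite /extend_coords/= valK/= mxE; apply: eq_bigr => l' _; congr (_ * _); by rewrite mxE.
Qed.

Lemma measurable_cheb_coords : measurable_fun [set: RI R In] (cheb_coords : RI R In -> RI R (nat * idx)%type).
Proof.
apply: measurable_into_RI => -[l ab]; rewrite /cheb_coords /extend_coords/=.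
case: insub => [j|]; last exact: measurable_cst.
apply: measurable_sum => i; apply: measurable_funM; first exact: measurable_cst.
apply: measurable_funM; first exact: measurable_cst.
apply: measurable_funB; [exact: measurable_coord|exact: measurable_cst].
Qed.

Local Notation W x := (\1_(@moment_space R p n) x : R).

Lemma moment_space_coords z : W (moment_coords z) = psd_ind n z.
Proof.
rewrite /psd_ind !indicE; congr (nat_of_bool _)%:R.
apply/idP/idP; rewrite !inE.
  exact: psd_of_moment_space.
exact: moment_space_of_psd.
Qed.

Lemma moment_space_indE x : W x = psd_ind n (cheb_coords x).
Proof. by rewrite -moment_space_coords cheb_coordsK. Qed.

Lemma measurable_moment_space : measurable_fun [set: RI R In] ((fun x => W x) : RI R In -> R).
Proof.
rewrite (_ : (fun _ => _) = @psd_ind R p' n \o cheb_coords).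
  exact: (measurableT_comp (@measurable_psd_ind R p' n) measurable_cheb_coords).
by apply/funext => x; rewrite moment_space_indE.
Qed.

Lemma moment_space_box : exists2 b : R, 0 <= b &
  forall x, W x <= \prod_(j <- enum {: In}) box b (x j).
Proof.
pose c (i : 'I_n) : R := s0 R i.+1 + 2^-1 * \sum_l `|A i l| * (n.+1 * p)%:R.
have s00 (i : nat) : 0 <= s0 R i by rewrite mulr_ge0// invr_ge0 exprn_ge0.
have c0 i : 0 <= c i.
  by rewrite addr_ge0// mulr_ge0 ?invr_ge0// sumr_ge0// => l _; rewrite mulr_ge0.
exists (\sum_i c i); first by apply: sumr_ge0 => i _; exact: c0.
move=> x; rewrite prod_box indicE; case: (boolP (x \in _)) => [|_] //.
move=> Wx; have : psd_ind n (cheb_coords x) = 1 by rewrite -moment_space_indE indicE Wx.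
rewrite /psd_ind indicE; case: (boolP (_ \in _)) => [|_ /eqP]; last by rewrite eq_sym oner_eq0.
rewrite inE/= => pT _.
rewrite (_ : all _ _ = true)//; apply/allP => -[i ab] _.
apply: (@le_trans _ _ (c i)); last first.
  by rewrite (bigD1 i)//= lerDl sumr_ge0// => l _; exact: c0.
rewrite -{1}(cheb_coordsK x) /moment_coords/=; apply: le_trans (ler_normD _ _) _; apply: lerD.
  by rewrite ger0_norm ?mulr_ge0//; case: (_ == _); rewrite ?mulr1 ?mulr0.
rewrite normrM (@ger0_norm _ 2^-1) ?invr_ge0// ler_wpM2l ?invr_ge0//.
apply: le_trans (ler_norm_sum _ _ _) _; apply: ler_sum => l _.
by rewrite normrM ler_wpM2l//; apply: psd_coord_le.
Qed.

Lemma moment_space_lty r (x : In -> R) : suffix r (enum {: In}) ->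
  (iter_leb_int r (fun y => (W y)%:E) x < +oo)%E.
Proof.
have [b b0 Wb] := moment_space_box => rs.
apply: le_lt_trans (iter_box_lty x (enum_uniq _) rs b0 ler01).
apply: le_iter_leb_int.
- by apply/measurable_EFinP; exact: measurable_moment_space.
- by apply/measurable_EFinP/measurable_funM; [exact: measurable_cst|exact: measurable_prod_box].
- by move=> z; rewrite lee_fin.
- by move=> z; rewrite lee_fin mul1r.
Qed.
End MomentSpaceIndicator.

(** * The rescaled statistic in Chebyshev coordinates *)

Section Statistic.
Variables (R : realType) (p' k m : nat).
Hypothesis k_gt0 : (0 < k)%N.
Local Notation p := p'.+1.
Local Notation C := R[i].
Local Notation n := (k + m)%N.
Local Notation "x %:C" := (real_complex R x) : ring_scope.
Local Notation idx := ('I_p * 'I_p)%type.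
Local Notation In := ('I_n * idx)%type.
Local Notation Ik := ('I_k * idx)%type.

Definition statistic (x : In -> R) : Ik -> R :=
  vec_coords (@scaled_stat R p k n
    (fun j : 'I_k => herm_of (fun a b => x (widen_ord (leq_addr m k) j, (a, b))))).

(** A is lower triangular and its leading k x k block does not depend on n. Hence applying the
    inverse of that block to the centred moments yields C_j / 2, and sqrt(8np) / 2 = sqrt(2np). *)
Lemma statistic_coords (z : nat * idx -> R) :
  statistic (moment_coords z) = restrict_coords (fun j => scale R p' k m * z j).
Proof.
have sE : Num.sqrt (8 * n * p)%:R = 2 * scale R p' k m.
  rewrite /scale -[2 in RHS](@ger0_norm R)// -sqrtr_sqr -sqrtrM ?sqr_ge0//.
  by congr Num.sqrt; rewrite -natrX -natrM; congr _%:R; lia.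
apply/funext => -[i ab]; rewrite /statistic /vec_coords /scaled_stat/=.
have SE (j : 'I_k) : herm_of (fun a b => moment_coords z (widen_ord (leq_addr m k) j, (a, b)))
    - (s0 R j.+1)%:C%:M = (2^-1)%:C *: \sum_(l < k) (Amat R k j l)%:C *: cseq z l.+1.
  rewrite -[herm_of _]/(hmx (fun ab => moment_coords z (widen_ord (leq_addr m k) j, ab))).
  rewrite hmx_moment_coords addrAC subrr add0r; congr (_ *: _).
  (* The columns of A beyond k vanish in the first k rows. *)
  rewrite big_split_ord/= [X in _ + X]big1 ?addr0; last first.
    move=> l _; rewrite mxE /= leqNgt ltn_addr ?scale0r//.
  by apply: eq_bigr => l _; rewrite !mxE.
under eq_bigr do rewrite SE.
have -> : \sum_(j < k) (invmx (Amat R k) i j)%:C *: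
    ((2^-1)%:C *: (\sum_(l < k) (Amat R k j l)%:C *: cseq z l.+1)) = (2^-1)%:C *: cseq z i.+1.
  transitivity ((2^-1)%:C *: \sum_(l < k) (\sum_j (invmx (Amat R k) i j * Amat R k j l))%:C *: cseq z l.+1).
    under eq_bigr do rewrite scalerA mulrC -scalerA.
    rewrite -scaler_sumr; congr (_ *: _).
    under eq_bigr do rewrite scaler_sumr.
    rewrite exchange_big; apply: eq_bigr => l _; rewrite rmorph_sum scaler_suml.
    by apply: eq_bigr => j _; rewrite scalerA rmorphM.
  have AE l : \sum_j invmx (Amat R k) i j * Amat R k j l = (i == l)%:R.
    by have := congr1 (fun M : 'M[R]_k => M i l) (mulVmx (Amat_unit R k)); rewrite /= [LHS]mxE mxE.
  congr (_ *: _); under eq_bigr do rewrite AE.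
  rewrite (bigD1 i)//= big1 ?addr0 ?eqxx ?scale1r// => l li.
  by rewrite eq_sym (negbTE li) scale0r.
rewrite scalerA -rmorphM/= sE mulrAC mulfV// mul1r -hmxZ herm_coordsK.
by [].
Qed.

Lemma blocks_cat : blocks p' 0 n = blocks p' 0 k ++ blocks p' k m.
Proof. by rewrite /blocks iotaD map_cat flatten_cat add0n. Qed.

Local Notation W x := (\1_(@moment_space R p n) x : R).
Local Notation sk := (blocks p' 0 k).
Local Notation RN := (RI R (nat * idx)%type).

Definition weighted_int (g : (Ik -> R) -> R) : \bar R :=
  iter_leb_int sk (fun w => (@scaled_weight R p' k m w * g (restrict_coords w))%:E) (fun=> 0).

Lemma measurable_scale_fun (t : R) : measurable_fun [set: RN] ((fun z j => t * z j) : RN -> RN).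
Proof.
apply: measurable_into_RI => j; apply: measurable_funM; first exact: measurable_cst.
exact: measurable_coord.
Qed.

(** The constant collects the Jacobian of the passage to the C_j, the fibre volumes and the
    rescaling. It precedes [g] in the quantifiers, so it cancels in expectations. *)
Lemma moment_integral : exists2 c : R, 0 < c & forall (g : (Ik -> R) -> R) (B : R),
  measurable_fun [set: RI R Ik] (g : RI R Ik -> R) -> (forall y, 0 <= g y <= B) ->
  leb_int (fun x => (W x * g (statistic x))%:E) = (c%:E * weighted_int g)%E.
Proof.
have [c1 c10 Hc1] := leb_int_moment_coords R p' n.
have [K K0 HK] := @fibre_volumes R p' k m 0.
set t := (scale R p' k m)^-1.
have t0 : 0 < t by rewrite invr_gt0 scale_gt0.
pose c2 : R := t ^+ size sk.
have c20 : 0 < c2 by rewrite exprn_gt0.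
exists (c1 * K * c2); first by rewrite !mulr_gt0.
move=> g B mg gB.
have g0 y : 0 <= g y by have /andP[] := gB y.
have statE x : statistic x = restrict_coords (fun j => scale R p' k m * cheb_coords x j).
  by rewrite -{1}(cheb_coordsK x) statistic_coords.
pose G (z : nat * idx -> R) := g (restrict_coords (fun j => scale R p' k m * z j)).
have G0 z : 0 <= G z by exact: g0.
have mG : measurable_fun [set: RN] (G : RN -> R).
  apply: (measurableT_comp mg); apply: (measurableT_comp (@measurable_restrict_coords R p' k)).
  exact: measurable_scale_fun.
have mf : measurable_fun [set: RI R In] ((fun x => (W x * g (statistic x))%:E) : RI R In -> \bar R).
  apply/measurable_EFinP/measurable_funM; first exact: measurable_moment_space.
  rewrite (_ : (fun _ => _) = G \o @cheb_coords R p' n).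
    exact: (measurableT_comp mG (@measurable_cheb_coords R p' n)).
  by apply/funext => x; rewrite statE.
rewrite (Hc1 _ mf); last by move=> x; rewrite lee_fin mulr_ge0.
have -> : ((fun x => (W x * g (statistic x))%:E) \o @moment_coords R p' n) =
    (fun z => (psd_ind n z * G z)%:E).
  by apply/funext => z /=; rewrite moment_space_coords statistic_coords.
rewrite (@psd_pd_integral R p' n G B mG); last by move=> z; exact: gB.
rewrite blocks_cat iter_leb_int_cat.
(* [G] depends on the first k blocks only, so it is constant along the fibre; [pd_ind] is the weight
   with exponent 0, which becomes exponent [m * p]. *)
have inner y : iter_leb_int (blocks p' k m) (fun z => (pd_ind n z * G z)%:E) y =
    (K%:E * (toep_weight k (m * p) y * G y)%:E)%E.
  rewrite (@eq_iter_leb_int _ _ _ _ (fun z => (G y)%:E * (toep_weight n 0 z)%:E)%E); last first.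
    move=> z zy; rewrite /toep_weight expr0 mulr1 -EFinM mulrC; congr (_ * _)%:E.
    rewrite /G; congr g; apply/funext => -[l ab]; rewrite /restrict_coords/=; congr (_ * _).
    by apply: zy; rewrite mem_blocks/= leqNgt ltn_ord.
  rewrite (@iter_leb_intZ R _ _ (fun z => (toep_weight n 0 z)%:E)).
  - by rewrite HK add0n -!EFinM; congr EFin; ring.
  - by apply/measurable_EFinP; exact: measurable_toep_weight.
  - by move=> z; rewrite lee_fin toep_weight_ge0.
  - by rewrite lee_fin G0.
rewrite (_ : iter_leb_int (blocks p' k m) _ = fun y => (K%:E * (toep_weight k (m * p) y * G y)%:E)%E); last first.
  by apply/funext.
have mF : measurable_fun [set: RN] ((fun y => (toep_weight k (m * p) y * G y)%:E) : RN -> \bar R).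
  by apply/measurable_EFinP/measurable_funM => //; exact: measurable_toep_weight.
have F0 y : (0 <= (toep_weight k (m * p) y * G y)%:E)%E.
  by rewrite lee_fin mulr_ge0 ?toep_weight_ge0 ?G0.
rewrite (@iter_leb_intZ R _ _ (fun y => (toep_weight k (m * p) y * G y)%:E))//; last by rewrite lee_fin ltW.
suff -> : weighted_int g = ((c2^-1)%:E * iter_leb_int sk (fun y => (toep_weight k (m * p) y * G y)%:E) (fun=> 0%R))%E.
  by rewrite !muleA -!EFinM; congr (_%:E * _)%E; field; rewrite gt_eqF.
have := @iter_leb_int_affine _ _ sk (fun=> t) (fun=> 0) _ (fun=> 0) (blocks_uniq p' 0 k) (fun=> t0) mF F0.
have -> : \prod_(j <- sk) t^-1 = c2^-1.
  by rewrite big_const_seq count_predT iter_mulr_1 exprVn.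
move=> <-; apply: eq_iter_leb_int => w w0.
(* The integration starts from the zero sequence, so scaling the coordinates in [sk] is the same as
   scaling all of them. *)
have -> : affine_on sk (fun=> t) (fun=> 0) w = (fun j => t * w j).
  apply/funext => j; rewrite /affine_on; case: ifPn => [_|/w0 ->]; first by rewrite addr0.
  by rewrite mulr0.
rewrite /scaled_weight /G -/t; congr (_ * g _)%:E.
by apply/funext => j; rewrite /restrict_coords mulrA mulfV ?mul1r// gt_eqF// scale_gt0.
Qed.

Lemma fine_sub_mul (X Y : \bar R) (B : R) : (0 <= X < +oo)%E -> (0 <= Y < +oo)%E ->
  fine (X - B%:E * Y)%E = fine X - B * fine Y.
Proof.
move=> /andP[X0 X1] /andP[Y0 Y1].
by rewrite -{1}(@fineK _ X) ?ge0_fin_numE// -{1}(@fineK _ Y) ?ge0_fin_numE.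
Qed.

Lemma expect_statE (h : (Ik -> R) -> R) (B : R) :
  measurable_fun [set: RI R Ik] (h : RI R Ik -> R) -> (forall y, `|h y| <= B) ->
  0 < fine (weighted_int (fun=> 1)) ->
  @expect_stat R p k m h =
  (fine (weighted_int (fun y => h y + B)) - B * fine (weighted_int (fun=> 1)))
    / fine (weighted_int (fun=> 1)).
Proof.
move=> mh hB I1.
have [c c0 Hc] := moment_integral.
have B0 : 0 <= B by exact: le_trans (normr_ge0 _) (hB (fun=> 0)).
have WE1 : leb_int (fun x => (W x)%:E) = (c%:E * weighted_int (fun=> 1%R))%E.
  rewrite -(Hc _ 1); [|exact: measurable_cst|by move=> y; rewrite ler01 lexx].
  by congr leb_int; apply/funext => x; rewrite mulr1.
have hB0 y : 0 <= h y + B <= B + B.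
  by have := hB y; rewrite ler_norml => /andP[h1 h2]; rewrite -lerBlDr sub0r h1/= lerD2r.
have mhB : measurable_fun [set: RI R Ik] ((fun y => h y + B) : RI R Ik -> R).
  by apply: measurable_funD => //; exact: measurable_cst.
have mW := @measurable_moment_space R p' n.
have statE x : statistic x = restrict_coords (fun j => scale R p' k m * cheb_coords x j).
  by rewrite -{1}(cheb_coordsK x) statistic_coords.
have mstat : measurable_fun [set: RI R In] (statistic : RI R In -> RI R Ik).
  rewrite (_ : statistic = (@restrict_coords R p' k) \o (fun z j => scale R p' k m * z j) \o @cheb_coords R p' n).
    apply: (measurableT_comp (measurableT_comp (@measurable_restrict_coords R p' k) (measurable_scale_fun _))).
    exact: measurable_cheb_coords.
  by apply/funext => x; rewrite statE.
have Wfin : (leb_int (fun x : In -> R => (W x)%:E) < +oo)%E.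
  by apply: moment_space_lty; exact: suffix_refl.
have W0 : (0 <= leb_int (fun x : In -> R => (W x)%:E))%E.
  by apply: leb_int_ge0 => x; rewrite lee_fin.
have NE : leb_int (fun x => (W x * h (statistic x))%:E) =
   (leb_int (fun x => (W x * (h (statistic x) + B))%:E) - B%:E * leb_int (fun x => (W x)%:E))%E.
  apply: iter_leb_int_signed => //.
  - exact: (measurableT_comp mh mstat).
  - by move=> r x rs; exact: moment_space_lty.
have NBfin : (leb_int (fun x => (W x * (h (statistic x) + B))%:E) < +oo)%E.
  apply: (@le_lt_trans _ _ ((B + B)%:E * leb_int (fun x : In -> R => (W x)%:E))%E); last first.
    by rewrite lte_mul_pinfty// lee_fin addr_ge0.
  rewrite /leb_int -(@iter_leb_intZ R _ _ (fun x => (W x)%:E)).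
  - apply: le_iter_leb_int.
    + by apply/measurable_EFinP/measurable_funM => //; exact: (measurableT_comp mhB mstat).
    + by apply/measurable_EFinP/measurable_funM => //; exact: measurable_cst.
    + by move=> x; have /andP[a _] := hB0 (statistic x); rewrite lee_fin mulr_ge0.
    + by move=> x; have /andP[_ a] := hB0 (statistic x); rewrite -EFinM lee_fin mulrC ler_wpM2r.
  - exact/measurable_EFinP.
  - by move=> x; rewrite lee_fin.
  - by rewrite lee_fin addr_ge0.
have NB0 : (0 <= leb_int (fun x => (W x * (h (statistic x) + B))%:E))%E.
  by apply: leb_int_ge0 => x; have /andP[a _] := hB0 (statistic x); rewrite lee_fin mulr_ge0.
have NBE := Hc _ _ mhB hB0.
rewrite /expect_stat -/(statistic _) NE.
(* Positivity of the [fine] value also excludes an infinite integral, for which [fine] returns 0. *)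
have fW : fine (leb_int (fun x : In -> R => (W x)%:E)) = c * fine (weighted_int (fun=> 1)).
  by rewrite WE1; case: (weighted_int _) I1 => [r| |] //=; rewrite ltxx.
rewrite fine_sub_mul ?NB0 ?W0// NBE fW.
have -> : fine (c%:E * weighted_int (fun y => (h y + B)%R))%E = c * fine (weighted_int (fun y => h y + B)).
  rewrite NBE in NBfin NB0; move: NBfin NB0; case: (weighted_int _) => [r| |] //=.
  - by rewrite gt0_muley ?lte_fin.
  - by rewrite gt0_muleNy ?lte_fin.
by field; rewrite !gt_eqF.
Qed.
End Statistic.

(** * The Gaussian limit *)

Section GaussianIntegral.
Variable R : realType.
Local Notation mu := (@lebesgue_measure R).

Definition gauss (a t : R) : R := expR (- (a * t ^+ 2)).

Lemma gauss_scaled (a : R) : 0 < a -> gauss a = gauss_fun \o (fun t => Num.sqrt a * t + 0).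
Proof.
move=> a0; apply/funext => t; rewrite /gauss /gauss_fun/= addr0 exprMn sqr_sqrtr//.
exact: ltW.
Qed.

Lemma measurable_gauss (a : R) : 0 < a -> measurable_fun [set: R] (gauss a).
Proof.
move=> a0; rewrite gauss_scaled//; apply: measurableT_comp; first exact: measurable_gauss_fun.
by apply: measurable_funD => //; apply: measurable_funM => //; exact: measurable_cst.
Qed.

Lemma integral_gauss (a : R) : 0 < a ->
  (\int[mu]_t (gauss a t)%:E = (Num.sqrt pi / Num.sqrt a)%:E)%E.
Proof.
move=> a0; have sa0 : 0 < Num.sqrt a by rewrite sqrtr_gt0.
have mg : measurable_fun setT (EFin \o @gauss_fun R).
  by apply/measurable_EFinP; exact: measurable_gauss_fun.
have g0 t : (0 <= (EFin \o @gauss_fun R) t)%E by rewrite lee_fin gauss_fun_ge0.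
have := ge0_integral_affine 0 sa0 mg g0; rewrite integralT_gauss.
rewrite -EFinM mulrC => <-; apply: eq_integral => t _.
by rewrite gauss_scaled.
Qed.
End GaussianIntegral.

Section Energy.
Variables (R : realType) (p' k : nat).
Local Notation p := p'.+1.
Local Notation C := R[i].
Local Notation idx := ('I_p * 'I_p)%type.
Local Notation sk := (blocks p' 0 k).
Implicit Types w : nat * idx -> R.

(** In tr X^2 the real and imaginary part of an off-diagonal entry are counted twice, once for each
    of the two conjugate entries. *)
Definition multiplicity (ab : idx) : R := if ab.1 == ab.2 then 1 else 2.

Lemma multiplicity_gt0 ab : 0 < multiplicity ab.
Proof. by rewrite /multiplicity; case: ifP. Qed.

Lemma frob_hmx (y : idx -> R) : frob (hmx y) = \sum_ab multiplicity ab * y ab ^+ 2.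
Proof.
rewrite [RHS](eq_bigr (fun ab => multiplicity (ab.1, ab.2) * y (ab.1, ab.2) ^+ 2)); last by move=> [].
rewrite -(pair_bigA _ (fun a b => multiplicity (a, b) * y (a, b) ^+ 2))/=.
have hE a b : complex.Re (hmx y a b) ^+ 2 + complex.Im (hmx y a b) ^+ 2 =
  (if a == b then y (a, b) ^+ 2 else y (a, b) ^+ 2 + y (b, a) ^+ 2).
  rewrite mxE; case: eqP => [->|ab] /=; first by rewrite expr0n addr0.
  by case: ifP => _ /=; rewrite // sqrrN addrC.
transitivity ((\sum_a \sum_b (if a == b then 0 else y (b, a) ^+ 2)) + \sum_a \sum_b y (a, b) ^+ 2).
  rewrite -big_split/=; apply: eq_bigr => a _; rewrite -big_split/=; apply: eq_bigr => b _; rewrite hE.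
  by case: eqP => [->|_]; rewrite ?add0r// addrC.
rewrite exchange_big/= -big_split/=.
apply: eq_bigr => a _; rewrite -big_split/=; apply: eq_bigr => b _.
rewrite /multiplicity/= eq_sym; case: eqP => [->|_]; first by rewrite add0r mul1r.
by rewrite mulr_natl mulr2n.
Qed.

Lemma big_blocks (T : Type) (x : T) (op : Monoid.com_law x) n (F : nat * idx -> T) :
  \big[op/x]_(j <- blocks p' 0 n) F j = \big[op/x]_(l < n) \big[op/x]_(ab : idx) F (val l, ab).
Proof.
elim: n => [|n IH]; first by rewrite /blocks big_nil big_ord0.
by rewrite blocks_succ big_cat big_ord_recr IH add0n /block big_map big_enum.
Qed.

Lemma energyE w : energy k w = \sum_(j <- sk) multiplicity j.2 * w j ^+ 2.
Proof. by rewrite big_blocks; apply: eq_bigr => l _; rewrite frob_hmx. Qed.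

Lemma expR_energy (c : R) w :
  expR (- (c * energy k w)) = \prod_(j <- sk) gauss (c * multiplicity j.2) (w j).
Proof.
rewrite energyE mulr_sumr -sumrN expR_sum; apply: eq_bigr => j _.
by rewrite /gauss mulrA.
Qed.

Lemma iter_energy_lty (c B : R) r x : 0 < c -> 0 <= B -> suffix r sk ->
  (iter_leb_int r (fun w => (B * expR (- (c * energy k w)))%:E) x < +oo)%E.
Proof.
move=> c0 B0 rs.
have cm0 (j : nat * idx) : 0 < c * multiplicity j.2 by rewrite mulr_gt0 ?multiplicity_gt0.
under [X in iter_leb_int _ X]eq_fun do rewrite expR_energy.
apply: (iter_leb_int_prod_lty (u := fun j => gauss (c * multiplicity j.2))
  (v := fun j => Num.sqrt pi / Num.sqrt (c * multiplicity j.2))) => //.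
- exact: blocks_uniq.
- by move=> j; exact: measurable_gauss.
- by move=> j t; exact: expR_ge0.
- by move=> j; exact: integral_gauss.
Qed.

Lemma measurable_energy : measurable_fun [set: RI R (nat * idx)%type] (energy k : RI R (nat * idx)%type -> R).
Proof.
rewrite (_ : energy k = fun w => \sum_(j <- sk) multiplicity j.2 * w j ^+ 2); last first.
  by apply/funext => w; rewrite energyE.
apply: measurable_sum => j; apply: measurable_funM; first exact: measurable_cst.
by apply: measurable_funX; exact: measurable_coord.
Qed.

Lemma measurable_expR_energy (c : R) : measurable_fun [set: RI R (nat * idx)%type]
  ((fun w => expR (- (c * energy k w))) : RI R (nat * idx)%type -> R).
Proof.
apply: measurableT_comp; first exact: measurable_expR.
apply: measurableT_comp => //; apply: measurable_funM; first exact: measurable_cst.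
exact: measurable_energy.
Qed.

Definition gue_const : R := Num.sqrt (2 * pi) ^+ p * pi ^+ 'C(p, 2).

Lemma gue_const_gt0 : 0 < gue_const.
Proof. by rewrite mulr_gt0 ?exprn_gt0 ?sqrtr_gt0 ?mulr_gt0 ?pi_gt0. Qed.

Lemma iter_energy : iter_leb_int sk (fun w => (expR (- (energy k w / 2)))%:E) (fun=> 0) =
  (gue_const ^+ k)%:E.
Proof.
have cm0 (j : nat * idx) : 0 < 2^-1 * multiplicity j.2 by rewrite mulr_gt0 ?multiplicity_gt0.
transitivity (iter_leb_int sk (fun w => (1 * \prod_(j <- sk) gauss (2^-1 * multiplicity j.2) (w j))%:E) (fun=> 0)).
  by apply: eq_iter_leb_int => w _; rewrite mul1r -expR_energy [_ / 2]mulrC.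
rewrite (iter_leb_int_prod (K := fun=> 1) (u := fun j => gauss (2^-1 * multiplicity j.2))
  (v := fun j => Num.sqrt pi / Num.sqrt (2^-1 * multiplicity j.2)))//; last 4 first.
- exact: blocks_uniq.
- by move=> j; exact: measurable_gauss.
- by move=> j t; exact: expR_ge0.
- by move=> j; exact: integral_gauss.
rewrite mul1r big_blocks; congr _%:E.
rewrite (eq_bigr (fun=> gue_const)); first by rewrite prodr_const card_ord.
move=> l _ /=.
rewrite -(pair_big xpredT xpredT (fun a b => Num.sqrt pi / Num.sqrt (2^-1 * multiplicity (a, b))))/=.
have spi : Num.sqrt pi ^+ 2 = pi :> R by rewrite sqr_sqrtr// pi_ge0.
(* In each row the diagonal coordinate has weight exp(-y^2/2) and contributes sqrt(2 pi), and each
   of the p - 1 others has weight exp(-y^2) and contributes sqrt(pi). *)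
rewrite (eq_bigr (fun=> Num.sqrt (2 * pi) * Num.sqrt pi ^+ p')).
  rewrite prodr_const card_ord exprMn -exprM /gue_const; congr (_ * _).
  rewrite -{2}spi -exprM; congr (_ ^+ _).
  have := odd_double_half (p * p'); rewrite oddM /= andNb add0n => H.
  by rewrite bin2 mul2n H mulnC.
move=> a _; rewrite (bigD1 a)//=; congr (_ * _).
  by rewrite /multiplicity/= eqxx mulr1 sqrtrV// invrK sqrtrM// mulrC.
rewrite (eq_bigr (fun=> Num.sqrt pi)).
  rewrite prodr_const; congr (_ ^+ _).
  by rewrite cardC1 card_ord.
move=> b ba; rewrite /multiplicity/= eq_sym (negbTE ba) mulVf//.
by rewrite sqrtr1 divr1.
Qed.
End Energy.

Section Limit.
Variables (R : realType) (p' k : nat).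
Hypothesis k_gt0 : (0 < k)%N.
Local Notation p := p'.+1.
Local Notation C := R[i].
Local Notation idx := ('I_p * 'I_p)%type.
Local Notation Ik := ('I_k * idx)%type.
Local Notation sk := (blocks p' 0 k).
Local Notation RN := (RI R (nat * idx)%type).

Definition gauss_int (g : (Ik -> R) -> R) : \bar R :=
  iter_leb_int sk (fun w => (expR (- (energy k w / 2)) * g (restrict_coords w))%:E) (fun=> 0).

Lemma measurable_scaled_weight m :
  measurable_fun [set: RN] (@scaled_weight R p' k m : RN -> R).
Proof.
exact: (measurableT_comp (@measurable_toep_weight R p' k (m * p)) (measurable_scale_fun _)).
Qed.

Lemma measurable_gauss_weight :
  measurable_fun [set: RN] ((fun w => expR (- (energy k w / 2))) : RN -> R).
Proof.
rewrite (_ : (fun _ => _) = fun w => expR (- (2^-1 * energy k w))).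
  exact: measurable_expR_energy.
by apply/funext => w; rewrite [_ / 2]mulrC.
Qed.

Section Bounded.
Variables (g : (Ik -> R) -> R) (B : R).
Hypotheses (mg : measurable_fun [set: RI R Ik] (g : RI R Ik -> R)) (gB : forall y, 0 <= g y <= B).

Let B0 : 0 <= B.
Proof. by have /andP[a b] := gB (fun=> 0); exact: le_trans b. Qed.

Let mgr : measurable_fun [set: RN] ((fun w => g (restrict_coords w)) : RN -> R).
Proof. exact: (measurableT_comp mg (@measurable_restrict_coords R p' k)). Qed.

Lemma gauss_int_fin : gauss_int g \is a fin_num.
Proof.
rewrite ge0_fin_numE; last first.
  by apply: iter_leb_int_ge0 => w; have /andP[g0 _] := gB (restrict_coords w);
    rewrite lee_fin mulr_ge0// expR_ge0.
have h0 : 0 < 2^-1 :> R by [].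
apply: le_lt_trans (iter_energy_lty (fun=> 0) h0 B0 (suffix_refl sk)).
apply: le_iter_leb_int.
- by apply/measurable_EFinP/measurable_funM => //; exact: measurable_gauss_weight.
- apply/measurable_EFinP/measurable_funM; first exact: measurable_cst.
  exact: measurable_expR_energy.
- by move=> w; have /andP[g0 _] := gB (restrict_coords w); rewrite lee_fin mulr_ge0// expR_ge0.
- move=> w; have /andP[_ g1] := gB (restrict_coords w).
  by rewrite lee_fin [energy k w / 2]mulrC [leRHS]mulrC ler_wpM2l// expR_ge0.
Qed.

(** Dominated convergence with the Gaussian majorant of [scaled_weight_le], which is available from
    m = 1 on; this explains [m.+1]. *)
Lemma weighted_int_cvg :
  (fun m => fine (weighted_int m.+1 g)) @ \oo --> fine (gauss_int g).
Proof.
apply: fine_cvg; rewrite fineK ?gauss_int_fin//.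
pose c : R := (2 * k%:R * (k%:R + 1) * p%:R)^-1.
have c0 : 0 < c by rewrite invr_gt0 !mulr_gt0// ?ltr0n// addr_gt0// ltr0n.
apply: (@iter_leb_int_cvg _ _ sk
  (fun m w => (@scaled_weight R p' k m.+1 w * g (restrict_coords w))%:E) _
  (fun w => (B * expR (- (c * energy k w)))%:E)).
- by move=> m; apply/measurable_EFinP/measurable_funM => //; exact: measurable_scaled_weight.
- move=> m w; have /andP[g0 _] := gB (restrict_coords w).
  by rewrite lee_fin mulr_ge0// toep_weight_ge0.
- move=> m w; have /andP[g0 g1] := gB (restrict_coords w).
  rewrite lee_fin mulrC ler_pM// ?toep_weight_ge0//.
  by apply: le_trans (scaled_weight_le _ _ _) _ => //; rewrite [c * _]mulrC.
- apply/measurable_EFinP/measurable_funM; first exact: measurable_cst.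
  exact: measurable_expR_energy.
- by move=> r x rs; exact: iter_energy_lty.
move=> w; apply: cvg_EFin; first by near=> m.
apply: cvgMl; have := @scaled_weight_cvg R p' k k_gt0 w.
by rewrite -cvg_shiftS.
Unshelve. all: by end_near.
Qed.
End Bounded.

Lemma gauss_int1 : fine (gauss_int (fun=> 1)) = gue_const R p' ^+ k.
Proof.
rewrite /gauss_int (_ : (fun w => _) = fun w => (expR (- (energy k w / 2)))%:E).
  by rewrite iter_energy.
by apply/funext => w; rewrite mulr1.
Qed.

Let gue_weight (y : Ik -> R) : R :=
  \prod_(j < k) gue_density (herm_of (fun a b => y (j, (a, b)))).

Let gue_weightE w : gue_weight (restrict_coords w) = (gue_const R p' ^+ k)^-1 * expR (- (energy k w / 2)).
Proof.
rewrite /gue_weight /gue_density -/(gue_const R p').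
under eq_bigr => j _.
  have -> : herm_of (fun a b => restrict_coords w (j, (a, b))) = hmx (fun ab => w (val j, ab)) by [].
  rewrite -{2}(hmx_adj (fun ab => w (val j, ab))) frobE/=.
  over.
rewrite big_split/= prodr_const card_ord exprVn mulrC; congr (_ * _).
rewrite -expR_sum; congr expR; rewrite /energy mulr_suml -sumrN.
by apply: eq_bigr => j _; rewrite mulNr.
Qed.

(** Brings the Gaussian expectation to the same form as [expect_statE], as a quotient of integrals
    of h + B and 1, so that the limit can be taken term by term. *)
Lemma expect_GUEE (h : (Ik -> R) -> R) (B : R) :
  measurable_fun [set: RI R Ik] (h : RI R Ik -> R) -> (forall y, `|h y| <= B) ->
  @expect_GUE R p k h =
  (fine (gauss_int (fun y => h y + B)) - B * fine (gauss_int (fun=> 1))) / fine (gauss_int (fun=> 1)).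
Proof.
move=> mh hB.
have B0 : 0 <= B by exact: le_trans (normr_ge0 _) (hB (fun=> 0)).
have q0 := exprn_gt0 k (gue_const_gt0 R p').
set q := gue_const R p' ^+ k in q0 *.
have gwE y : gue_weight y = q^-1 * expR (- (energy k (extend_coords y) / 2)).
  by rewrite -gue_weightE extend_coordsK.
have gw0 y : 0 <= gue_weight y by rewrite gwE mulr_ge0 ?invr_ge0 ?ltW// expR_gt0.
have mext : measurable_fun [set: RI R Ik] (@extend_coords R p' k : RI R Ik -> RN).
  apply: measurable_into_RI => -[l ab]; rewrite /extend_coords/=.
  by case: insub => [j|]; [exact: measurable_coord|exact: measurable_cst].
have mgw : measurable_fun [set: RI R Ik] (gue_weight : RI R Ik -> R).
  rewrite (_ : gue_weight = fun y => q^-1 * expR (- (energy k (extend_coords y) / 2))); last exact/funext.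
  apply: measurable_funM; first exact: measurable_cst.
  exact: (measurableT_comp measurable_gauss_weight mext).
have Hg (g : (Ik -> R) -> R) (B' : R) : measurable_fun [set: RI R Ik] (g : RI R Ik -> R) ->
    (forall y, 0 <= g y <= B') ->
    leb_int (fun y => (gue_weight y * g y)%:E) = (q^-1%:E * gauss_int g)%E.
  move=> mg gB; rewrite leb_int_restrict_coords; last 2 first.
  - by apply/measurable_EFinP/measurable_funM.
  - by move=> y; have /andP[g0 _] := gB y; rewrite lee_fin mulr_ge0.
  rewrite /gauss_int -(@iter_leb_intZ R _ _ (fun w => (expR (- (energy k w / 2)) * g (restrict_coords w))%:E)).
  - by congr iter_leb_int; apply/funext => w /=; rewrite gue_weightE -EFinM mulrA.
  - apply/measurable_EFinP/measurable_funM; first exact: measurable_gauss_weight.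
    exact: (measurableT_comp mg (@measurable_restrict_coords R p' k)).
  - by move=> w; have /andP[g0 _] := gB (restrict_coords w); rewrite lee_fin mulr_ge0 ?expR_ge0.
  - by rewrite lee_fin invr_ge0 ltW.
have hB0 y : 0 <= h y + B <= B + B.
  by have := hB y; rewrite ler_norml => /andP[h1 h2]; rewrite -lerBlDr sub0r h1/= lerD2r.
have mhB : measurable_fun [set: RI R Ik] ((fun y => h y + B) : RI R Ik -> R).
  by apply: measurable_funD => //; exact: measurable_cst.
have one01 (y : Ik -> R) : 0 <= (1 : R) <= 1 by rewrite ler01 lexx.
have m1 : measurable_fun [set: RI R Ik] ((fun=> 1) : RI R Ik -> R) by exact: measurable_cst.
have E1 := Hg _ _ m1 one01.
have EB := Hg _ _ mhB hB0.
have F1 := gauss_int_fin m1 one01.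
have FB := gauss_int_fin mhB hB0.
have gwprod y : gue_weight y = q^-1 * \prod_(j <- enum {: Ik}) gauss (2^-1 * multiplicity R j.2) (y j).
  rewrite gwE [_ / 2]mulrC expR_energy; congr (_ * _).
  rewrite big_blocks [RHS]big_enum/= [RHS](eq_bigr (fun j : Ik => gauss (2^-1 * multiplicity R j.2) (y (j.1, j.2)))); last by move=> [].
  rewrite -(pair_bigA _ (fun j ab => gauss (2^-1 * multiplicity R ab) (y (j, ab))))/=.
  apply: eq_bigr => j _; apply: eq_bigr => ab _; by rewrite /extend_coords/= valK.
have -> : @expect_GUE R p k h = fine (leb_int (fun y => (gue_weight y * h y)%:E)) by [].
have -> : leb_int (fun y => (gue_weight y * h y)%:E) =
  (leb_int (fun y => (gue_weight y * (h y + B))%:E) - B%:E * leb_int (fun y => (gue_weight y * 1)%:E))%E.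
  have := @iter_leb_int_signed R _ (enum {: Ik}) gue_weight h B (fun=> 0) mgw mh gw0 hB.
  rewrite /leb_int => ->.
    by congr (_ - _ * iter_leb_int _ _ _)%E; apply/funext => y; rewrite mulr1.
  move=> r x rs; under [X in iter_leb_int _ X]eq_fun do rewrite gwprod.
  have cm0 (j : Ik) : 0 < 2^-1 * multiplicity R j.2 by rewrite mulr_gt0 ?multiplicity_gt0.
  apply: (iter_leb_int_prod_lty (u := fun j => gauss (2^-1 * multiplicity R j.2))
    (v := fun j => Num.sqrt pi / Num.sqrt (2^-1 * multiplicity R j.2))) => //.
  - exact: enum_uniq.
  - by move=> j; exact: measurable_gauss.
  - by move=> j t; exact: expR_ge0.
  - by move=> j; exact: integral_gauss.
  - by rewrite invr_ge0 ltW.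
rewrite E1 EB -(fineK F1) -(fineK FB) -!EFinM -EFinB/= gauss_int1 -/q.
by field; rewrite gt_eqF.
Qed.
End Limit.

(* Convergence in distribution, stated via bounded continuous test functions
   (on the real coordinates of (S_p(C))^k); the sequence is indexed by
   n = k + m, m -> oo. *)
Theorem theorem5p3 (R : realType) (p k : nat) :
  (0 < p)%N -> (0 < k)%N ->
  forall h : ('I_k * ('I_p * 'I_p) -> R) -> R,
    @bounded_continuous R _ h ->
    (fun m : nat => @expect_stat R p k m h) @ \oo --> @expect_GUE R p k h.
Proof.
case: p => // p' _ k_gt0 h bch.
have mh := bounded_continuous_measurable bch.
have [[B hB] _] := bch.
have B0 : 0 <= B by exact: le_trans (normr_ge0 _) (hB (fun=> 0)).
have hB0 y : 0 <= h y + B <= B + B.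
  by have := hB y; rewrite ler_norml => /andP[h1 h2]; rewrite -lerBlDr sub0r h1/= lerD2r.
have mhB : measurable_fun [set: RI R _] ((fun y => h y + B) : RI R ('I_k * ('I_p'.+1 * 'I_p'.+1))%type -> R).
  by apply: measurable_funD => //; exact: measurable_cst.
have one01 (y : 'I_k * ('I_p'.+1 * 'I_p'.+1) -> R) : 0 <= (1 : R) <= 1 by rewrite ler01 lexx.
have m1 : measurable_fun [set: RI R _] ((fun=> 1 : R) : RI R ('I_k * ('I_p'.+1 * 'I_p'.+1))%type -> R) by exact: measurable_cst.
have c1 := weighted_int_cvg k_gt0 m1 one01.
have cB := weighted_int_cvg k_gt0 mhB hB0.
have J1 : 0 < fine (@gauss_int R p' k (fun=> 1)) by rewrite gauss_int1 exprn_gt0// gue_const_gt0.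
have cB1 : (fun m => B * fine (@weighted_int R p' k m.+1 (fun=> 1))) @ \oo -->
    B * fine (@gauss_int R p' k (fun=> 1)) by apply: cvgMr.
have cV : (fun m => (fine (@weighted_int R p' k m.+1 (fun=> 1)))^-1) @ \oo -->
    (fine (@gauss_int R p' k (fun=> 1)))^-1 by apply: cvgV => //; exact: lt0r_neq0.
have lim := cvgM (cvgB cB cB1) cV.
rewrite (expect_GUEE mh hB) -cvg_shiftS.
apply: cvg_trans (lim _ _); apply: near_eq_cvg; near=> m.
apply/esym/expect_statE => //.
(* The normalising integral tends to a positive number, so it is positive for large [m], as
   [expect_statE] requires. *)
near: m; exact: (cvgr_gt _ c1 _ J1).
Unshelve. all: by end_near.
Qed.
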